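(* There is a $\Pi^0_2$ predicate $\operatorname{Disint}\subseteq(\mathbb{N}^\mathbb{N})^3$ such that for all $f,g,h\in\mathbb{N}^\mathbb{N}$, if $f$ names a Banach space presentation $\mathcal{B}^\#$ and $h$ names a real $p\ge1$, then $\operatorname{Disint}(f,g,h)$ holds if and only if $g$ names an $L^p$-formal disintegration of $\mathcal{B}^\#$.
   Context: The scalar field is $\mathbb{R}$ or $\mathbb{C}$, with rational scalars $\mathbb{F}_\mathbb{Q}=\mathbb{F}\cap\mathbb{Q}(i)$. A presentation $\mathcal{B}^\#=(\mathcal{B},R)$ of a Banach space $\mathcal{B}$ has $R:\mathbb{N}\to\mathcal{B}$ with linearly dense range; its rational vectors are finite $\mathbb{F}_\mathbb{Q}$-combinations of the $R(n)$, coded by numbers via a fixed Gödel numbering of formal expressions; its rational open balls are open balls with rational-vector center and positive rational radius, coded presentation-independently, $B(\mathcal{B}^\#;n)$ being the $n$-th. With $I_n$ the $n$-th rational open interval, the diagram of $\mathcal{B}^\#$ is the set of codes of pairs $(m,n)$ with the norm of the $m$-th rational vector in $I_n$; a name of $\mathcal{B}^\#$ is any $f\in\mathbb{N}^\mathbb{N}$ with range equal to the diagram. A name of a real $p$ is a standard name from computable analysis (e.g. a code of a sequence of rationals $q_k$ with $|q_k-p|<2^{-k}$). A vector tree of $\mathcal{B}$ is an injective map $\psi$ from a tree $S\subseteq\omega^{<\omega}$ into $\mathcal{B}$; a name of $\psi$ (relative to $\mathcal{B}^\#$) is an enumeration (as an element of $\mathbb{N}^\mathbb{N}$, via coding) of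 the set of all finite subsets of $\{(\nu,n):\nu\in S,\ \psi(\nu)\in B(\mathcal{B}^\#;n)\}$. Vectors $v_1,\dots,v_n$ are $L^p$-formally disjointly supported if $\|\sum\alpha_jv_j\|^p=\sum|\alpha_j|^p\|v_j\|^p$ for all scalars. $\psi$ is summative if $\psi(\nu)=\sum_{\nu'}\psi(\nu')$ (over children $\nu'$ of $\nu$ in $S$) for every $\nu\in S$ with a child in $S$; $L^p$-formally separating if images of pairwise incomparable nodes are $L^p$-formally disjointly supported; an $L^p$-formal disintegration is a summative $L^p$-formally separating vector tree omitting $\mathbf{0}$ with linearly dense range. $\Pi^0_2$ refers to the lightface arithmetical hierarchy on $(\mathbb{N}^\mathbb{N})^3$. *)

(* Defs.v *)
From HB Require Import structures.
From mathcomp Require Import all_boot all_order all_algebra.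
From mathcomp Require Import all_classical all_reals all_analysis.
From mathcomp Require Import complex.

Set Implicit Arguments.
Unset Strict Implicit.
Unset Printing Implicit Defensive.

Import Order.TTheory GRing.Theory Num.Theory.
Import numFieldNormedType.Exports.

Local Open Scope classical_set_scope.
Local Open Scope ring_scope.

(* Finite sequences of naturals <-> naturals (a bijection, from choice.v). *)
Definition seq_code (s : seq nat) : nat := CodeSeq.code s.
Definition seq_decode (n : nat) : seq nat := CodeSeq.decode n.

Definition pair_code (a b : nat) : nat := seq_code [:: a; b].
Definition unpair (n : nat) : nat * nat :=
  (nth 0%N (seq_decode n) 0, nth 0%N (seq_decode n) 1).

Definition rat_of_nat (n : nat) : rat := odflt 0 (unpickle n).

Definition posrat_of_nat (n : nat) : rat :=
  ((unpair n).1.+1)%:R / ((unpair n).2.+1)%:R.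

Definition rat_interval (R : realType) (n : nat) : set R :=
  let a := rat_of_nat (unpair n).1 in
  let l := posrat_of_nat (unpair n).2 in
  [set x : R | ratr a < x < ratr (a + l)].

Definition ratsc_real (R : realType) (n : nat) : R := ratr (rat_of_nat n).
Definition ratsc_cplx (R : realType) (n : nat) : R[i] :=
  Complex (ratr (rat_of_nat (unpair n).1)) (ratr (rat_of_nat (unpair n).2)).

(* Computability is given by (syntactic) primitive recursive          *)
(* functions on lists of naturals; by Kleene's normal form a predicate *)
(* on (N^N)^3 is Pi^0_2 iff it is of the form                          *)
(*   forall a, exists b, theta(a, b, f|b, g|b, h|b)                    *)
(* with theta primitive recursive on (codes of) finite data.           *)

Inductive prf : Type :=
| PZero : prf
| PSucc : prf
| PProj : nat -> prf                  (* i-th argument (0 if absent) *)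
| PComp : prf -> seq prf -> prf
| PRec  : prf -> prf -> prf.

Fixpoint prf_eval (e : prf) (xs : seq nat) {struct e} : nat :=
  match e with
  | PZero => 0%N
  | PSucc => (head 0%N xs).+1
  | PProj i => nth 0%N xs i
  | PComp h gs => prf_eval h ((fix evs (gs : seq prf) : seq nat :=
                               match gs with
                               | [::] => [::]
                               | g :: gs' => prf_eval g xs :: evs gs'
                               end) gs)
  | PRec g h =>
      let n := head 0%N xs in
      let ys := behead xs in
      (fix rec (m : nat) : nat :=
         match m with
         | 0%N => prf_eval g ys
         | m'.+1 => prf_eval h (m' :: rec m' :: ys)
         end) n
  end.

Definition init_code (f : nat -> nat) (b : nat) : nat := seq_code (mkseq f b).

Definition Pi02_3 (D : (nat -> nat) -> (nat -> nat) -> (nat -> nat) -> Prop) : Prop :=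
  exists e : prf, forall f g h : nat -> nat,
    D f g h <->
    (forall a : nat, exists b : nat,
       prf_eval e [:: a; b; init_code f b; init_code g b; init_code h b] != 0%N).

(* The scalar field K is R or C = R[i]; [toR] sends the (real-valued)  *)
(* norm in K to R, and [ratsc] enumerates the rational scalars of K.   *)

Section Banach.
Variables (R : realType) (K : numFieldType) (toR : K -> R) (ratsc : nat -> K).
Variable V : completeNormedModType K.

Definition nrm (v : V) : R := toR `|v|.

Definition lin_dense (X : set V) : Prop :=
  closure [set v : V | exists s : seq (K * V),
             (forall c, c \in s -> X c.2) /\ v = \sum_(c <- s) c.1 *: c.2] = setT.

Definition presentation (P : nat -> V) : Prop := lin_dense (range P).

Definition ratvec (P : nat -> V) (m : nat) : V :=
  \sum_(c <- seq_decode m) ratsc (unpair c).1 *: P (unpair c).2.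

(* The n-th rational open ball B(B#; n) (center: rational vector, radius:
   positive rational), coded presentation-independently. *)
Definition rat_ball (P : nat -> V) (n : nat) : set V :=
  [set v : V | nrm (v - ratvec P (unpair n).1) < ratr (posrat_of_nat (unpair n).2)].

Definition diagram (P : nat -> V) : set nat :=
  [set k | exists m n : nat, k = pair_code m n /\ @rat_interval R n (nrm (ratvec P m))].

Definition names_pres (P : nat -> V) (f : nat -> nat) : Prop :=
  range f = diagram P.

Definition is_tree (S : set (seq nat)) : Prop :=
  forall nu mu : seq nat, S (nu ++ mu) -> S nu.

Definition vector_tree (S : set (seq nat)) (psi : seq nat -> V) : Prop :=
  is_tree S /\ (forall nu nu', S nu -> S nu' -> psi nu = psi nu' -> nu = nu').

Definition Lp_disjoint (p : R) (vs : seq V) : Prop :=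
  forall alpha : nat -> K,
    powR (nrm (\sum_(j < size vs) alpha j *: vs`_j)) p
    = \sum_(j < size vs) powR (toR `|alpha j|) p * powR (nrm vs`_j) p.

Definition summative (S : set (seq nat)) (psi : seq nat -> V) : Prop :=
  forall nu : seq nat, S nu -> (exists k, S (rcons nu k)) ->
    (fun M : nat => \sum_(k < M | `[< S (rcons nu k) >]) psi (rcons nu k))
      @ \oo --> psi nu.

Definition incomparable (nu mu : seq nat) : bool :=
  ~~ prefix nu mu && ~~ prefix mu nu.

Definition Lp_separating (p : R) (S : set (seq nat)) (psi : seq nat -> V) : Prop :=
  forall ns : seq (seq nat), (forall nu, nu \in ns -> S nu) ->
    pairwise incomparable ns -> Lp_disjoint p (map psi ns).

Definition Lp_disintegration (p : R) (S : set (seq nat)) (psi : seq nat -> V) : Prop :=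
  [/\ vector_tree S psi, summative S psi, Lp_separating p S psi,
      (forall nu, S nu -> psi nu <> 0) & lin_dense (psi @` S)].

(* g is a name of the vector tree psi (relative to B#): an enumeration of
   (the codes of) all finite subsets of
   {(nu, n) : nu in S, psi nu in B(B#; n)}; a finite set is coded by the
   code of any finite sequence listing codes pair_code (seq_code nu) n of
   its elements. *)
Definition names_tree (P : nat -> V) (S : set (seq nat)) (psi : seq nat -> V)
    (g : nat -> nat) : Prop :=
  range g = [set k : nat | forall c, c \in seq_decode k ->
              S (seq_decode (unpair c).1) /\
              rat_ball P (unpair c).2 (psi (seq_decode (unpair c).1))].

Definition names_Lp_disintegration (P : nat -> V) (p : R) (g : nat -> nat) : Prop :=
  exists (S : set (seq nat)) (psi : seq nat -> V),
    Lp_disintegration p S psi /\ names_tree P S psi g.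

End Banach.

Definition names_real (R : realType) (h : nat -> nat) (p : R) : Prop :=
  forall k : nat, `|ratr (rat_of_nat (h k)) - p| < (2 ^+ k)^-1.

Definition Thm41_for (R : realType) (K : numFieldType) (toR : K -> R)
    (ratsc : nat -> K) : Prop :=
  exists Disint : (nat -> nat) -> (nat -> nat) -> (nat -> nat) -> Prop,
    Pi02_3 Disint /\
    forall (V : completeNormedModType K) (P : nat -> V) (f g h : nat -> nat) (p : R),
      presentation P -> names_pres toR ratsc P f ->
      names_real h p -> 1 <= p ->
      (Disint f g h <-> names_Lp_disintegration toR ratsc P p g).

(* Main.v *)
(* All facts about the presentation are extracted from the single kind of statement "the norm of
   the rational vector m is within 1 of the natural number U": every other estimate follows after
   multiplying vectors by large integers, so codes of rationals are hardly ever computed with.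

   A function g names a vector tree exactly when the balls it lists for a node are the rational
   neighbourhoods of one vector: any two of them contain a third, arbitrarily small, strictly
   inside both, and every ball strictly containing a listed one is listed; completeness then
   provides the vector.  Being a tree, injective, without zero, and of dense span are then visibly
   "for all, there exists" statements.

   Formal disjointness is ||sum a_j v_j||^p = sum ||a_j v_j||^p, which by density is needed only
   for a_j in Z (or Z[i]).  It is tested in the limit K -> oo: after scaling by some N >= K, the
   norms are replaced by integers U, U_j and p by a rational q close to it, and the integer parts
   of U^q and of the U_j^q must satisfy K * |[U^q] - sum [U_j^q]| <= [N^q].

   Convergence of the sum of the children of a node looks like a statement with three
   quantifiers, and membership in the tree is not decidable.  For formally disjoint vectors,
   however, the p-th powers of the norms add up, so it suffices that every finite set of children
   extends to a finite set whose sum is as close as desired to the node. *)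

Require Import Defs.
From mathcomp Require Import all_boot all_order all_algebra.
From mathcomp Require Import all_classical all_reals all_analysis.
From mathcomp Require Import zify ring lra.

Set Implicit Arguments.
Unset Strict Implicit.
Unset Printing Implicit Defensive.

Import Order.TTheory GRing.Theory Num.Theory.
Import numFieldNormedType.Exports.
From mathcomp Require Import complex.

Local Open Scope nat_scope.

(** * Primitive recursive functions between encoded types *)

(** The names carry positive information only: membership in a diagram can be confirmed at a finite
    stage, never refuted. This fixes the shape of every test. What occurs as a premise is read from
    [f] and [g] at universally quantified indices, what is asserted is read at existential ones. An
    equation such as formal disjointness therefore has to be asserted up to 1/K, for every K.

    Bounded absolute errors are harmless, since everything is finally divided by the scale N.
    Reading off a norm costs at most 1, and replacing vectors of the tree by centres of small enough
    balls costs at most 1; this is the origin of the bounds 2 below. In the test of disjointness an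
    integer part costs less than 1, hence less than 1 / N^q after division by N^q, and the exponent
    q may vary along with N because x^q is jointly continuous in x >= 0 and q > 0, even at x = 0.

    Both scalar fields are handled at once through a root of unity [iota_sc]: multiplying
    coefficients by it and concatenating formal combinations is the whole arithmetic done on
    vectors. *)

Definition pr_one := PComp PSucc [:: PZero].
Definition pr_add := PRec (PProj 0) (PComp PSucc [:: PProj 1]).
Definition pr_mul := PRec PZero (PComp pr_add [:: PProj 1; PProj 2]).
Definition pr_exp :=
  PComp (PRec pr_one (PComp pr_mul [:: PProj 1; PProj 2])) [:: PProj 1; PProj 0].
Definition pr_pred := PRec PZero (PProj 0).
Definition pr_sub :=
  PComp (PRec (PProj 0) (PComp pr_pred [:: PProj 1])) [:: PProj 1; PProj 0].
(** From floor((m+1)/2) = m - floor(m/2). *)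
Definition pr_half := PRec PZero (PComp pr_sub [:: PProj 0; PProj 1]).
Definition pr_even :=
  PComp pr_sub [:: pr_one; PComp pr_sub [:: PProj 0;
    PComp pr_add [:: pr_half; pr_half]]].
Definition pr_iterhalf := PRec (PProj 0) (PComp pr_half [:: PProj 1]).
(** A nonempty list [x :: s] has code 2^x (2c + 1), with c the code of [s], so its head is a 2-adic
    valuation. The counter advances while the number halved that many times is even and then stays
    put, so running the loop too long does no harm. *)
Definition pr_val2 :=
  PRec PZero (PComp pr_add [:: PProj 1;
    PComp pr_even [:: PComp pr_iterhalf [:: PProj 1; PProj 2]]]).
Definition pr_hd := PComp pr_val2 [:: PProj 0; PProj 0].
Definition pr_tl := PComp pr_half [:: PComp pr_iterhalf [:: pr_hd; PProj 0]].
Definition pr_cons := PComp pr_mul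
  [:: PComp pr_exp [:: PComp PSucc [:: pr_one]; PProj 0];
      PComp PSucc [:: PComp pr_add [:: PProj 1; PProj 1]]].

Arguments prf_eval : simpl never.

Lemma eval_comp h gs xs : prf_eval (PComp h gs) xs = prf_eval h [seq prf_eval g xs | g <- gs].
Proof. by rewrite /prf_eval -/prf_eval; congr prf_eval; elim: gs => //= g gs ->. Qed.

Lemma eval_rec0 g h ys : prf_eval (PRec g h) (0 :: ys) = prf_eval g ys.
Proof. by []. Qed.

Lemma eval_recS g h n ys : prf_eval (PRec g h) (n.+1 :: ys) =
  prf_eval h [:: n, prf_eval (PRec g h) (n :: ys) & ys].
Proof. by []. Qed.

Lemma eval_proj i xs : prf_eval (PProj i) xs = nth 0 xs i.
Proof. by []. Qed.

Lemma eval_succ x xs : prf_eval PSucc (x :: xs) = x.+1.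
Proof. by []. Qed.

Definition evalE := (eval_comp, eval_rec0, eval_proj, eval_succ).

Lemma pr_addE x y : prf_eval pr_add [:: x; y] = x + y.
Proof. by elim: x => // x IHx; rewrite eval_recS -/pr_add IHx evalE. Qed.

Lemma pr_mulE x y : prf_eval pr_mul [:: x; y] = x * y.
Proof.
elim: x => // x IHx; rewrite eval_recS -/pr_mul IHx eval_comp /= !eval_proj /=.
by rewrite pr_addE mulSn addnC.
Qed.

Lemma pr_expE x y : prf_eval pr_exp [:: x; y] = x ^ y.
Proof.
rewrite eval_comp /= !eval_proj /=; elim: y => // y IHy.
by rewrite eval_recS IHy eval_comp /= !eval_proj /= pr_mulE expnSr.
Qed.

Lemma pr_predE x xs : prf_eval pr_pred (x :: xs) = x.-1.
Proof. by case: x. Qed.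

Lemma pr_subE x y : prf_eval pr_sub [:: x; y] = x - y.
Proof.
rewrite eval_comp /= !eval_proj /=; elim: y => [|y IHy]; first by rewrite subn0.
by rewrite eval_recS IHy eval_comp /= eval_proj pr_predE subnS.
Qed.

Lemma pr_halfE x xs : prf_eval pr_half (x :: xs) = x./2.
Proof.
elim: x => // x IHx; rewrite -[RHS]/(uphalf x) eval_recS -/pr_half IHx.
rewrite eval_comp /= !eval_proj [LHS]pr_subE uphalf_half [nth _ _ _]/= [nth _ _ _]/=.
by have := odd_double_half x; lia.
Qed.

Lemma pr_evenE x xs : prf_eval pr_even (x :: xs) = ~~ odd x.
Proof.
rewrite eval_comp [map _ _]/= eval_comp [map _ _]/= eval_comp [map _ _]/= !pr_halfE.
rewrite pr_addE pr_subE pr_subE -[prf_eval pr_one _]/1 -[prf_eval (PProj 0) _]/x.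
by have := odd_double_half x; case: (odd x); lia.
Qed.

Lemma pr_iterhalfE i x xs : prf_eval pr_iterhalf [:: i, x & xs] = iter i half x.
Proof.
by elim: i => // i IHi; rewrite eval_recS -/pr_iterhalf IHi eval_comp [map _ _]/= pr_halfE.
Qed.

Lemma iter_half i x y : i <= x -> iter i half (2 ^ x * y) = 2 ^ (x - i) * y.
Proof.
elim: i => [|i IHi] lt_ix; first by rewrite subn0.
rewrite iterS IHi 1?ltnW // subnS; case: (x - i) (subn_gt0 i x) lt_ix => [<-//|m] _ _.
by rewrite expnS -mulnA mul2n doubleK.
Qed.

Lemma pr_val2E x m i :
  prf_eval pr_val2 [:: i; 2 ^ x * m.*2.+1] = minn i x.
Proof.
elim: i => [|i IHi]; first by rewrite min0n.
rewrite eval_recS -/pr_val2 IHi eval_comp [map _ _]/= eval_comp [map _ _]/=.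
rewrite eval_comp [map _ _]/= !eval_proj [nth _ _ _]/= [nth _ _ _]/=.
rewrite pr_iterhalfE pr_evenE pr_addE.
rewrite iter_half ?geq_minr // oddM oddX /= odd_double andbT orbF.
by lia.
Qed.

Lemma pr_hdE n : prf_eval pr_hd [:: n] = head 0 (seq_decode n).
Proof.
rewrite eval_comp [map _ _]/= eval_proj /=.
rewrite -{1 2}(CodeSeq.decodeK n) /seq_decode; case: (CodeSeq.decode n) => //= x s.
rewrite -/(CodeSeq.code s) [LHS]pr_val2E.
have lt_x : x < 2 ^ x by apply: ltn_expl.
by apply/minn_idPr/(leq_trans (ltnW lt_x)); rewrite leq_pmulr.
Qed.

Lemma pr_tlE n : prf_eval pr_tl [:: n] = seq_code (behead (seq_decode n)).
Proof.
rewrite eval_comp [map _ _]/= eval_comp [map _ _]/= eval_proj [nth _ _ _]/= pr_hdE.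
rewrite pr_halfE pr_iterhalfE.
rewrite -{2}(CodeSeq.decodeK n) /seq_decode; case: (CodeSeq.decode n) => // x s.
rewrite [CodeSeq.code _]/= [head _ _]/= iter_half // subnn mul1n -[half _]/(uphalf _).
by rewrite uphalf_double.
Qed.

Lemma pr_consE x s : prf_eval pr_cons [:: x; seq_code s] = seq_code (x :: s).
Proof.
transitivity (prf_eval pr_mul [:: prf_eval pr_exp [:: 2; x];
  (prf_eval pr_add [:: seq_code s; seq_code s]).+1]); first by [].
by rewrite pr_addE pr_expE pr_mulE addnn.
Qed.

Definition pr_pair a b := PComp pr_cons [:: a; PComp pr_cons [:: b; PZero]].

Lemma pr_pairE a b xs :
  prf_eval (pr_pair a b) xs = pair_code (prf_eval a xs) (prf_eval b xs).
Proof.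
rewrite eval_comp [map _ _]/= eval_comp [map _ _]/= -[prf_eval PZero xs]/(seq_code [::]).
by rewrite !pr_consE.
Qed.

Class Enc (A : Type) := enc : A -> nat.
#[export] Instance enc_nat : Enc nat := id.
#[export] Instance enc_bool : Enc bool := nat_of_bool.
#[export] Instance enc_prod A B (ea : Enc A) (eb : Enc B) : Enc (A * B) :=
  fun p => pair_code (enc p.1) (enc p.2).
#[export] Instance enc_seq A (ea : Enc A) : Enc (seq A) :=
  fun s => seq_code (map enc s).

(** Only codes of elements are fed to the program; its values at other numbers are left open.
    Booleans are coded by 0 and 1, so a test and its characteristic function have the same code. *)
Definition PR (A B : Type) {ea : Enc A} {eb : Enc B} (F : A -> B) : Prop :=
  exists e, forall a, prf_eval e [:: enc a] = enc (F a).

Lemma unpairK a b : unpair (pair_code a b) = (a, b).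
Proof. by rewrite /unpair /pair_code /seq_decode /seq_code CodeSeq.codeK. Qed.

Lemma pair_code_inj a b a' b' : pair_code a b = pair_code a' b' -> a = a' /\ b = b'.
Proof. by move=> /(congr1 unpair); rewrite !unpairK => -[]. Qed.

Section PRBasics.
Variables (A B C D : Type).
Context {ea : Enc A} {eb : Enc B} {ec : Enc C} {ed : Enc D}.

Lemma PR_ext (F G : A -> B) : F =1 G -> PR F -> PR G.
Proof. by move=> eqFG [e He]; exists e => a; rewrite He eqFG. Qed.

Lemma PR_id : PR (fun a : A => a).
Proof. by exists (PProj 0). Qed.

Lemma PR_comp (G : B -> C) (F : A -> B) : PR G -> PR F -> PR (fun a => G (F a)).
Proof.
by move=> [eG HG] [eF HF]; exists (PComp eG [:: eF]) => a; rewrite eval_comp /= HF HG.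
Qed.

Lemma PR_const (c : B) : PR (fun _ : A => c).
Proof.
exists (iter (enc c) (fun e => PComp PSucc [:: e]) PZero) => a.
by elim: (enc c) => // n IHn; rewrite iterS eval_comp /= IHn.
Qed.

Lemma PR_fst (F : A -> B * C) : PR F -> PR (fun a => (F a).1).
Proof.
move=> [e He]; exists (PComp pr_hd [:: e]) => a.
by rewrite eval_comp /= He pr_hdE /enc /enc_prod /pair_code /seq_decode CodeSeq.codeK.
Qed.

Lemma PR_snd (F : A -> B * C) : PR F -> PR (fun a => (F a).2).
Proof.
move=> [e He]; exists (PComp pr_hd [:: PComp pr_tl [:: e]]) => a.
rewrite eval_comp /= eval_comp /= He pr_tlE pr_hdE.
by rewrite /enc /enc_prod /pair_code /seq_decode /seq_code !CodeSeq.codeK.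
Qed.

Lemma PR_cons (F : A -> B) (G : A -> seq B) : PR F -> PR G -> PR (fun a => F a :: G a).
Proof.
move=> [e He] [e' He']; exists (PComp pr_cons [:: e; e']) => a.
by rewrite eval_comp /= He He' pr_consE.
Qed.

Lemma PR_pair (F : A -> B) (G : A -> C) : PR F -> PR G -> PR (fun a => (F a, G a)).
Proof.
by move=> [e He] [e' He']; exists (pr_pair e e') => a; rewrite pr_pairE He He'.
Qed.

(** Recursion on the code 0 or 1 of the condition: the step discards the recursive value and
    projects onto the other branch. *)
Lemma PR_if (b : A -> bool) (F G : A -> B) :
  PR b -> PR F -> PR G -> PR (fun a => if b a then F a else G a).
Proof.
move=> [e He] [e1 H1] [e2 H2]; exists (PComp (PRec (PProj 0) (PProj 3)) [:: e; e2; e1]) => a.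
by rewrite eval_comp /= He H1 H2; case: (b a).
Qed.

Lemma PR_lcase (L : A -> seq B) (N : A -> C) (H : A -> B -> seq B -> C) :
  PR L -> PR N -> PR (fun t : A * (B * seq B) => H t.1 t.2.1 t.2.2) ->
  PR (fun a => if L a is x :: s then H a x s else N a).
Proof.
move=> [eL HL] [eN HN] [eH HH].
exists (PComp (PRec (PProj 0) (PProj 3)) [:: eL; eN;
  PComp eH [:: pr_pair (PProj 0) (pr_pair (PComp pr_hd [:: eL]) (PComp pr_tl [:: eL]))]]) => a.
rewrite eval_comp /= HL HN eval_comp /= !pr_pairE (eval_comp pr_hd) (eval_comp pr_tl) /=.
rewrite HL pr_hdE pr_tlE.
case: (L a) => [//|x s]; rewrite /enc /= /enc_seq /seq_decode /seq_code CodeSeq.codeK /=.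
rewrite -[RHS]/(enc (H (a, (x, s)).1 (a, (x, s)).2.1 (a, (x, s)).2.2)) -HH.
(* A nonempty list has a nonzero code, so the recursion on the code leaves its base clause. *)
have : 0 < 2 ^ enc x * (CodeSeq.code [seq enc i | i <- s]).*2.+1.
  by rewrite muln_gt0 expn_gt0.
by case: (2 ^ _ * _)%N.
Qed.

Lemma PR_rec (n : A -> nat) (F : A -> B) (H : A -> nat -> B -> B) :
  PR n -> PR F -> PR (fun t : A * (nat * B) => H t.1 t.2.1 t.2.2) ->
  PR (fun a => nat_rect (fun=> B) (F a) (H a) (n a)).
Proof.
move=> [en Hn] [eF HF] [eH HH].
exists (PComp (PRec eF (PComp eH [:: pr_pair (PProj 2) (pr_pair (PProj 0) (PProj 1))]))
  [:: en; PProj 0]) => a.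
rewrite eval_comp /= Hn -[enc (n a)]/(n a); elim: (n a) => [|m IHm]; first exact: HF.
by rewrite eval_recS IHm eval_comp /= !pr_pairE -[RHS](HH (a, (m, _))).
Qed.

End PRBasics.

Arguments PR_id {A ea}.

Lemma PR_ap2 (A B C D : Type) (ea : Enc A) (eb : Enc B) (ec : Enc C) (ed : Enc D)
    (H : B -> C -> D) (X : A -> B) (Y : A -> C) :
  PR (fun t : B * C => H t.1 t.2) -> PR X -> PR Y -> PR (fun a => H (X a) (Y a)).
Proof.
move=> hH hX hY.
exact: (PR_comp (G := fun t : B * C => H t.1 t.2) (F := fun a => (X a, Y a)) hH (PR_pair hX hY)).
Qed.

Lemma PR_ap3 (A B C D E : Type) (ea : Enc A) (eb : Enc B) (ec : Enc C) (ed : Enc D) (ee : Enc E)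
    (H : B -> C -> D -> E) (X : A -> B) (Y : A -> C) (Z : A -> D) :
  PR (fun t : B * (C * D) => H t.1 t.2.1 t.2.2) -> PR X -> PR Y -> PR Z ->
  PR (fun a => H (X a) (Y a) (Z a)).
Proof.
move=> hH hX hY hZ; apply: (PR_comp (G := fun t : B * (C * D) => H t.1 t.2.1 t.2.2)
  (F := fun a => (X a, (Y a, Z a))) hH).
by apply: PR_pair => //; apply: PR_pair.
Qed.

Lemma PR_nat1 (e : prf) (f : nat -> nat) : (forall x, prf_eval e [:: x] = f x) ->
  forall (A : Type) (ea : Enc A) (F : A -> nat), PR F -> PR (fun a => f (F a)).
Proof.
by move=> He A ea F [e1 H1]; exists (PComp e [:: e1]) => a; rewrite eval_comp /= H1 [LHS]He.
Qed.

Lemma PR_nat2 (e : prf) (f : nat -> nat -> nat) :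
  (forall x y, prf_eval e [:: x; y] = f x y) ->
  forall (A : Type) (ea : Enc A) (F G : A -> nat), PR F -> PR G -> PR (fun a => f (F a) (G a)).
Proof.
move=> He A ea F G [e1 H1] [e2 H2]; exists (PComp e [:: e1; e2]) => a.
by rewrite eval_comp /= H1 H2 [LHS]He.
Qed.

Definition PR_addn := PR_nat2 pr_addE.
Definition PR_subn := PR_nat2 pr_subE.
Definition PR_muln := PR_nat2 pr_mulE.
Definition PR_expn := PR_nat2 pr_expE.
Definition PR_succn := PR_nat1 (e := PSucc) (fun=> erefl).

Lemma size_le_code s : size s <= seq_code s.
Proof.
elim: s => // x s IHs; rewrite -[seq_code _]/(2 ^ x * (seq_code s).*2.+1).
apply: (leq_trans (n := (seq_code s).+1)) => //.
by rewrite -[(seq_code s).+1]mul1n leq_mul ?expn_gt0 //; lia.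
Qed.

Lemma PR_predn (A : Type) {ea : Enc A}
    (F : A -> nat) : PR F -> PR (fun a => (F a).-1).
Proof.
move=> hF; apply: (PR_ext (F := fun a => F a - 1)) => [a|]; first by rewrite subn1.
by apply: PR_subn hF _; apply: PR_const.
Qed.

Lemma PR_b2n (A : Type) {ea : Enc A}
    (F : A -> bool) : PR F -> PR (fun a => nat_of_bool (F a)).
Proof. by []. Qed.

Lemma PR_n2b (A : Type) {ea : Enc A}
    (F : A -> bool) : PR (fun a => nat_of_bool (F a)) -> PR F.
Proof. by []. Qed.

Lemma PR_leq (A : Type) {ea : Enc A}
    (F G : A -> nat) : PR F -> PR G -> PR (fun a => F a <= G a).
Proof.
move=> hF hG; apply/PR_n2b/(PR_ext (F := fun a => 1 - (F a - G a))) => [a|].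
  by case: leqP; lia.
by apply: PR_subn; [apply: PR_const | apply: PR_subn].
Qed.

Lemma PR_negb (A : Type) {ea : Enc A}
    (F : A -> bool) : PR F -> PR (fun a => ~~ F a).
Proof.
move=> hF; apply/PR_n2b/(PR_ext (F := fun a => 1 - F a)) => [a|]; first by case: (F a).
by apply: PR_subn; [apply: PR_const | exact: hF].
Qed.

Lemma PR_andb (A : Type) {ea : Enc A}
    (F G : A -> bool) : PR F -> PR G -> PR (fun a => F a && G a).
Proof. by move=> hF hG; apply: PR_if => //; apply: PR_const. Qed.

Lemma PR_orb (A : Type) {ea : Enc A}
    (F G : A -> bool) : PR F -> PR G -> PR (fun a => F a || G a).
Proof. by move=> hF hG; apply: PR_if => //; apply: PR_const. Qed.

Lemma PR_implyb (A : Type) {ea : Enc A}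
    (F G : A -> bool) : PR F -> PR G -> PR (fun a => F a ==> G a).
Proof. by move=> hF hG; apply: PR_if => //; apply: PR_const. Qed.

Lemma PR_eqn (A : Type) {ea : Enc A}
    (F G : A -> nat) : PR F -> PR G -> PR (fun a => F a == G a).
Proof.
move=> hF hG; apply: (PR_ext (F := fun a => (F a <= G a) && (G a <= F a))) => [a|].
  by rewrite eqn_leq.
by apply: PR_andb; apply: PR_leq.
Qed.

Lemma PR_seq_code (A : Type) {ea : Enc A}
    (F : A -> seq nat) : PR F -> PR (fun a => seq_code (F a)).
Proof. by move=> [e He]; exists e => a; rewrite He /enc /= /enc_seq map_id. Qed.

Lemma PR_seq_decode (A : Type) {ea : Enc A}
    (F : A -> nat) : PR F -> PR (fun a => seq_decode (F a)).
Proof.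
move=> [e He]; exists e => a; rewrite He /enc /= /enc_seq map_id.
by rewrite /seq_code /seq_decode CodeSeq.decodeK.
Qed.

Lemma PR_eqseq (A : Type) {ea : Enc A}
    (F G : A -> seq nat) : PR F -> PR G -> PR (fun a => F a == G a).
Proof.
move=> hF hG; apply: (PR_ext (F := fun a => seq_code (F a) == seq_code (G a))) => [a|].
  by rewrite (inj_eq (can_inj CodeSeq.codeK)).
by apply: PR_eqn; apply: PR_seq_code.
Qed.

Lemma PR_iter (A B : Type) {ea : Enc A} {eb : Enc B}
    (n : A -> nat) (F : A -> B) (H : A -> B -> B) :
  PR n -> PR F -> PR (fun t : A * B => H t.1 t.2) ->
  PR (fun a => iter (n a) (H a) (F a)).
Proof.
move=> hn hF hH.
apply: (PR_ext (F := fun a => nat_rect (fun=> B) (F a) (fun=> H a) (n a))) => [a|].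
  by elim: (n a) => //= m ->.
apply: (PR_rec (H := fun a _ b => H a b)) => //.
by apply: (PR_ap2 (H := H)) => //; [exact (PR_fst PR_id) | exact (PR_snd (PR_snd PR_id))].
Qed.

(** The loop state is the list still to be read together with the accumulator. The code of a list
    bounds its length, so it can serve as the number of iterations; those after the end of the list
    change nothing. *)
Lemma PR_foldl (A B C : Type) {ea : Enc A} {eb : Enc B} {ec : Enc C}
    (L : A -> seq B) (F : A -> C) (H : A -> C -> B -> C) :
  PR L -> PR F -> PR (fun t : A * (C * B) => H t.1 t.2.1 t.2.2) ->
  PR (fun a => foldl (H a) (F a) (L a)).
Proof.
move=> hL hF hH.
pose step a (t : seq B * C) := if t.1 is x :: s then (s, H a t.2 x) else ([::], t.2).
have PR_step : PR (fun t : A * (seq B * C) => step t.1 t.2).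
  apply: (PR_lcase (L := fun t : A * (seq B * C) => t.2.1)
    (H := fun t x s => (s, H t.1 t.2.2 x))).
  - exact (PR_fst (PR_snd PR_id)).
  - by apply: PR_pair; [exact: PR_const | exact (PR_snd (PR_snd PR_id))].
  apply: PR_pair; first exact (PR_snd (PR_snd PR_id)).
  apply: (PR_ap3 (H := H)) => //; first exact (PR_fst (PR_fst PR_id)).
    exact (PR_snd (PR_snd (PR_fst PR_id))).
  exact (PR_fst (PR_snd PR_id)).
apply: (PR_ext (F := fun a => (iter (enc (L a)) (step a) (L a, F a)).2)) => [a|].
  have size_le : size (L a) <= enc (L a).
    by rewrite -(size_map (@enc B eb) (L a)); exact: size_le_code.
  elim: (L a) (F a) (enc (L a)) size_le => [|x s IHs] c n /=.
    by move=> _; elim: n c => // n IHn c; rewrite iterSr IHn.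
  by case: n => // n; rewrite iterSr; exact: IHs.
by apply: PR_snd; apply: PR_iter => //; apply: PR_pair.
Qed.

Lemma PR_rev (A B : Type) {ea : Enc A} {eb : Enc B}
    (L : A -> seq B) : PR L -> PR (fun a => rev (L a)).
Proof.
move=> hL; apply: (PR_ext (F := fun a => foldl (fun s x => x :: s) [::] (L a))) => [a|].
  by rewrite /rev; elim: (L a) [::] => //=.
apply: (PR_foldl (H := fun _ s x => x :: s)) => //; first exact: PR_const.
by apply: PR_cons; [exact (PR_snd (PR_snd PR_id)) | exact (PR_fst (PR_snd PR_id))].
Qed.

Lemma PR_foldr (A B C : Type) {ea : Enc A} {eb : Enc B} {ec : Enc C}
    (L : A -> seq B) (F : A -> C) (H : A -> B -> C -> C) :
  PR L -> PR F -> PR (fun t : A * (B * C) => H t.1 t.2.1 t.2.2) ->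
  PR (fun a => foldr (H a) (F a) (L a)).
Proof.
move=> hL hF hH.
apply: (PR_ext (F := fun a => foldl (fun c b => H a b c) (F a) (rev (L a)))) => [a|].
  by rewrite foldl_rev.
apply: (PR_foldl (H := fun a c b => H a b c)); [exact: PR_rev | exact: hF |].
apply: (PR_ap3 (H := H)) => //; first exact (PR_fst PR_id).
  exact (PR_snd (PR_snd PR_id)).
exact (PR_fst (PR_snd PR_id)).
Qed.

Lemma PR_map (A B C : Type) {ea : Enc A} {eb : Enc B} {ec : Enc C}
    (L : A -> seq B) (H : A -> B -> C) :
  PR L -> PR (fun t : A * B => H t.1 t.2) -> PR (fun a => map (H a) (L a)).
Proof.
move=> hL hH.
apply: (PR_ext (F := fun a => foldr (fun b s => H a b :: s) [::] (L a))) => [a|].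
  by elim: (L a) => //= x s ->.
apply: (PR_foldr (H := fun a b s => H a b :: s)) => //; first exact: PR_const.
apply: PR_cons; last exact (PR_snd (PR_snd PR_id)).
by apply: (PR_ap2 (H := H)) => //; [exact (PR_fst PR_id) | exact (PR_fst (PR_snd PR_id))].
Qed.

Lemma PR_all (A B : Type) {ea : Enc A} {eb : Enc B}
    (L : A -> seq B) (H : A -> B -> bool) :
  PR L -> PR (fun t : A * B => H t.1 t.2) -> PR (fun a => all (H a) (L a)).
Proof.
move=> hL hH.
apply: (PR_ext (F := fun a => foldr (fun b s => H a b && s) true (L a))) => [a|].
  by elim: (L a) => //= x s ->.
apply: (PR_foldr (H := fun a b s => H a b && s)) => //; first exact: PR_const.
apply: PR_andb; last exact (PR_snd (PR_snd PR_id)).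
by apply: (PR_ap2 (H := H)) => //; [exact (PR_fst PR_id) | exact (PR_fst (PR_snd PR_id))].
Qed.

Lemma PR_cat (A B : Type) {ea : Enc A} {eb : Enc B}
    (F G : A -> seq B) : PR F -> PR G -> PR (fun a => F a ++ G a).
Proof.
move=> hF hG; apply: (PR_ext (F := fun a => foldr cons (G a) (F a))) => [a|].
  by elim: (F a) => //= x s ->.
apply: (PR_foldr (H := fun _ => cons)) => //.
by apply: PR_cons; [exact (PR_fst (PR_snd PR_id)) | exact (PR_snd (PR_snd PR_id))].
Qed.

Lemma PR_flatten (A B : Type) {ea : Enc A} {eb : Enc B}
    (F : A -> seq (seq B)) : PR F -> PR (fun a => flatten (F a)).
Proof.
move=> hF; apply: (PR_foldr (H := fun _ => cat) (F := fun=> [::])) => //; first exact: PR_const.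
by apply: PR_cat; [exact (PR_fst (PR_snd PR_id)) | exact (PR_snd (PR_snd PR_id))].
Qed.

Lemma PR_nseq (A B : Type) {ea : Enc A} {eb : Enc B}
    (n : A -> nat) (F : A -> B) : PR n -> PR F -> PR (fun a => nseq (n a) (F a)).
Proof.
move=> hn hF; apply: (PR_ext (F := fun a => iter (n a) (cons (F a)) [::])) => [//|].
apply: (PR_iter (F := fun=> [::]) (H := fun a => cons (F a))) => //; first exact: PR_const.
apply: PR_cons; last exact (PR_snd PR_id).
by apply: (PR_comp (G := F) (F := fst)) => //; exact (PR_fst PR_id).
Qed.

Lemma PR_size (A B : Type) {ea : Enc A} {eb : Enc B}
    (L : A -> seq B) : PR L -> PR (fun a => size (L a)).
Proof.
move=> hL; apply: (PR_ext (F := fun a => foldr (fun _ n => n.+1) 0 (L a))) => [a|].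
  by elim: (L a) => //= x s ->.
apply: (PR_foldr (H := fun _ _ n => n.+1)) => //; first exact: PR_const.
by apply: PR_succn; exact (PR_snd (PR_snd PR_id)).
Qed.

Lemma PR_behead (A B : Type) {ea : Enc A} {eb : Enc B}
    (L : A -> seq B) : PR L -> PR (fun a => behead (L a)).
Proof.
move=> hL; apply: (PR_ext (F := fun a => if L a is x :: s then s else [::])) => [a|].
  by case: (L a).
apply: (PR_lcase (H := fun _ _ s => s)) => //; first exact: PR_const.
exact (PR_snd (PR_snd PR_id)).
Qed.

Lemma PR_drop (A B : Type) {ea : Enc A} {eb : Enc B}
    (n : A -> nat) (L : A -> seq B) : PR n -> PR L -> PR (fun a => drop (n a) (L a)).
Proof.
move=> hn hL; apply: (PR_ext (F := fun a => iter (n a) behead (L a))) => [a|].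
  elim: (n a) (L a) => [|m IHm] s; first by rewrite drop0.
  by rewrite iterSr IHm; case: s => //=; rewrite ?drop_oversize.
by apply: (PR_iter (H := fun _ => behead)) => //; exact (PR_behead (PR_snd PR_id)).
Qed.

Lemma PR_nth (A B : Type) {ea : Enc A} {eb : Enc B}
    (d : B) (n : A -> nat) (L : A -> seq B) :
  PR n -> PR L -> PR (fun a => nth d (L a) (n a)).
Proof.
move=> hn hL.
apply: (PR_ext (F := fun a => if drop (n a) (L a) is x :: s then x else d)) => [a|].
  case: (ltnP (n a) (size (L a))) => lt_n; first by rewrite (drop_nth d).
  by rewrite drop_oversize // nth_default.
apply: (PR_lcase (H := fun _ x _ => x)); [exact: PR_drop | exact: PR_const |].
exact (PR_fst (PR_snd PR_id)).
Qed.

Lemma PR_take (A B : Type) {ea : Enc A} {eb : Enc B}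
    (n : A -> nat) (L : A -> seq B) : PR n -> PR L -> PR (fun a => take (n a) (L a)).
Proof.
move=> hn hL; apply: (PR_ext
  (F := fun a => rev (drop (size (L a) - n a) (rev (L a))))) => [a|].
  set s := L a; set m := n a.
  by rewrite drop_rev revK; case: (leqP m (size s)) => h; [rewrite subKn | rewrite !take_oversize //; lia].
apply/PR_rev/PR_drop; last exact: PR_rev.
by apply: PR_subn => //; exact: PR_size.
Qed.

(** * Automatic proofs of primitive recursiveness; [pr_ext] is a hook for later closure lemmas *)

Ltac pr_ext := fail.

Ltac pr_step := cbv beta; lazymatch goal with
  | |- PR (fun a => a) => exact PR_id
  | |- PR fst => refine (PR_fst (F := fun t => t) _)
  | |- PR snd => refine (PR_snd (F := fun t => t) _)
  | |- PR (fun _ => ?c) => exact (PR_const c)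
  | |- PR (fun a => (@?F a, @?G a)) => refine (PR_pair (F := F) (G := G) _ _)
  | |- PR (fun a => fst (@?F a)) => refine (PR_fst (F := F) _)
  | |- PR (fun a => snd (@?F a)) => refine (PR_snd (F := F) _)
  | |- PR (fun a => @?F a :: @?G a) => refine (PR_cons (F := F) (G := G) _ _)
  | |- PR (fun a => @?F a && @?G a) => refine (PR_andb (F := F) (G := G) _ _)
  | |- PR (fun a => @?F a || @?G a) => refine (PR_orb (F := F) (G := G) _ _)
  | |- PR (fun a => @?F a ==> @?G a) => refine (PR_implyb (F := F) (G := G) _ _)
  | |- PR (fun a => ~~ @?F a) => refine (PR_negb (F := F) _)
  | |- PR (fun a => nat_of_bool (@?F a)) => refine (PR_b2n (F := F) _)
  | |- PR (fun a => (@?F a).+1) => refine (PR_succn (F := F) _)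
  | |- PR (fun a => (@?F a).-1) => refine (PR_predn (F := F) _)
  | |- PR (fun a => @?F a + @?G a) => refine (PR_addn (F := F) (G := G) _ _)
  | |- PR (fun a => @?F a - @?G a) => refine (PR_subn (F := F) (G := G) _ _)
  | |- PR (fun a => @?F a * @?G a) => refine (PR_muln (F := F) (G := G) _ _)
  | |- PR (fun a => @?F a ^ @?G a) => refine (PR_expn (F := F) (G := G) _ _)
  | |- PR (fun a => @?F a <= @?G a) => refine (PR_leq (F := F) (G := G) _ _)
  | |- @PR _ _ _ _ (fun a => @eq_op Datatypes_nat__canonical__eqtype_Equality (@?F a) (@?G a)) =>
      refine (PR_eqn (F := F) (G := G) _ _)
  | |- PR (fun a => seq_code (@?F a)) => refine (PR_seq_code (F := F) _)
  | |- PR (fun a => seq_decode (@?F a)) => refine (PR_seq_decode (F := F) _)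
  | |- PR (fun a => iter (@?n a) (@?H a) (@?F a)) =>
      refine (PR_iter (n := n) (F := F) (H := H) _ _ _)
  | |- PR (fun a => foldr (@?H a) (@?F a) (@?L a)) =>
      refine (PR_foldr (L := L) (F := F) (H := H) _ _ _)
  | |- PR (fun a => map (@?H a) (@?L a)) => refine (PR_map (L := L) (H := H) _ _)
  | |- PR (fun a => all (@?H a) (@?L a)) => refine (PR_all (L := L) (H := H) _ _)
  | |- PR (fun a => @?F a ++ @?G a) => refine (PR_cat (F := F) (G := G) _ _)
  | |- PR (fun a => flatten (@?F a)) => refine (PR_flatten (F := F) _)
  | |- PR (fun a => nseq (@?n a) (@?F a)) => refine (PR_nseq (n := n) (F := F) _ _)
  | |- PR (fun a => size (@?F a)) => refine (PR_size (L := F) _)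
  | |- PR (fun a => rev (@?F a)) => refine (PR_rev (L := F) _)
  | |- PR (fun a => behead (@?F a)) => refine (PR_behead (L := F) _)
  | |- PR (fun a => take (@?n a) (@?F a)) => refine (PR_take (n := n) (L := F) _ _)
  | |- PR (fun a => nth ?d (@?F a) (@?n a)) => refine (PR_nth d (n := n) (L := F) _ _)
  | |- PR (fun a => @eq_op _ (@?F a) (@?G a)) => refine (PR_eqseq (F := F) (G := G) _ _)
  | |- _ => pr_ext
  end.
Ltac pr_hyp := match goal with
  | H : PR ?G |- PR (fun a => ?G (@?F a)) => refine (PR_comp (G := G) (F := F) H _)
  end.
Ltac pr := repeat first [assumption | pr_hyp | pr_step].

Section MorePR.
Variables (A : Type) (ea : Enc A).

Lemma PR_pair_code (F G : A -> nat) : PR F -> PR G -> PR (fun a => pair_code (F a) (G a)).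
Proof. by move=> hF hG; rewrite /pair_code; pr. Qed.

Lemma PR_unpair (F : A -> nat) : PR F -> PR (fun a => unpair (F a)).
Proof. by move=> hF; rewrite /unpair; pr. Qed.

Lemma PR_iota (F G : A -> nat) : PR F -> PR G -> PR (fun a => iota (F a) (G a)).
Proof.
move=> hF hG.
apply: (PR_ext (F := fun a => nat_rect (fun=> seq nat) [::]
  (fun i s => s ++ [:: F a + i]) (G a))) => [a|].
  by elim: (G a) => // n; rewrite -addn1 iotaD addn1 /= => ->.
apply: (PR_rec (F := fun=> [::]) (H := fun a i s => s ++ [:: F a + i])) => //; pr.
Qed.

Lemma PR_sumn (F : A -> seq nat) : PR F -> PR (fun a => sumn (F a)).
Proof. by move=> hF; rewrite /sumn; pr. Qed.

Lemma PR_mem (F : A -> nat) (L : A -> seq nat) : PR F -> PR L -> PR (fun a => F a \in L a).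
Proof.
move=> hF hL; apply: (PR_ext (F := fun a => ~~ all (fun b => b != F a) (L a))) => [a|].
  by rewrite -has_predC -has_pred1; apply: eq_has => b /=; rewrite negbK.
by pr.
Qed.

Lemma PR_incomparable (F G : A -> seq nat) : PR F -> PR G ->
  PR (fun a => incomparable (F a) (G a)).
Proof.
move=> hF hG; apply: (PR_ext (F := fun a => (take (size (F a)) (G a) != F a) &&
  (take (size (G a)) (F a) != G a))) => [a|]; first by rewrite /incomparable !prefixE.
by pr.
Qed.

End MorePR.

(** The step of this fold needs the tail and not only the result on it, so the fold rebuilds the
    list beside the boolean. *)
Lemma PR_pairwise_incomparable (A : Type) (ea : Enc A) (F : A -> seq (seq nat)) : PR F ->
  PR (fun a => pairwise incomparable (F a)).
Proof.
move=> hF; pose H (x : seq nat) (t : seq (seq nat) * bool) :=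
  (x :: t.1, all (incomparable x) t.1 && t.2).
apply: (PR_ext (F := fun a => (foldr H ([::], true) (F a)).2)) => [a|].
  suff -> : foldr H ([::], true) (F a) = (F a, pairwise incomparable (F a)) by [].
  by elim: (F a) => //= x s ->.
by rewrite /H; pr; apply: PR_incomparable; pr.
Qed.

Ltac pr_ext ::= lazymatch goal with
  | |- PR (fun a => pair_code (@?F a) (@?G a)) => refine (PR_pair_code (F := F) (G := G) _ _)
  | |- PR (fun a => unpair (@?F a)) => refine (PR_unpair (F := F) _)
  | |- PR (fun a => iota (@?F a) (@?G a)) => refine (PR_iota (F := F) (G := G) _ _)
  | |- PR (fun a => sumn (@?F a)) => refine (PR_sumn (F := F) _)
  | |- PR (fun a => (@?F a) \in (@?G a)) => refine (PR_mem (F := F) (L := G) _ _)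
  | |- PR (fun a => pairwise incomparable (@?F a)) =>
      refine (PR_pairwise_incomparable (F := F) _)
  end.

(** In order: the universal parameters, two values of [g] and one of [f] at indices taken from them,
    the existential witnesses, a list of elements of the range of [f], one more value of [g], and an
    index with the value of [h] there. *)
Definition theta_type :=
  seq nat -> nat -> nat -> nat -> seq nat -> seq nat -> nat -> nat -> nat -> bool.

Definition theta_ctx : Type :=
  (seq nat * (nat * (nat * (nat * (seq nat * (seq nat * (nat * (nat * nat))))))))%type.

Definition PRtheta (th : theta_type) := PR (fun t : theta_ctx => th t.1 t.2.1 t.2.2.1
  t.2.2.2.1 t.2.2.2.2.1 t.2.2.2.2.2.1 t.2.2.2.2.2.2.1 t.2.2.2.2.2.2.2.1 t.2.2.2.2.2.2.2.2).

(* The names [f] and [g] are enumerations, so a matrix only needs finitely many elements of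
   their ranges: [s] lists elements of the range of [f], and one value [g j] codes any finite
   list of the tree diagram. *)
Definition forall_exists (th : theta_type) (f g h : nat -> nat) : Prop :=
  forall x : seq nat, exists (y s : seq nat) (j k : nat),
    th x (g (nth 0 x 0)) (g (nth 0 x 1)) (f (nth 0 x 2)) y s (g j) k (h k) /\
    (forall v, v \in s -> exists i, f i = v).

Lemma pair_code_gt a b : b < pair_code a b.
Proof. by have /and3P[] := CodeSeq.ltn_code [:: a; b]. Qed.

Lemma seq_codeK : cancel seq_code seq_decode.
Proof. exact: CodeSeq.codeK. Qed.

Lemma seq_decodeK : cancel seq_decode seq_code.
Proof. exact: CodeSeq.decodeK. Qed.

Lemma take_mkseq (f : nat -> nat) m n : take m (mkseq f n) = mkseq f (minn m n).
Proof. by rewrite /mkseq -map_take take_iota. Qed.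

(** The number [b] packs the existential witnesses with a bound [B] on all the indices consulted. As
    [B <= b], the prefixes of length [b] reach every value required, and membership in the range of
    [f] is searched for inside the prefix. *)
Lemma Pi02_forall_exists (th : theta_type) : PRtheta th -> Pi02_3 (forall_exists th).
Proof.
move=> PRth.
pose bd (b n : nat) := take (unpair b).2 (seq_decode n).
pose w (b : nat) := seq_decode (unpair b).1.
pose chk (a b F G H : nat) : bool :=
  [&& nth 0 (seq_decode a) 0 < size (bd b G), nth 0 (seq_decode a) 1 < size (bd b G),
      nth 0 (seq_decode a) 2 < size (bd b F), nth 0 (w b) 2 < size (bd b G),
      nth 0 (w b) 3 < size (bd b H),
      all (fun v => v \in bd b F) (seq_decode (nth 0 (w b) 1)) &
      th (seq_decode a) (nth 0 (bd b G) (nth 0 (seq_decode a) 0))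
         (nth 0 (bd b G) (nth 0 (seq_decode a) 1)) (nth 0 (bd b F) (nth 0 (seq_decode a) 2))
         (seq_decode (nth 0 (w b) 0)) (seq_decode (nth 0 (w b) 1))
         (nth 0 (bd b G) (nth 0 (w b) 2)) (nth 0 (w b) 3)
         (nth 0 (bd b H) (nth 0 (w b) 3))].
have [e He] : PR (fun t : nat * (nat * (nat * (nat * nat))) =>
    chk t.1 t.2.1 t.2.2.1 t.2.2.2.1 t.2.2.2.2).
  rewrite /chk /bd /w; do 6![apply: PR_andb; first by pr].
  pose F (t : nat * (nat * (nat * (nat * nat)))) : theta_ctx :=
    (seq_decode t.1, (nth 0 (bd t.2.1 t.2.2.2.1) (nth 0 (seq_decode t.1) 0),
    (nth 0 (bd t.2.1 t.2.2.2.1) (nth 0 (seq_decode t.1) 1),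
    (nth 0 (bd t.2.1 t.2.2.1) (nth 0 (seq_decode t.1) 2),
    (seq_decode (nth 0 (w t.2.1) 0), (seq_decode (nth 0 (w t.2.1) 1),
    (nth 0 (bd t.2.1 t.2.2.2.1) (nth 0 (w t.2.1) 2), (nth 0 (w t.2.1) 3,
     nth 0 (bd t.2.1 t.2.2.2.2) (nth 0 (w t.2.1) 3))))))))).
  by apply: (PR_comp (F := F) PRth); rewrite /F /bd /w; pr.
exists (PComp e [:: pr_pair (PProj 0) (pr_pair (PProj 1) (pr_pair (PProj 2)
  (pr_pair (PProj 3) (PProj 4))))]) => f g h.
have -> : forall_exists th f g h <-> forall a, exists b,
    chk a b (init_code f b) (init_code g b) (init_code h b); last first.
  split=> chkP a; have [b chkb] := chkP a; exists b; move: chkb;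
  rewrite eval_comp /= !pr_pairE !eval_proj /=;
  by rewrite (He (a, (b, (init_code f b, (init_code g b, init_code h b))))) eqb0 negbK.
split=> fe.
- move=> a; have [y [s [j [k [thx sP]]]]] := fe (seq_decode a).
  pose fi v := if pselect (exists i, f i = v) is left H then sval (cid H) else 0.
  pose x := seq_decode a.
  (* Larger than each index used, including one index [fi v] in [f] for every [v] of [s]. *)
  pose B := (nth 0 x 0 + nth 0 x 1 + nth 0 x 2 + j + k + \sum_(v <- s) fi v).+1.
  pose b := pair_code (seq_code [:: seq_code y; seq_code s; j; k]) B.
  exists b; have leB : B <= b by apply: ltnW (pair_code_gt _ _).
  have bdE u : bd b (init_code u b) = mkseq u B.
    by rewrite /bd unpairK /init_code seq_codeK take_mkseq (minn_idPl leB).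
  have wE : w b = [:: seq_code y; seq_code s; j; k] by rewrite /w unpairK seq_codeK.
  rewrite /chk !bdE wE !size_mkseq.
  rewrite [nth 0 [:: _; _; _; _] 0]/= [nth 0 [:: _; _; _; _] 1]/=.
  rewrite [nth 0 [:: _; _; _; _] 2]/= [nth 0 [:: _; _; _; _] 3]/= !seq_codeK -/x.
  have lt0 : nth 0 x 0 < B by rewrite /B; lia.
  have lt1 : nth 0 x 1 < B by rewrite /B; lia.
  have lt2 : nth 0 x 2 < B by rewrite /B; lia.
  have ltj : j < B by rewrite /B; lia.
  have ltk : k < B by rewrite /B; lia.
  rewrite !nth_mkseq // lt0 lt1 lt2 ltj ltk thx andbT /=; apply/allP => v vs.
  have fiv : f (fi v) = v.
    by rewrite /fi; case: pselect => [H|nH]; [case: (cid H) | case: nH; exact: sP].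
  apply/mapP; exists (fi v) => //; rewrite mem_iota /= add0n /B ltnS.
  by rewrite (leq_trans _ (leq_addl _ _)) // (big_rem v) //= leq_addr.
- move=> x; have [b] := fe (seq_code x); rewrite /chk !seq_codeK.
  have bdE u : bd b (init_code u b) = mkseq u (minn (unpair b).2 b).
    by rewrite /bd /init_code seq_codeK take_mkseq.
  rewrite !bdE !size_mkseq => /and5P[lt0 lt1 lt2 ltj /and3P[ltk /allP sP]].
  rewrite !nth_mkseq // => thx.
  exists (seq_decode (nth 0 (w b) 0)), (seq_decode (nth 0 (w b) 1)),
    (nth 0 (w b) 2), (nth 0 (w b) 3); split=> // v /sP /mapP[i _ ->].
  by exists i.
Qed.

(** * Codes of rationals *)

(** Rationals are pickled by generic constructions: a pair of integers subject to a test, each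
    integer as a sum of two copies of the naturals, that sum as a pair of options. This and the next
    two equations expose the layers, so that codes can be inspected by primitive recursion. *)
Lemma unpickle_pairE (T1 T2 : countType) n : @unpickle (T1 * T2)%type n =
  if seq_decode n is [:: a; b] then obind (fun x => omap (pair x) (unpickle b)) (unpickle a)
  else None.
Proof.
transitivity (omap pair_of_tag (@unpickle_tagged T1 (fun=> T2) n)); first by [].
rewrite /unpickle_tagged /seq_decode; case: (CodeSeq.decode n) => [|a [|b [|c s]]] //.
by case: (unpickle a) => //= x; case: (unpickle b).
Qed.

Lemma unpickle_intE n : @unpickle int n =
  if seq_decode n is [:: a; b] then
    if seq_decode b is x :: _ then Some (Negz x)
    else if seq_decode a is x :: _ then Some (Posz x) else None
  else None.
Proof.
have pmapE s : pmap (fun x : nat => Some x) s = s by elim: s => //= x s ->.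
transitivity (omap int_of_natsum (obind sum_of_opair
  (@unpickle (option nat * option nat)%type n))); first by [].
have optE m : @unpickle (option nat) m = Some (ohead (seq_decode m)).
  by rewrite -[seq_decode m]pmapE.
rewrite unpickle_pairE; case: (seq_decode n) => [|a [|b [|c s]]] //.
by rewrite !optE /=; case: (seq_decode b) => [|x s] //=; case: (seq_decode a).
Qed.

Lemma unpickle_ratE n : @unpickle rat n =
  if seq_decode n is [:: a; b] then
    obind (fun x : int => obind (fun y : int => insub (x, y)) (unpickle b)) (unpickle a)
  else None.
Proof.
transitivity (obind insub (@unpickle (int * int)%type n) : option rat); first by [].
rewrite unpickle_pairE; case: (seq_decode n) => [|a [|b [|c s]]] //.
by case: (unpickle a) => //= x; case: (unpickle b).
Qed.

(** An integer is a pair of optional naturals, 0 (the code of the empty list) being the absent one.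
    As in [Negz], [zneg n] stands for -(n + 1), so [zneg 0] codes -1. *)
Definition zpos n := pair_code (seq_code [:: n]) 0.
Definition zneg n := pair_code 0 (seq_code [:: n]).

Lemma unpickle_zpos n : @unpickle int (zpos n) = Some (Posz n).
Proof. by rewrite unpickle_intE /zpos /pair_code !seq_codeK. Qed.

Lemma unpickle_zneg n : @unpickle int (zneg n) = Some (Negz n).
Proof. by rewrite unpickle_intE /zneg /pair_code !seq_codeK. Qed.

Definition qint z := pair_code z (zpos 1).

Lemma rat_of_nat_qint n (z : int) : unpickle n = Some z -> rat_of_nat (qint n) = (z%:~R)%R.
Proof.
move=> nz; rewrite /rat_of_nat unpickle_ratE /qint {1}/pair_code seq_codeK nz unpickle_zpos.
rewrite -[obind _ _]/(insub (z, Posz 1) : option rat).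
case: insubP => [q _ vq|]; last by rewrite /= coprimen1.
by rewrite -ratzE; apply: val_inj.
Qed.

Definition numc n := nth 0 (seq_decode (nth 0 (seq_decode (nth 0 (seq_decode n) 0)) 0)) 0.
Definition denc n := nth 0 (seq_decode (nth 0 (seq_decode (nth 0 (seq_decode n) 1)) 0)) 0.

(** Positivity forces the numerator into the nonnegative summand, which is where [numc] looks; this
    will be applied to the approximations of [p]. *)
Lemma rat_of_nat_gt0 n : (0 < rat_of_nat n)%R ->
  0 < denc n /\ rat_of_nat n = ((numc n)%:R / (denc n)%:R)%R.
Proof.
rewrite /rat_of_nat unpickle_ratE /numc /denc.
case: (seq_decode n) => [|a [|b [|c s]]] //=; rewrite !unpickle_intE.
case: (seq_decode a) => [|a1 [|a2 [|a3 s]]] //=.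
case: (seq_decode b) => [|b1 [|b2 [|b3 s]]] //=; try by case: (seq_decode a2); case: (seq_decode a1).
case: (seq_decode a2) => [|x2 s2] /=; last first.
  set o := obind _ _; case E : o => [q|] //=; rewrite /o in E.
  case: (seq_decode b2) E => [|y2 t2] /=; last by case: insubP => //= r /andP[].
  case: (seq_decode b1) => //= y t; case: insubP => //= r _ rv [<-].
  by rewrite -numq_gt0 /numq rv.
case: (seq_decode a1) => //= x s1; set o := obind _ _; case E : o => [q|] //=; rewrite /o in E.
case: (seq_decode b2) E => [|y2 t2] /=; last by case: insubP => //= r /andP[].
case: (seq_decode b1) => //= y t; case: insubP => //= r /andP[/= y0 _] rv [<-] _.
by split=> //; rewrite -[r]divq_num_den /numq /denq rv.
Qed.

(** Negation has to be right on every number, including those that decode to nothing and make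
    [rat_of_nat] return 0; these, and the codes of zero, are left alone. *)
Definition negz a :=
  let s := seq_decode a in
  if size s == 2 then
    let p := seq_decode (nth 0 s 0) in
    let q := seq_decode (nth 0 s 1) in
    if 0 < size q then zpos (nth 0 q 0).+1
    else if 0 < nth 0 p 0 then zneg (nth 0 p 0).-1 else a
  else a.

Definition negc n :=
  let s := seq_decode n in
  if size s == 2 then pair_code (negz (nth 0 s 0)) (nth 0 s 1) else n.

Lemma unpickle_negz n : @unpickle int (negz n) = omap (@GRing.opp int) (unpickle n).
Proof.
rewrite [in RHS]unpickle_intE /negz; case E : (seq_decode n) => [|a [|b [|c s]]] /=.
- by rewrite unpickle_intE E.
- by rewrite unpickle_intE E.
- case Eb : (seq_decode b) => [|x s] /=; last by rewrite unpickle_zpos.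
  case Ea : (seq_decode a) => [|[|x] s] /=; last by rewrite unpickle_zneg.
    by rewrite unpickle_intE E Eb Ea.
  by rewrite unpickle_intE E Eb Ea.
by rewrite unpickle_intE E.
Qed.

Lemma rat_of_nat_negc n : rat_of_nat (negc n) = (- rat_of_nat n)%R.
Proof.
rewrite /rat_of_nat !unpickle_ratE /negc; case E : (seq_decode n) => [|a [|b [|c s]]] /=;
  rewrite ?E ?oppr0 //.
rewrite /pair_code seq_codeK unpickle_negz.
case: (unpickle a) => [x|] /=; last by rewrite oppr0.
case: (unpickle b) => [y|] /=; last by rewrite oppr0.
case: insubP => /= [q cq vq|ncq]; case: insubP => /= [r cr vr|ncr].
- by rewrite -[q]divq_num_den -[r]divq_num_den /numq /denq vq vr /= mulrNz mulNr.
- by case/negP: ncr; move: cq; rewrite /= abszN.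
- by case/negP: ncq; move: cr; rewrite /= abszN.
- by rewrite oppr0.
Qed.

Section PRCodes.
Variables (A : Type) (ea : Enc A) (F : A -> nat).
Hypothesis hF : PR F.

Lemma PR_zpos : PR (fun a => zpos (F a)). Proof. by rewrite /zpos; pr. Qed.
Lemma PR_zneg : PR (fun a => zneg (F a)). Proof. by rewrite /zneg; pr. Qed.
Lemma PR_numc : PR (fun a => numc (F a)). Proof. by rewrite /numc; pr. Qed.
Lemma PR_denc : PR (fun a => denc (F a)). Proof. by rewrite /denc; pr. Qed.

End PRCodes.

Lemma PR_negz (A : Type) (ea : Enc A) (F : A -> nat) : PR F -> PR (fun a => negz (F a)).
Proof.
move=> hF; rewrite /negz; apply: PR_if; [by pr| |by pr].
apply: PR_if; [by pr | by apply: PR_zpos; pr |].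
by apply: PR_if; [by pr | by apply: PR_zneg; pr | by pr].
Qed.

Lemma PR_negc (A : Type) (ea : Enc A) (F : A -> nat) : PR F -> PR (fun a => negc (F a)).
Proof.
move=> hF; rewrite /negc; apply: PR_if; [by pr| |by pr].
by apply: PR_pair_code; [apply: PR_negz |]; pr.
Qed.

(** * The matrix of the predicate *)

(* An element [c] of a tree diagram codes a pair (node, ball): [nid] is the code of the node,
   [mid] the formal rational combination giving the centre of the ball, and [rn c / rd c] its
   radius. *)
Definition nid c := (unpair c).1.
Definition node c := seq_decode (nid c).
Definition mid c := seq_decode (unpair (unpair c).2).1.
Definition rn c := (unpair (unpair (unpair c).2).2).1.+1.
Definition rd c := (unpair (unpair (unpair c).2).2).2.+1.

(** Formal combinations add by concatenation, so repetition multiplies by [N] without touching a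
    coefficient. *)
Definition rep (N : nat) (m : seq nat) := flatten (nseq N m).

(* The interval coded by the second component is (U - 1, U + 1), so this is the element of the
   diagram stating that the norm of the rational vector [m] is within 1 of [U]. *)
Definition atom (m : seq nat) (U : nat) := pair_code (seq_code m)
  (pair_code (qint (if U == 0 then zneg 0 else zpos U.-1)) (pair_code 1 0)).

(* floor (U ^ (a / b)) when b > 0 *)
Definition rpow (U a b : nat) := sumn [seq nat_of_bool (z.+1 ^ b <= U ^ a) | z <- iota 0 (U ^ a)].

Definition absdiff (x y : nat) := (x - y) + (y - x).

Definition child (p c : nat) :=
  (0 < size (node c)) && (take (size (node c)).-1 (node c) == seq_decode p).

Section Matrix.
Variables (rotsc : nat -> nat) (e0 : nat).

(** [rotsc] multiplies a coded scalar by the root of unity, and [e0] is the exponent at which the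
    root becomes -1. Thus [rot_vec e0] negates, and a list of exponents acts as the sum of the
    corresponding powers. *)
Definition rotc c := pair_code (rotsc (unpair c).1) (unpair c).2.
Definition rot_vec (e : nat) (m : seq nat) := iter e (map rotc) m.
Definition act (l m : seq nat) := flatten [seq rot_vec e m | e <- l].
Definition coefs (E : seq nat) (i : nat) := seq_decode (nth 0 E i).
Definition cen (E W : seq nat) :=
  flatten [seq act (coefs E i) (mid (nth 0 W i)) | i <- iota 0 (size W)].
Definition tot (E W : seq nat) := sumn [seq size (coefs E i) | i <- iota 0 (size W)].
(** A coefficient that is a sum of n roots of unity has modulus at most n, so [tot] bounds the sum
    of the moduli. If all radii are at most 1 / (N [tot]), passing from the vectors to the centres
    changes N times the combination by at most 1. *)
Definition small (N : nat) (E W : seq nat) := all (fun c => N * tot E W * rn c <= rd c) W.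

(** States N r <= 1 and U + 2 <= N r' for the radii r, r'. If N times the distance of the centres is
    below U + 1, as [diff_atom] will say, then distance + r < r'. *)
Definition inside (N U c c' : nat) := (N * rn c <= rd c) && (U.+2 * rd c' <= N * rn c').
Definition diff_atom (N U c c' : nat) := atom (rep N (mid c ++ rot_vec e0 (mid c'))) U.

Definition one_coef := seq_code [:: 0].
Definition opp_coef := seq_code [:: e0].

(* In [x], the entries 0 and 1 are the indices of the values [g0], [g1] of [g], entry 2 is the
   index of the value [f2] of [f], entry 3 selects one of the matrices below, and the entries
   from 4 on are their parameters. *)
Definition th_nil : theta_type := fun x g0 g1 f2 y s w k q => seq_decode w == [::].

Definition th_cons : theta_type := fun x g0 g1 f2 y s w k q =>
  (nth 0 x 4 < size (seq_decode g1)) ==>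
  (seq_decode w == nth 0 (seq_decode g1) (nth 0 x 4) :: seq_decode g0).

Definition th_refine : theta_type := fun x g0 g1 f2 y s w k q =>
  ((2 <= size (seq_decode g0)) &&
    (nid (nth 0 (seq_decode g0) 0) == nid (nth 0 (seq_decode g0) 1))) ==>
  [&& 0 < size (seq_decode w), nid (nth 0 (seq_decode w) 0) == nid (nth 0 (seq_decode g0) 0),
      nth 0 x 4 <= nth 0 y 0,
      inside (nth 0 y 0) (nth 0 y 1) (nth 0 (seq_decode w) 0) (nth 0 (seq_decode g0) 0),
      inside (nth 0 y 0) (nth 0 y 2) (nth 0 (seq_decode w) 0) (nth 0 (seq_decode g0) 1),
      diff_atom (nth 0 y 0) (nth 0 y 1) (nth 0 (seq_decode w) 0) (nth 0 (seq_decode g0) 0) \in s &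
      diff_atom (nth 0 y 0) (nth 0 y 2) (nth 0 (seq_decode w) 0) (nth 0 (seq_decode g0) 1) \in s].

(** Here strict inclusion of balls is a premise, so the diagram element certifying it is read at a
    universal index. *)
Definition th_enlarge : theta_type := fun x g0 g1 f2 y s w k q =>
  [&& 0 < size (seq_decode g0), nid (nth 0 (seq_decode g0) 0) == nid (nth 0 x 4),
      inside (nth 0 x 5) (nth 0 x 6) (nth 0 (seq_decode g0) 0) (nth 0 x 4) &
      f2 == diff_atom (nth 0 x 5) (nth 0 x 6) (nth 0 (seq_decode g0) 0) (nth 0 x 4)] ==>
  (nth 0 x 4 \in seq_decode w).

Definition th_tree : theta_type := fun x g0 g1 f2 y s w k q =>
  (0 < size (seq_decode g0)) ==>
  ((0 < size (seq_decode w)) &&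
   (node (nth 0 (seq_decode w) 0) == take (nth 0 x 4) (node (nth 0 (seq_decode g0) 0)))).

(** The integer [nth 0 y 1] is at distance less than 2 from N times the norm of the difference;
    being at least 2 it proves that norm positive. The same threshold serves in [th_nonzero]. *)
Definition th_inj : theta_type := fun x g0 g1 f2 y s w k q =>
  ((2 <= size (seq_decode g0)) &&
    (nid (nth 0 (seq_decode g0) 0) != nid (nth 0 (seq_decode g0) 1))) ==>
  [&& map nid (seq_decode w) ==
        [:: nid (nth 0 (seq_decode g0) 0); nid (nth 0 (seq_decode g0) 1)],
      small (nth 0 y 0) [:: one_coef; opp_coef] (seq_decode w), 2 <= nth 0 y 1 &
      atom (rep (nth 0 y 0) (cen [:: one_coef; opp_coef] (seq_decode w))) (nth 0 y 1) \in s].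

Definition th_nonzero : theta_type := fun x g0 g1 f2 y s w k q =>
  (0 < size (seq_decode g0)) ==>
  [&& map nid (seq_decode w) == [:: nid (nth 0 (seq_decode g0) 0)],
      small (nth 0 y 0) [:: one_coef] (seq_decode w), 2 <= nth 0 y 1 &
      atom (rep (nth 0 y 0) (cen [:: one_coef] (seq_decode w))) (nth 0 y 1) \in s].

(** Coefficient 1 for the node and -1 for each child. In the test below, the value 0 in the atom
    gives N ‖node - sum of children‖ < 2, and incomparability keeps a child from being counted
    twice. *)
Definition sum_coefs (n : nat) := one_coef :: nseq n.-1 opp_coef.

Definition th_sum : theta_type := fun x g0 g1 f2 y s w k q =>
  ((2 <= size (seq_decode g0)) &&
    all (child (nid (nth 0 (seq_decode g0) 0))) (behead (seq_decode g0))) ==>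
  [&& 0 < size (seq_decode w), nid (nth 0 (seq_decode w) 0) == nid (nth 0 (seq_decode g0) 0),
      all (child (nid (nth 0 (seq_decode g0) 0))) (behead (seq_decode w)),
      pairwise incomparable (map node (behead (seq_decode w))),
      all (fun c => nid c \in map nid (behead (seq_decode w))) (behead (seq_decode g0)),
      nth 0 x 4 <= nth 0 y 0,
      small (nth 0 y 0) (sum_coefs (size (seq_decode w))) (seq_decode w) &
      atom (rep (nth 0 y 0) (cen (sum_coefs (size (seq_decode w))) (seq_decode w))) 0 \in s].

(** Entry 5 of [x] is the precision K; [y] holds the scale, the integer for the sum and the coded
    list of those for the summands. The index [k] must exceed K too, so that the exponent tends to
    p. *)
Definition th_sep : theta_type := fun x g0 g1 f2 y s w k q =>
  pairwise incomparable (map node (seq_decode g0)) ==>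
  [&& map nid (seq_decode w) == map nid (seq_decode g0),
      nth 0 x 5 <= nth 0 y 0, nth 0 x 5 < k,
      small (nth 0 y 0) (seq_decode (nth 0 x 4)) (seq_decode w),
      atom (rep (nth 0 y 0) (cen (seq_decode (nth 0 x 4)) (seq_decode w))) (nth 0 y 1) \in s,
      all (fun i => atom (rep (nth 0 y 0) (act (coefs (seq_decode (nth 0 x 4)) i)
                                               (mid (nth 0 (seq_decode w) i))))
                         (nth 0 (seq_decode (nth 0 y 2)) i) \in s) (iota 0 (size (seq_decode w))) &
      nth 0 x 5 * absdiff (rpow (nth 0 y 1) (numc q) (denc q))
        (sumn [seq rpow (nth 0 (seq_decode (nth 0 y 2)) i) (numc q) (denc q)
              | i <- iota 0 (size (seq_decode w))])
      <= rpow (nth 0 y 0) (numc q) (denc q)].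

(** With M and D for [nth 0 x 5] and [nth 0 y 1]: M D m plus an integral combination of tree vectors
    has norm below D. Division by M D puts m within 1/M of the span, D acting as a common
    denominator of the coefficients. *)
Definition th_dense : theta_type := fun x g0 g1 f2 y s w k q =>
  [&& small 1 (seq_decode (nth 0 y 0)) (seq_decode w), (nth 0 y 2).+2 <= nth 0 y 1 &
      atom (rep (nth 0 x 5 * nth 0 y 1) (seq_decode (nth 0 x 4)) ++
            cen (seq_decode (nth 0 y 0)) (seq_decode w)) (nth 0 y 2) \in s].

Definition matrices := [:: th_cons; th_refine; th_enlarge; th_tree; th_inj;
  th_nonzero; th_sum; th_sep; th_dense].

(** A conjunction of forall-exists statements is one such statement, a universal parameter choosing
    the conjunct; selectors beyond the list fall back on [th_nil]. *)
Definition disint_matrix : theta_type := fun x g0 g1 f2 y s w k q =>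
  foldr (fun (t : nat * theta_type) b => if nth 0 x 3 == t.1
    then t.2 x g0 g1 f2 y s w k q else b) (th_nil x g0 g1 f2 y s w k q)
    (zip (iota 0 (size matrices)) matrices).

(** * Primitive recursiveness of the matrices *)

Hypothesis PR_rotsc : PR rotsc.

Section PRMatrix.
Variables (A : Type) (ea : Enc A).
Implicit Types (F G H : A -> nat) (L M : A -> seq nat).

Lemma PR_nid F : PR F -> PR (fun a => nid (F a)).
Proof. by move=> hF; rewrite /nid; pr. Qed.
Lemma PR_mid F : PR F -> PR (fun a => mid (F a)).
Proof. by move=> hF; rewrite /mid; pr. Qed.
Lemma PR_rn F : PR F -> PR (fun a => rn (F a)).
Proof. by move=> hF; rewrite /rn; pr. Qed.
Lemma PR_rd F : PR F -> PR (fun a => rd (F a)).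
Proof. by move=> hF; rewrite /rd; pr. Qed.
Lemma PR_rep F L : PR F -> PR L -> PR (fun a => rep (F a) (L a)).
Proof. by move=> hF hL; rewrite /rep; pr. Qed.

Lemma PR_atom L F : PR L -> PR F -> PR (fun a => atom (L a) (F a)).
Proof.
move=> hL hF; rewrite /atom /qint; apply: PR_pair_code; first by pr.
apply: PR_pair_code; last by pr.
by apply: PR_pair_code; [apply: PR_if; [by pr|by pr|apply: PR_zpos] |]; pr.
Qed.

Lemma PR_rpow F G H : PR F -> PR G -> PR H -> PR (fun a => rpow (F a) (G a) (H a)).
Proof. by move=> hF hG hH; rewrite /rpow; pr. Qed.

Lemma PR_rot_vec F L : PR F -> PR L -> PR (fun a => rot_vec (F a) (L a)).
Proof. by move=> hF hL; rewrite /rot_vec /rotc; pr. Qed.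

End PRMatrix.

Ltac pr_mat := repeat first [assumption | pr_hyp | pr_step | lazymatch goal with
  | |- PR (fun a => nid (@?F a)) => refine (PR_nid (F := F) _)
  | |- PR (fun a => mid (@?F a)) => refine (PR_mid (F := F) _)
  | |- PR (fun a => rn (@?F a)) => refine (PR_rn (F := F) _)
  | |- PR (fun a => rd (@?F a)) => refine (PR_rd (F := F) _)
  | |- PR (fun a => numc (@?F a)) => refine (PR_numc (F := F) _)
  | |- PR (fun a => denc (@?F a)) => refine (PR_denc (F := F) _)
  | |- PR (fun a => rep (@?F a) (@?L a)) => refine (PR_rep (F := F) (L := L) _ _)
  | |- PR (fun a => atom (@?L a) (@?F a)) => refine (PR_atom (L := L) (F := F) _ _)
  | |- PR (fun a => rpow (@?F a) (@?G a) (@?H a)) =>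
      refine (PR_rpow (F := F) (G := G) (H := H) _ _ _)
  | |- PR (fun a => rot_vec (@?F a) (@?L a)) => refine (PR_rot_vec (F := F) (L := L) _ _)
  end].

Lemma PR_disint_matrix : PRtheta disint_matrix.
Proof.
rewrite /PRtheta /disint_matrix /=.
apply: PR_if; [by pr | by rewrite /th_cons; pr |].
apply: PR_if; [by pr | by rewrite /th_refine /inside /diff_atom; pr_mat |].
apply: PR_if; [by pr | by rewrite /th_enlarge /inside /diff_atom; pr_mat |].
apply: PR_if; [by pr | by rewrite /th_tree /node; pr_mat |].
apply: PR_if; [by pr | by rewrite /th_inj /small /tot /cen /act /coefs; pr_mat |].
apply: PR_if; [by pr | by rewrite /th_nonzero /small /tot /cen /act /coefs; pr_mat |].
apply: PR_if; [by pr | by rewrite /th_sum /child /node /sum_coefs /small /tot /cen /act /coefs;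
  pr_mat |].
apply: PR_if; [by pr | by rewrite /th_sep /node /absdiff /small /tot /cen /act /coefs; pr_mat |].
apply: PR_if; [by pr | by rewrite /th_dense /small /tot /cen /act /coefs; pr_mat |].
by rewrite /th_nil; pr.
Qed.

Lemma matrix_split f g h : forall_exists disint_matrix f g h <->
  [/\ forall_exists th_nil f g h, forall_exists th_cons f g h, forall_exists th_refine f g h,
      forall_exists th_enlarge f g h & [/\ forall_exists th_tree f g h,
      forall_exists th_inj f g h, forall_exists th_nonzero f g h,
      forall_exists th_sum f g h & forall_exists th_sep f g h /\ forall_exists th_dense f g h]].
Proof.
(* Overwriting entry 3 selects a conjunct and keeps the other entries as they are, also for short
   [x], since padding uses the default 0. *)
have thE x g0 g1 f2 y s w k q t :
  disint_matrix (set_nth 0 x 3 t) g0 g1 f2 y s w k q =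
  nth th_nil matrices t (set_nth 0 x 3 t) g0 g1 f2 y s w k q.
  rewrite /disint_matrix /= nth_set_nth /=.
  by do 9![case: t => [//|t]]; rewrite /= nth_nil.
split=> [mP|].
  have get (th : theta_type) t : nth th_nil matrices t = th ->
      (forall x t g0 g1 f2 y s w k q, th (set_nth 0 x 3 t) g0 g1 f2 y s w k q =
        th x g0 g1 f2 y s w k q) -> forall_exists th f g h.
    move=> tht thx x; have [y [s [j [k [tP sP]]]]] := mP (set_nth 0 x 3 t).
    exists y, s, j, k; split=> //; move: tP.
    by rewrite thE tht !nth_set_nth /= thx.
  have nthx x t i : i != 3 -> nth 0 (set_nth 0 x 3 t) i = nth 0 x i.
    by rewrite nth_set_nth /= => /negbTE ->.
  split; [apply: (get _ 9) | apply: (get _ 0) | apply: (get _ 1) | apply: (get _ 2) | split;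
    [apply: (get _ 3) | apply: (get _ 4) | apply: (get _ 5) | apply: (get _ 6) |
     split; [apply: (get _ 7) | apply: (get _ 8)]]] => //.
  - by move=> *; rewrite /th_cons !nthx.
  - by move=> *; rewrite /th_refine !nthx.
  - by move=> *; rewrite /th_enlarge !nthx.
  - by move=> *; rewrite /th_tree !nthx.
  - by move=> *; rewrite /th_sum !nthx.
  - by move=> *; rewrite /th_sep !nthx.
  - by move=> *; rewrite /th_dense !nthx.
move=> [h9 h0 h1 h2 [h3 h4 h5 h6 [h7 h8]]] x; rewrite /disint_matrix /=.
case: (nth 0 x 3 == 0); first exact: h0.
case: (nth 0 x 3 == 1); first exact: h1.
case: (nth 0 x 3 == 2); first exact: h2.
case: (nth 0 x 3 == 3); first exact: h3.
case: (nth 0 x 3 == 4); first exact: h4.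
case: (nth 0 x 3 == 5); first exact: h5.
case: (nth 0 x 3 == 6); first exact: h6.
case: (nth 0 x 3 == 7); first exact: h7.
case: (nth 0 x 3 == 8); first exact: h8.
exact: h9.
Qed.

End Matrix.

Local Open Scope classical_set_scope.
Local Open Scope ring_scope.

(** * Norms with values in the reals *)

(* The common properties of the real scalars ([iota = -1]) and of the complex scalars
   ([iota = 'i]): sums of powers of [iota] are dense up to scaling, so that vectors can be
   multiplied by enough scalars without arithmetic on codes of rationals. *)
Record scalar_spec (R : realType) (K : numFieldType) (toR : K -> R) (ratsc : nat -> K)
    (iota_sc : K) (rotsc : nat -> nat) (e0 : nat) : Prop := ScalarSpec {
  toRD : forall x y, 0 <= x -> 0 <= y -> toR (x + y) = toR x + toR y;
  toRM : forall x y, 0 <= x -> 0 <= y -> toR (x * y) = toR x * toR y;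
  toR_le : forall x y, 0 <= x -> 0 <= y -> (toR x <= toR y) = (x <= y);
  toR1 : toR 1 = 1;
  toR_sur : forall e : R, 0 < e -> exists2 x, 0 < x & toR x = e;
  ratsc_rot : forall n, ratsc (rotsc n) = iota_sc * ratsc n;
  iotaX : iota_sc ^+ e0 = -1;
  ratsc_dense : forall (a : K) (e : R), 0 < e -> exists n, toR `|a - ratsc n| < e;
  iota_dense : forall a : K, exists l : seq nat, toR `|a - \sum_(e <- l) iota_sc ^+ e| <= 2
}.

Section Norm.
Context (R : realType) (K : numFieldType) (toR : K -> R) (ratsc : nat -> K).
Context (iota_sc : K) (rotsc : nat -> nat) (e0 : nat).
Hypothesis sc : scalar_spec toR ratsc iota_sc rotsc e0.

Lemma toR0 : toR 0 = 0.
Proof.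
have := toRD sc (lexx 0) (lexx 0); rewrite addr0 => /esym/eqP.
by rewrite -subr_eq0 addrK => /eqP.
Qed.

Lemma toR_ge0 x : 0 <= x -> 0 <= toR x.
Proof. by move=> x0; rewrite -toR0 (toR_le sc). Qed.

Lemma toR_inj x y : 0 <= x -> 0 <= y -> toR x = toR y -> x = y.
Proof.
move=> x0 y0 e; apply/eqP; rewrite eq_le -(toR_le sc x0 y0) -(toR_le sc y0 x0).
by rewrite e lexx.
Qed.

Lemma toR_lt x y : 0 <= x -> 0 <= y -> (toR x < toR y) = (x < y).
Proof.
move=> x0 y0; rewrite !lt_neqAle (toR_le sc) //; congr (~~ _ && _).
by apply/eqP/eqP => [/toR_inj-> | ->].
Qed.

Lemma toR_nat n : toR n%:R = n%:R.
Proof. by elim: n => [|n IHn]; rewrite ?toR0 // -!natr1 (toRD sc) // IHn (toR1 sc). Qed.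

Section Space.
Variable V : completeNormedModType K.
Implicit Types v w : V.
Local Notation nrm := (@nrm R K toR V).

Lemma nrm_ge0 v : 0 <= nrm v.
Proof. exact: toR_ge0. Qed.

Lemma nrm0 : nrm 0 = 0.
Proof. by rewrite /Defs.nrm normr0 toR0. Qed.

Lemma nrm_eq0 v : nrm v = 0 -> v = 0.
Proof. by rewrite -toR0 => /(toR_inj (normr_ge0 _) (lexx _))/normr0_eq0. Qed.

Lemma nrmN v : nrm (- v) = nrm v.
Proof. by rewrite /Defs.nrm normrN. Qed.

Lemma nrm_distC v w : nrm (v - w) = nrm (w - v).
Proof. by rewrite -nrmN opprB. Qed.

Lemma nrmD v w : nrm (v + w) <= nrm v + nrm w.
Proof. by rewrite -(toRD sc) // (toR_le sc) // ?addr_ge0 // ler_normD. Qed.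

Lemma nrmB v w : nrm (v - w) <= nrm v + nrm w.
Proof. by rewrite -(nrmN w) nrmD. Qed.

Lemma nrm_triangle u v w : nrm (v - w) <= nrm (v - u) + nrm (u - w).
Proof. by rewrite -[v - w](_ : (v - u) + (u - w) = _) ?nrmD // addrA subrK. Qed.

Lemma nrm_dist v w : `|nrm v - nrm w| <= nrm (v - w).
Proof.
have h1 := nrmD (v - w) w; rewrite subrK in h1.
have h2 := nrmD (w - v) v; rewrite subrK nrm_distC in h2.
by rewrite ler_norml; lra.
Qed.

Lemma nrmZ a v : nrm (a *: v) = toR `|a| * nrm v.
Proof. by rewrite /Defs.nrm normrZ (toRM sc). Qed.

Lemma nrmMn v n : nrm (v *+ n) = n%:R * nrm v.
Proof. by rewrite -scaler_nat nrmZ normr_nat toR_nat. Qed.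

Lemma nrm_sum (I : Type) (r : seq I) (P : pred I) (F : I -> V) :
  nrm (\sum_(i <- r | P i) F i) <= \sum_(i <- r | P i) nrm (F i).
Proof.
elim/big_rec2: _ => [|i y x _ le_yx]; first by rewrite nrm0.
by apply: le_trans (nrmD _ _) _; rewrite lerD2l.
Qed.

(** The modulus has [e0]-th power |-1| = 1, and [e0] is positive because 1 and -1 differ in
    characteristic 0. *)
Lemma norm_iota : toR `|iota_sc| = 1.
Proof.
have h : `|iota_sc| ^+ e0 = 1 by rewrite -normrX (iotaX sc) normrN1.
rewrite -(toR1 sc); congr toR; apply/eqP.
have [e00|e00] := posnP e0.
  by move: (iotaX sc); rewrite e00 expr0 => /eqP; rewrite -subr_eq0 opprK -mulr2n pnatr_eq0.
by rewrite -(pexpr_eq1 e00) ?h ?normr_ge0.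
Qed.

Lemma nrm_iota e v : nrm (iota_sc ^+ e *: v) = nrm v.
Proof.
elim: e => [|e IHe]; first by rewrite scale1r.
by rewrite exprS -scalerA nrmZ norm_iota mul1r.
Qed.

Lemma cvg_nrmP (u : nat -> V) (l : V) : u @ \oo --> l <->
  forall e : R, 0 < e -> exists N, forall n, (N <= n)%N -> nrm (u n - l) < e.
Proof.
split=> [/cvgrPdist_lt ul e e0'|ul].
  have [x x0 xe] := toR_sur sc e0'; have [N _ NP] := ul x x0.
  by exists N => n /NP; rewrite nrm_distC -xe toR_lt // ltW.
apply/cvgrPdist_lt => x x0; have xx : 0 < toR x by rewrite -toR0 toR_lt // ltW.
have [N NP] := ul _ xx; exists N => // n /NP.
by rewrite nrm_distC toR_lt // ltW.
Qed.

Lemma cauchy_nrm (u : nat -> V) :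
  (forall e : R, 0 < e -> exists N, forall n m, (N <= n)%N -> (N <= m)%N -> nrm (u n - u m) < e) ->
  exists l, forall e : R, 0 < e -> exists N, forall n, (N <= n)%N -> nrm (u n - l) < e.
Proof.
move=> cau; suff /cvg_ex[l /cvg_nrmP ul] : cvg (u @ \oo) by exists l.
apply: cauchy_cvg; apply/cauchy_exP => x x0.
have xx : 0 < toR x by rewrite -toR0 toR_lt // ltW.
have [N NP] := cau _ xx; exists (u N); exists N => // n Nn.
rewrite -ball_normE /ball_ /=; have := NP N n (leqnn _) Nn.
by rewrite toR_lt // ltW.
Qed.

Lemma closure_nrmP (A : set V) v : closure A v <->
  forall e : R, 0 < e -> exists2 w, A w & nrm (v - w) < e.
Proof.
split=> [cA e e0'|cA B /nbhs_ballP[x /= x0 xB]].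
  have [x x0 xe] := toR_sur sc e0'; have [w [Aw]] := cA _ (nbhsx_ballx v x x0).
  by rewrite -ball_normE /= => vw; exists w => //; rewrite -xe toR_lt // ltW.
have xx : 0 < toR x by rewrite -toR0 toR_lt // ltW.
have [w Aw vw] := cA _ xx; exists w; split=> //; apply: xB.
by rewrite -ball_normE /=; move: vw; rewrite toR_lt // ltW.
Qed.

Lemma lin_denseP (X : set V) : lin_dense X <-> forall v (e : R), 0 < e ->
  exists2 s : seq (K * V), (forall c, c \in s -> X c.2) & nrm (v - \sum_(c <- s) c.1 *: c.2) < e.
Proof.
rewrite /lin_dense; split=> [dX v e e1|dX].
  have /closure_nrmP/(_ e e1)[w [s [sX ->]] lt_e] : closure [set v : V |
    exists s : seq (K * V), (forall c, c \in s -> X c.2) /\ v = \sum_(c <- s) c.1 *: c.2] v.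
    by rewrite dX.
  by exists s.
apply/seteqP; split=> // v _; apply/closure_nrmP => e e1.
by have [s sX lt_e] := dX v e e1; exists (\sum_(c <- s) c.1 *: c.2) => //; exists s.
Qed.

End Space.
End Norm.

(** * Rational vectors and the diagram *)

Section Diagram.
Context (R : realType) (K : numFieldType) (toR : K -> R) (ratsc : nat -> K).
Context (iota_sc : K) (rotsc : nat -> nat) (e0 : nat).
Hypothesis sc : scalar_spec toR ratsc iota_sc rotsc e0.
Context (V : completeNormedModType K) (P : nat -> V).
Local Notation nrm := (@nrm R K toR V).
Local Notation rot_vec := (rot_vec rotsc).
Local Notation act := (act rotsc).
Local Notation cen := (cen rotsc).

Definition rv (m : seq nat) : V := \sum_(c <- m) ratsc (unpair c).1 *: P (unpair c).2.

Definition zcoef (l : seq nat) : K := \sum_(e <- l) iota_sc ^+ e.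

Lemma rv_cat m m' : rv (m ++ m') = rv m + rv m'.
Proof. by rewrite /rv big_cat. Qed.

Lemma rv_flatten (ms : seq (seq nat)) : rv (flatten ms) = \sum_(m <- ms) rv m.
Proof.
by elim: ms => [|m ms IHms]; rewrite /= ?big_nil ?big_cons ?rv_cat ?IHms // /rv big_nil.
Qed.

Lemma rv_rep N m : rv (rep N m) = rv m *+ N.
Proof.
elim: N => [|N IHN]; first by rewrite /rv big_nil.
by rewrite -[rep N.+1 m]/(m ++ rep N m) rv_cat IHN mulrS.
Qed.

Lemma rv_rot e m : rv (rot_vec e m) = iota_sc ^+ e *: rv m.
Proof.
elim: e => [|e IHe]; first by rewrite scale1r.
rewrite -[rot_vec e.+1 m]/(map (rotc rotsc) (rot_vec e m)) exprS -scalerA -IHe /rv big_map.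
rewrite scaler_sumr; apply: eq_bigr => c _.
by rewrite /rotc unpairK /= (ratsc_rot sc) scalerA.
Qed.

Lemma rv_rot_e0 m : rv (rot_vec e0 m) = - rv m.
Proof. by rewrite rv_rot (iotaX sc) scaleN1r. Qed.

Lemma rv_act l m : rv (act l m) = zcoef l *: rv m.
Proof.
by rewrite rv_flatten big_map /zcoef scaler_suml; apply: eq_bigr => e _; rewrite rv_rot.
Qed.

Lemma rv_cen E W : rv (cen E W) = \sum_(i < size W) zcoef (coefs E i) *: rv (mid (nth 0 W i)%N).
Proof.
rewrite rv_flatten big_map -[X in iota _ X]subn0 -/(index_iota 0 (size W)) big_mkord.
by apply: eq_bigr => i _; rewrite rv_act.
Qed.

Lemma nrm_zcoef l v : nrm (zcoef l *: v) <= (size l)%:R * nrm v.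
Proof.
rewrite /zcoef scaler_suml; apply: le_trans (nrm_sum sc _ _ _) _.
under eq_bigr do rewrite (nrm_iota sc).
by rewrite big_const_seq count_predT iter_addr_0 mulr_natl.
Qed.

Lemma rv_dense : presentation P -> forall v (e : R), 0 < e -> exists m, nrm (v - rv m) < e.
Proof.
move=> /(lin_denseP sc) dP v e e1; have e2 : 0 < e / 2 by lra.
have [s sP lt_e] := dP v _ e2.
suff [m lt_m] : exists m, nrm (\sum_(c <- s) c.1 *: c.2 - rv m) < e / 2.
  exists m; apply: le_lt_trans (nrm_triangle sc (\sum_(c <- s) c.1 *: c.2) _ _) _.
  by rewrite [ltRHS](splitr e) ltrD.
move: (e / 2) e2 sP {lt_e} => d; elim: s d => [|[a w] s IHs] d d0 sP.
  by exists [::]; rewrite /rv !big_nil subrr (nrm0 sc).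
have [k _ Pk] : range P w by apply: (sP (a, w)); rewrite mem_head.
have d2 : 0 < d / 2 by lra.
have [m lt_m] : exists m, nrm (\sum_(c <- s) c.1 *: c.2 - rv m) < d / 2.
  by apply: IHs => // c cs; apply: sP; rewrite in_cons cs orbT.
(* The summand 1 keeps the bound d / 2 / (‖w‖ + 1) for the coefficient meaningful when w = 0. *)
have w1 : 0 < nrm w + 1 by rewrite ltr_pwDr // (nrm_ge0 sc).
have [n lt_n] := ratsc_dense sc a (divr_gt0 d2 w1).
exists (pair_code n k :: m); rewrite big_cons /= -cat1s rv_cat {1}/rv big_seq1 unpairK /= Pk.
rewrite opprD addrACA -scalerBl; apply: le_lt_trans (nrmD sc _ _) _.
rewrite [ltRHS](splitr d) ler_ltD // (nrmZ sc).
apply: le_trans (_ : _ <= toR `|a - ratsc n| * (nrm w + 1)) _.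
  by rewrite ler_wpM2l ?(toR_ge0 sc) // lerDl.
by rewrite -ler_pdivlMr // ltW.
Qed.

Lemma ratr_rn_rd c : ratr (posrat_of_nat (unpair (unpair c).2).2) = (rn c)%:R / (rd c)%:R :> R.
Proof. by rewrite /posrat_of_nat fmorph_div !rmorph_nat. Qed.

Definition cradius (c : nat) : R := (rn c)%:R / (rd c)%:R.

Lemma cradius_gt0 c : 0 < cradius c.
Proof. by rewrite divr_gt0 // ltr0n. Qed.

Lemma cradius_le (N c : nat) : (N * rn c <= rd c)%N -> N%:R * cradius c <= 1.
Proof.
by move=> h; rewrite /cradius mulrA ler_pdivrMr ?ltr0n // mul1r -natrM ler_nat.
Qed.

Section Named.
Variable f : nat -> nat.
Hypotheses (presP : presentation P) (namesP : names_pres toR ratsc P f).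

Lemma atomP m U : (exists i, f i = atom m U) <-> `|nrm (rv m) - U%:R| < 1.
Proof.
have intU : rat_of_nat (qint (if U == 0 then zneg 0 else zpos U.-1))%N = U%:R - 1.
  case: U => [|U] /=; first by rewrite (rat_of_nat_qint (unpickle_zneg 0)).
  by rewrite (rat_of_nat_qint (unpickle_zpos U)) -natr1 addrK.
have ivl x : rat_interval (pair_code (qint (if U == 0 then zneg 0 else zpos U.-1))
    (pair_code 1 0)) x <-> `|x - U%:R| < 1 :> R.
  rewrite /rat_interval unpairK /posrat_of_nat unpairK intU divr1 /=.
  rewrite !rmorphD rmorphN /= rmorph1 !rmorph_nat ltr_norml.
  by split=> /andP[h1 h2]; apply/andP; split; lra.
rewrite -ivl; split=> [[i fi]|ivlm].
  have : range f (atom m U) by exists i.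
  rewrite namesP => -[m' [n' [/pair_code_inj[<- <-]]]].
  by rewrite /ratvec seq_codeK.
have : range f (atom m U).
  rewrite namesP; exists (seq_code m); eexists; split; first by [].
  by rewrite /ratvec seq_codeK.
by move=> [i _ fi]; exists i.
Qed.

Lemma atom_ex m : exists2 U, (exists i, f i = atom m U) & U%:R <= nrm (rv m) < U%:R + 1.
Proof.
have := truncn_itv (nrm_ge0 sc (rv m)); rewrite -natr1; set U := Num.truncn _ => itvU.
exists U => //; apply/atomP; case/andP: itvU => h1 h2.
by rewrite ltr_norml; apply/andP; split; lra.
Qed.

Section Tree.
Variables (S : set (seq nat)) (psi : seq nat -> V).

Definition inA c := S (node c) /\ nrm (psi (node c) - rv (mid c)) < cradius c.

Lemma names_treeE g : names_tree toR ratsc P S psi g <->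
  range g = [set k | forall c, c \in seq_decode k -> inA c].
Proof.
rewrite /names_tree; split=> ->; apply/seteqP; split=> k /= kP c /kP;
  by rewrite /inA /rat_ball /= ratr_rn_rd /ratvec /node /nid /rv /mid.
Qed.

Lemma ball_ex nu M : S nu -> exists c, [/\ inA c, nid c = seq_code nu & (M * rn c <= rd c)%N].
Proof.
move=> Snu; have e1 : 0 < 1%:R / M.+1%:R :> R by rewrite divr_gt0 // ltr0n.
have [m lt_m] := rv_dense presP (psi nu) e1.
(* In the code of the radius, 0 and [M] stand for numerator 1 and denominator M + 1. *)
exists (pair_code (seq_code nu) (pair_code (seq_code m) (pair_code 0 M))).
rewrite /inA /node /nid /mid /cradius /rn /rd !unpairK /= !seq_codeK.
by rewrite muln1; split.
Qed.

Definition lincomb (E : seq nat) (nus : seq (seq nat)) : V :=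
  \sum_(i < size nus) zcoef (coefs E i) *: psi (nth [::] nus i).

Lemma tot_size E W W' : size W = size W' -> tot E W = tot E W'.
Proof. by rewrite /tot => ->. Qed.

Lemma balls_ex N E nus : (forall nu, nu \in nus -> S nu) -> exists W,
  [/\ forall c, c \in W -> inA c, map nid W = map seq_code nus & small N E W].
Proof.
move=> nusS; have [W [WA nidW smW]] : exists W, [/\ forall c, c \in W -> inA c,
    map nid W = map seq_code nus &
    forall c, c \in W -> (N * tot E (map seq_code nus) * rn c <= rd c)%N].
  (* The required precision depends on the whole list; it is turned into a constant before the
     induction. *)
  move: (N * _)%N => M; elim: nus nusS => [|nu nus IH] nusS; first by exists [::].
  have [|W [WA nidW smW]] := IH _; first by move=> mu h; apply: nusS; rewrite in_cons h orbT.
  have [c [cA nidc smc]] := ball_ex M (nusS nu (mem_head _ _)).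
  exists (c :: W); split; rewrite /= ?nidc ?nidW // => d; rewrite in_cons => /predU1P[->//|].
    exact: WA.
  exact: smW.
exists W; split=> //; apply/allP => c /smW.
by rewrite (@tot_size _ _ W) // -nidW !size_map.
Qed.

Lemma nid_nodes W nus : map nid W = map seq_code nus -> map node W = nus.
Proof.
move=> /(congr1 (map seq_decode)); rewrite -!map_comp => ->.
by rewrite (eq_map (g := id)) ?map_id // => nu /=; rewrite seq_codeK.
Qed.

(** The i-th term moves by at most the size of its coefficient list times the radius of its ball;
    these sizes add up to [tot], for which [small] was made. *)
Lemma lincomb_approx N E W : (forall c, c \in W -> inA c) -> small N E W ->
  N%:R * nrm (lincomb E (map node W) - rv (cen E W)) <= 1.
Proof.
move=> WA /allP smW; rewrite /lincomb size_map rv_cen -sumrB.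
apply: le_trans (_ : _ <= \sum_(i < size W) N%:R * ((size (coefs E i))%:R * cradius (nth 0%N W i))) _.
  rewrite -mulr_sumr ler_wpM2l ?ler0n //; apply: le_trans (nrm_sum sc _ _ _) _.
  apply: ler_sum => i _; rewrite (nth_map 0%N) // -scalerBr.
  apply: le_trans (nrm_zcoef _ _) _; rewrite ler_wpM2l ?ler0n // ltW //.
  by have [] := WA _ (mem_nth 0%N (ltn_ord i)).
have totE : (tot E W)%:R = \sum_(i < size W) (size (coefs E i))%:R :> R.
  rewrite /tot sumnE big_map -[X in iota _ X]subn0 -/(index_iota 0 (size W)) big_mkord.
  by rewrite natr_sum.
(* If [tot] vanishes, every coefficient is an empty sum; otherwise the inequality may be multiplied
   by [tot]. *)
have [tot0|tot0] := posnP (tot E W).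
  have size0 (i : 'I_(size W)) : (size (coefs E i))%:R = 0 :> R.
    move: totE; rewrite tot0 => /esym/eqP; rewrite psumr_eq0 ?ler0n //.
    by move=> /allP/(_ i); rewrite mem_index_enum => /(_ isT)/eqP.
  by rewrite big1 // => i _; rewrite size0 mul0r mulr0.
have t0 : 0 < (tot E W)%:R :> R by rewrite ltr0n.
rewrite -(ler_pM2l t0) mulr1 mulr_sumr [leRHS]totE; apply: ler_sum => i _.
rewrite [leLHS](_ : _ = (size (coefs E i))%:R * ((N * tot E W)%N%:R * cradius (nth 0%N W i))); last first.
  by rewrite natrM; ring.
by rewrite ler_piMr ?ler0n // cradius_le // smW // mem_nth.
Qed.

Lemma lincomb_approx1 N E W i : (forall c, c \in W -> inA c) -> small N E W -> (i < size W)%N ->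
  N%:R * nrm (zcoef (coefs E i) *: psi (node (nth 0 W i))%N - rv (act (coefs E i) (mid (nth 0 W i)%N)))
    <= 1.
Proof.
move=> WA /allP smW lt_i; rewrite rv_act -scalerBr.
have Wi := mem_nth 0%N lt_i; have [_ /ltW le_rad] := WA _ Wi.
apply: le_trans (_ : N%:R * ((size (coefs E i))%:R * cradius (nth 0%N W i)) <= _).
  rewrite ler_wpM2l ?ler0n //; apply: le_trans (nrm_zcoef _ _) _.
  by rewrite ler_wpM2l ?ler0n.
have le_tot : (size (coefs E i) <= tot E W)%N.
  rewrite /tot sumnE big_map (big_rem i) /= ?leq_addr // mem_iota add0n lt_i.
  by [].
rewrite mulrA -natrM; apply: cradius_le; apply: leq_trans (smW _ Wi).
by rewrite leq_mul2r leq_mul2l le_tot !orbT.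
Qed.

End Tree.
End Named.
End Diagram.

(** * Names of vector trees *)

Section TreeNames.
Context (R : realType) (K : numFieldType) (toR : K -> R) (ratsc : nat -> K).
Context (iota_sc : K) (rotsc : nat -> nat) (e0 : nat).
Hypothesis sc : scalar_spec toR ratsc iota_sc rotsc e0.
Context (V : completeNormedModType K) (P : nat -> V) (f : nat -> nat).
Hypotheses (presP : presentation P) (namesP : names_pres toR ratsc P f).
Local Notation nrm := (@nrm R K toR V).
Local Notation rv := (rv ratsc P).
Local Notation cradius := (@cradius R).
Local Notation diff_atom := (diff_atom rotsc e0).

Lemma nat_above (x : R) : exists N : nat, x < N%:R.
Proof. by exists (Num.truncn x).+1; exact: truncnS_gt. Qed.

Lemma rv_diff N c c' :
  nrm (rv (rep N (mid c ++ rot_vec rotsc e0 (mid c')))) = N%:R * nrm (rv (mid c) - rv (mid c')).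
Proof. by rewrite rv_rep rv_cat (rv_rot_e0 sc) (nrmMn sc). Qed.

Lemma leq_rad U N c : (U * rd c <= N * rn c)%N = (U%:R <= N%:R * cradius c).
Proof. by rewrite /cradius mulrA ler_pdivlMr ?ltr0n // -!natrM ler_nat. Qed.

Lemma inside_sound N U c c' : inside N U c c' -> (exists i, f i = diff_atom N U c c') ->
  nrm (rv (mid c) - rv (mid c')) + cradius c < cradius c'.
Proof.
move=> /andP[/(@cradius_le R _ _) h1]; rewrite leq_rad -natr1 -natr1 => h2.
move=> /(atomP namesP); rewrite rv_diff ltr_norml => /andP[_ h3].
have N0 : 0 < N%:R :> R.
  case: N h1 h2 h3 => [|N _ _ _]; last by rewrite ltr0n.
  by move=> _; rewrite mul0r; have := ler0n R U; lra.
by rewrite -(ltr_pM2l N0) mulrDr; lra.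
Qed.

(** U is at most N ‖v - centre of c‖ + 1, the 1 coming from the small ball d around v. For U + 2 to
    be at most N times the radius of c, N times the slack of v in c should be at least 3; the
    constant 4 provides this. *)
Lemma inside_complete v c : nrm (v - rv (mid c)) < cradius c -> exists N0 : nat, forall N d, (N0 <= N)%N ->
  nrm (v - rv (mid d)) < cradius d -> (N * rn d <= rd d)%N ->
  exists2 U, inside N U d c & exists i, f i = diff_atom N U d c.
Proof.
move=> vc; have [N0 lt_N0] := nat_above (4 / (cradius c - nrm (v - rv (mid c)))).
exists N0 => N d le_N vd le_d.
have [U Uf /andP[le_U _]] := atom_ex sc namesP (rep N (mid d ++ rot_vec rotsc e0 (mid c))).
exists U; last exact: Uf.
rewrite /inside le_d leq_rad -natr1 -natr1 /=.
have le_d' := @cradius_le R _ _ le_d; move: le_U; rewrite rv_diff.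
have := nrm_triangle sc v (rv (mid d)) (rv (mid c)); rewrite (nrm_distC toR (rv (mid d)) v).
set D := nrm (rv (mid d) - _); set D1 := nrm (v - rv (mid d)) in vd *; set D2 := nrm (v - _) in vc lt_N0 *.
move=> tri le_U; have N4 : 4 < N%:R * (cradius c - D2).
  rewrite -ltr_pdivrMr ?subr_gt0 //; apply: lt_le_trans lt_N0 _.
  by rewrite ler_nat.
have : N%:R * D <= N%:R * D1 + N%:R * D2 by rewrite -mulrDr ler_wpM2l ?ler0n.
have : N%:R * D1 <= N%:R * cradius d by rewrite ler_wpM2l ?ler0n // ltW.
by move: N4; rewrite mulrBr; lra.
Qed.

Definition base_conditions g h := [/\ forall_exists th_nil f g h, forall_exists th_cons f g h,
  forall_exists (th_refine rotsc e0) f g h & forall_exists (th_enlarge rotsc e0) f g h].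

Section NamesTree.
Variables (S : set (seq nat)) (psi : seq nat -> V) (g : nat -> nat).
Hypothesis named : names_tree toR ratsc P S psi g.

Lemma name_list W : (forall c, c \in W -> inA toR ratsc P S psi c) -> exists j, seq_decode (g j) = W.
Proof.
move: named => /names_treeE gE WA; have [j _ gj] : range g (seq_code W).
  by rewrite gE /= seq_codeK.
by exists j; rewrite gj seq_codeK.
Qed.

Lemma name_in j c : c \in seq_decode (g j) -> inA toR ratsc P S psi c.
Proof.
move: named => /names_treeE gE; have : range g (g j) by exists j.
by rewrite gE; apply.
Qed.

Lemma name_nth j i : (i < size (seq_decode (g j)))%N ->
  inA toR ratsc P S psi (nth 0 (seq_decode (g j)) i)%N.
Proof. by move=> lt_i; apply: (@name_in j); exact: mem_nth. Qed.

Lemma names_tree_base h : base_conditions g h.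
Proof.
split=> x.
- have [//|j gj] := @name_list [::].
  by exists [::], [::], j, 0%N; rewrite /th_nil gj.
- set g0 := g _; set g1 := g _.
  have [lt_i|le_i] := boolP (nth 0 x 4 < size (seq_decode g1))%N; last first.
    by exists [::], [::], 0%N, 0%N; rewrite /th_cons (negbTE le_i).
  have [|j gj] := @name_list (nth 0 (seq_decode g1) (nth 0 x 4) :: seq_decode g0)%N.
    move=> c; rewrite in_cons => /predU1P[->|]; last exact: name_in.
    exact: name_nth.
  by exists [::], [::], j, 0%N; rewrite /th_cons gj eqxx implybT.
- rewrite /th_refine; set g0 := g (nth 0 x 0)%N; set L := seq_decode g0.
  have [/andP[size_L /eqP nidE]|npre] := boolP ((2 <= size L)%N && _); last first.
    by exists [::], [::], 0%N, 0%N.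
  have [Sc lt_c] := @name_nth (nth 0 x 0)%N 0%N (ltnW size_L).
  have [Sc' lt_c'] := @name_nth (nth 0 x 0)%N 1%N size_L.
  rewrite /node -/g0 -/L -nidE in Sc' lt_c'; rewrite -/g0 -/L in Sc lt_c.
  have [N1 N1P] := inside_complete lt_c; have [N2 N2P] := inside_complete lt_c'.
  pose N := (nth 0 x 4 + N1 + N2)%N.
  have [d [[Sd lt_d] nidd le_d]] := ball_ex sc presP psi N Sc.
  rewrite /node nidd seq_codeK in lt_d.
  have [|U1 in1 [i1 f1]] := N1P N d _ lt_d le_d; first by rewrite /N; lia.
  have [|U2 in2 [i2 f2]] := N2P N d _ lt_d le_d; first by rewrite /N; lia.
  have [|j gj] := @name_list [:: d].
    by move=> c; rewrite inE => /eqP->; split; rewrite /node nidd seq_codeK.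
  exists [:: N; U1; U2], [:: f i1; f i2], j, 0%N; split; last first.
    by move=> v; rewrite !inE => /orP[]/eqP->; [exists i1 | exists i2].
  rewrite gj /= in1 in2 nidd /node seq_decodeK eqxx -f1 -f2 !inE !eqxx orbT /N.
  by rewrite -addnA leq_addr.
- rewrite /th_enlarge; set L := seq_decode _; set c := nth 0%N L 0; set c' := nth 0%N x 4.
  have [/and4P[size_L /eqP nidE in_c /eqP fE]|npre] := boolP [&& _, _, _ & _]; last first.
    by exists [::], [::], 0%N, 0%N.
  have [Sc lt_c] := @name_nth (nth 0 x 0)%N 0%N size_L; rewrite -/L -/c in Sc lt_c.
  have [|j gj] := @name_list [:: c']; last first.
    by exists [::], [::], j, 0%N; rewrite gj inE eqxx.
  move=> d; rewrite inE => /eqP->; rewrite /inA /node -nidE; split=> //.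
  have /(inside_sound in_c) lt_c' : exists i, f i = diff_atom (nth 0 x 5)%N (nth 0 x 6)%N c c'.
    by exists (nth 0 x 2)%N.
  apply: le_lt_trans (nrm_triangle sc (rv (mid c)) _ _) _.
  by apply: le_lt_trans lt_c'; rewrite addrC lerD2l ltW.
Qed.

End NamesTree.

Section Construct.
Variables (g h : nat -> nat).
Hypothesis base : base_conditions g h.

Definition in_name c := exists j, c \in seq_decode (g j).

Lemma in_name_list W : (forall c, c \in W -> in_name c) -> exists j, seq_decode (g j) = W.
Proof.
case: base => nilP consP _ _; elim: W => [|c W IHW] WA.
  by have [y [s [j [k [/eqP gj _]]]]] := nilP [::]; exists j.
have [|j gj] := IHW; first by move=> d Wd; apply: WA; rewrite in_cons Wd orbT.
have [j' cj'] := WA c (mem_head _ _).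
have [y [s [j'' [k [+ _]]]]] := consP [:: j; j'; 0; 0; index c (seq_decode (g j'))]%N.
by rewrite /th_cons /= index_mem cj' /= nth_index // gj => /eqP <-; exists j''.
Qed.

Lemma in_name_refine M c c' : in_name c -> in_name c' -> nid c = nid c' ->
  exists d, [/\ in_name d, nid d = nid c, M%:R * cradius d <= 1,
    nrm (rv (mid d) - rv (mid c)) + cradius d < cradius c &
    nrm (rv (mid d) - rv (mid c')) + cradius d < cradius c'].
Proof.
move=> cA cA' nidE; have [|j gj] := @in_name_list [:: c; c'].
  by move=> d; rewrite !inE => /orP[]/eqP->.
case: base => _ _ refP _; have [y [s [j' [k [+ sP]]]]] := refP [:: j; 0; 0; 0; M]%N.
rewrite /th_refine [nth 0%N [:: j; _; _; _; _] 0]/= gj [nth 0%N [:: j; _; _; _; _] 4]/=.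
rewrite [nth 0%N [:: _; _] 0]/= [nth 0%N [:: _; _] 1]/= nidE eqxx.
rewrite -[(2 <= _)%N && _]/true implyTb; set d := nth 0%N _ 0.
move=> /and5P[size_d /eqP nidd le_M in1 /and3P[in2 /sP s1 /sP s2]].
exists d; split=> //.
- by exists j'; exact: mem_nth.
- case/andP: in1 => /(@cradius_le R _ _) le1 _; apply: le_trans le1.
  by rewrite ler_wpM2r ?ler_nat // ltW // cradius_gt0.
- exact: inside_sound in1 s1.
- exact: inside_sound in2 s2.
Qed.

Lemma in_name_enlarge N U c c' : in_name c -> nid c = nid c' -> inside N U c c' ->
  (exists i, f i = diff_atom N U c c') -> in_name c'.
Proof.
move=> cA nidE in_c [i fi]; have [|j gj] := @in_name_list [:: c].
  by move=> d; rewrite inE => /eqP->.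
case: base => _ _ _ enlP; have [y [s [j' [k [+ sP]]]]] := enlP [:: j; 0; i; 0; c'; N; U]%N.
by rewrite /th_enlarge /= gj /= nidE eqxx in_c fi eqxx /= => ?; exists j'.
Qed.

(** Two balls listed for a node have a common refinement, so their centres are closer than the sum
    of the radii, and balls of radius at most 1 / (n + 1) have Cauchy centres. The limit is at first
    only in the closed balls; it is in the open ball c because it is in the closed ball of a
    refinement strictly inside c. *)
Lemma limit_vector c0 : in_name c0 -> exists v : V, forall c, in_name c -> nid c = nid c0 ->
  nrm (v - rv (mid c)) < cradius c.
Proof.
move=> c0A; have /boolp.choice[u uP] : forall n, exists d,
    [/\ in_name d, nid d = nid c0 & n.+1%:R * cradius d <= 1].
  move=> n; have [d [dA nidd le_d _ _]] := in_name_refine n.+1 c0A c0A erefl.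
  by exists d.
have dist c c' : in_name c -> in_name c' -> nid c = nid c' ->
    nrm (rv (mid c) - rv (mid c')) < cradius c + cradius c'.
  move=> cA cA' nidE; have [d [dA nidd _ lt1 lt2]] := in_name_refine 0 cA cA' nidE.
  apply: le_lt_trans (nrm_triangle sc (rv (mid d)) _ _) _; rewrite (nrm_distC toR).
  by have := @cradius_gt0 R d; lra.
have radu n : cradius (u n) <= n.+1%:R^-1.
  by have [_ _] := uP n; rewrite mulrC -ler_pdivlMr ?ltr0n // mul1r.
have small_inv (e : R) : 0 < e -> exists N, forall n, (N <= n)%N -> n.+1%:R^-1 < e.
  move=> e1; have [N lt_N] := nat_above e^-1; exists N => n le_n.
  rewrite invf_plt ?posrE ?ltr0n //; apply: lt_le_trans lt_N _.
  by rewrite ler_nat ltnW.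
have [v vP] : exists l, forall e : R, 0 < e -> exists N, forall n, (N <= n)%N ->
    nrm (rv (mid (u n)) - l) < e.
  apply: (cauchy_nrm sc) => e e1; have e2 : 0 < e / 2 by lra.
  have [N NP] := small_inv _ e2; exists N => n m le_n le_m.
  have [uA unid _] := uP n; have [uA' unid' _] := uP m.
  apply: lt_trans (dist _ _ uA uA' _) _; first by rewrite unid'.
  have := le_lt_trans (radu n) (NP _ le_n); have := le_lt_trans (radu m) (NP _ le_m).
  by lra.
have le_v c : in_name c -> nid c = nid c0 -> nrm (v - rv (mid c)) <= cradius c.
  move=> cA nidc; apply/ler_addgt0Pr => e e1; have e2 : 0 < e / 2 by lra.
  have [N1 N1P] := small_inv _ e2; have [N2 N2P] := vP _ e2.
  have := N2P (N1 + N2)%N (leq_addl _ _).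
  have := le_lt_trans (radu _) (N1P (N1 + N2)%N (leq_addr _ _)).
  set n := (N1 + N2)%N; have [uA unid _] := uP n.
  have := dist _ _ uA cA; rewrite unid nidc => /(_ erefl).
  have := nrm_triangle sc (rv (mid (u n))) v (rv (mid c)); rewrite (nrm_distC toR v (rv (mid (u n)))).
  by lra.
exists v => c cA nidc; have [d [dA nidd _ lt_d _]] := in_name_refine 0 cA cA erefl.
have := nrm_triangle sc (rv (mid d)) v (rv (mid c)).
have := le_v d dA; rewrite nidd nidc => /(_ erefl); lra.
Qed.

(** The nodes are those with a listed ball; outside of them [psi] is 0. That every ball c containing
    [psi nu] is listed comes from enlargement: a small enough listed ball at the node is certified
    to lie strictly inside c. *)
Lemma base_names_tree : exists S psi, names_tree toR ratsc P S psi g.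
Proof.
pose S nu := exists2 c, in_name c & nid c = seq_code nu.
have /boolp.choice[psi psiP] : forall nu, exists v : V, forall c, in_name c ->
    nid c = seq_code nu -> nrm (v - rv (mid c)) < cradius c.
  move=> nu.
  have [[c0 c0A nidc0]|nS] := pselect (S nu).
    by have [v vP] := limit_vector c0A; exists v => c cA; rewrite -nidc0; exact: vP.
  by exists 0 => c cA nidc; case: nS; exists c.
exists S, psi; apply/names_treeE.
have inP c : inA toR ratsc P S psi c <-> in_name c.
  split=> [[[c0 c0A nid0] lt_c]|cA]; last first.
    split; first by exists c => //; rewrite /node seq_decodeK.
    by apply: psiP => //; rewrite /node seq_decodeK.
  rewrite /node seq_decodeK in nid0.
  have [N0 N0P] := inside_complete lt_c.
  have [d [dA nidd le_d _ _]] := in_name_refine N0 c0A c0A erefl.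
  have [||U Uin Uf] := N0P N0 d (leqnn _).
  - by apply: psiP => //; rewrite nidd nid0 /node seq_decodeK.
  - move: le_d; rewrite /cradius mulrA ler_pdivrMr ?ltr0n // mul1r -natrM ler_nat.
    by [].
  by apply: in_name_enlarge Uin Uf => //; rewrite nidd nid0.
apply/seteqP; split=> k /=.
  by move=> [j _ <-] c cj; apply/inP; exists j.
move=> kA; have [|j gj] := @in_name_list (seq_decode k); first by move=> c /kA/inP.
by exists j => //; rewrite -[g j]seq_decodeK gj seq_decodeK.
Qed.

End Construct.
End TreeNames.

(** * Trees, injectivity and density *)

Section TreeConditions.
Context (R : realType) (K : numFieldType) (toR : K -> R) (ratsc : nat -> K).
Context (iota_sc : K) (rotsc : nat -> nat) (e0 : nat).
Hypothesis sc : scalar_spec toR ratsc iota_sc rotsc e0.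
Context (V : completeNormedModType K) (P : nat -> V) (f : nat -> nat).
Hypotheses (presP : presentation P) (namesP : names_pres toR ratsc P f).
Context (S : set (seq nat)) (psi : seq nat -> V) (g h : nat -> nat).
Hypothesis named : names_tree toR ratsc P S psi g.
Local Notation nrm := (@nrm R K toR V).
Local Notation rv := (rv ratsc P).
Local Notation inA := (inA toR ratsc P S psi).
Local Notation zc := (zcoef iota_sc).
Local Notation lc := (lincomb iota_sc psi).
Local Notation cen := (cen rotsc).

(** The error 2 is 1 for the rounding in the diagram and 1 for the passage to the centres. *)
Lemma approx_atom N E W U : (forall c, c \in W -> inA c) -> small N E W ->
  (exists i, f i = atom (rep N (cen E W)) U) -> `|N%:R * nrm (lc E (map node W)) - U%:R| < 2.
Proof.
move=> WA smW /(atomP namesP); rewrite rv_rep (nrmMn sc) => lt1.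
have le1 := lincomb_approx sc WA smW.
have le2 : `|N%:R * nrm (lc E (map node W)) - N%:R * nrm (rv (cen E W))| <= 1.
  rewrite -mulrBr normrM normr_nat; apply: le_trans le1.
  by rewrite ler_wpM2l ?ler0n // (nrm_dist sc).
move: lt1 le2; rewrite ltr_norml ler_norml => /andP[h1 h2] /andP[h3 h4].
by rewrite ltr_norml; apply/andP; split; lra.
Qed.

Lemma approx_ex N E nus : (forall nu, nu \in nus -> S nu) -> exists W j U,
  [/\ seq_decode (g j) = W, forall c, c \in W -> inA c, map nid W = map seq_code nus,
      small N E W & (exists i, f i = atom (rep N (cen E W)) U) /\
      `|N%:R * nrm (lc E nus) - U%:R| < 2].
Proof.
move=> nusS; have [W [WA nidW smW]] := balls_ex sc presP psi N E nusS.
have [j gj] := name_list named WA.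
have [U Uf _] := atom_ex sc namesP (rep N (cen E W)).
exists W, j, U; split=> //; split=> //.
by have := approx_atom WA smW Uf; rewrite (nid_nodes nidW).
Qed.

Lemma lincomb_nil E : lc E [::] = 0.
Proof. by rewrite /lincomb big_ord0. Qed.

Lemma lincomb_cons e E nu nus : lc (e :: E) (nu :: nus) = zc (seq_decode e) *: psi nu + lc E nus.
Proof. by rewrite /lincomb big_ord_recl. Qed.

Lemma zcoef_one : zc (seq_decode one_coef) = 1.
Proof. by rewrite /one_coef seq_codeK /zcoef big_seq1. Qed.

Lemma zcoef_opp : zc (seq_decode (opp_coef e0)) = -1.
Proof. by rewrite /opp_coef seq_codeK /zcoef big_seq1 (iotaX sc). Qed.

Lemma node_list nu nu' : S nu -> S nu' -> exists j, map nid (seq_decode (g j)) =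
  [:: seq_code nu; seq_code nu'].
Proof.
move=> Snu Snu'; have [|W [j [U [gj _ nidW _ _]]]] := @approx_ex 0 [::] [:: nu; nu'].
  by move=> mu; rewrite !inE => /orP[]/eqP->.
by exists j; rewrite gj nidW.
Qed.

Lemma tree_iff : is_tree S <-> forall_exists th_tree f g h.
Proof.
split=> [treeS x|thP nu mu Snu].
  rewrite /th_tree; set L := seq_decode (g (nth 0 x 0)%N).
  have [size_L|npre] := boolP (0 < size L)%N; last by exists [::], [::], 0%N, 0%N.
  have [Sc _] := name_nth named size_L.
  have [|c [cA nidc _]] := @ball_ex _ _ _ _ _ _ _ sc _ _ presP S psi
    (take (nth 0 x 4)%N (node (nth 0 L 0)%N)) 0.
    by apply: (treeS _ (drop (nth 0 x 4)%N (node (nth 0%N L 0)))); rewrite cat_take_drop.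
  have [|j gj] := @name_list _ _ _ _ _ _ _ _ _ named [:: c].
    by move=> d; rewrite inE => /eqP->.
  by exists [::], [::], j, 0%N; rewrite gj /= /node nidc seq_codeK.
have [j gj] := node_list Snu Snu.
have [y [s [j' [k [+ _]]]]] := thP [:: j; 0; 0; 0; size nu]%N.
rewrite /th_tree [nth 0%N [:: j; _; _; _; _] 0]/= -(size_map nid (seq_decode (g j))) gj.
rewrite [nth 0%N [:: j; _; _; _; _] 4]/= [node (nth _ (seq_decode (g j)) _)]/node.
rewrite -(nth_map _ 0%N) ?gj -?(size_map nid (seq_decode (g j))) ?gj // /= seq_codeK.
rewrite take_size_cat // => /andP[size_W /eqP <-].
by have [] := name_nth named size_W.
Qed.

Lemma inj_iff : (forall nu nu', S nu -> S nu' -> psi nu = psi nu' -> nu = nu') <->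
  forall_exists (th_inj rotsc e0) f g h.
Proof.
have valE nu nu' : lc [:: one_coef; opp_coef e0] [:: nu; nu'] = psi nu - psi nu'.
  by rewrite !lincomb_cons lincomb_nil zcoef_one zcoef_opp scale1r scaleN1r addr0.
split=> [psiI x|thP nu nu' Snu Snu' psiE].
  rewrite /th_inj; set L := seq_decode (g (nth 0 x 0)%N).
  have [/andP[size_L nidE]|npre] := boolP ((1 < size L)%N && _); last first.
    by exists [::], [::], 0%N, 0%N.
  have [Sc _] := name_nth named (ltnW size_L); have [Sc' _] := name_nth named size_L.
  rewrite -/L in Sc Sc'; set nu := node _ in Sc; set nu' := node _ in Sc'.
  have nz : 0 < nrm (psi nu - psi nu').
    rewrite lt_neqAle (nrm_ge0 sc) andbT; apply: contra nidE => /eqP/esym/(nrm_eq0 sc)/eqP.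
    rewrite subr_eq0 => /eqP/psiI => /(_ Sc Sc')/(congr1 seq_code).
    by rewrite /nu /nu' /node !seq_decodeK => ->.
  (* N times the norm exceeds 4 and its reading errs by less than 2, so the integer read passes the
     threshold 2. *)
  have [N lt_N] := nat_above (4 / nrm (psi nu - psi nu')).
  have [|W [j [U [gj _ nidW smW [[i fi] lt_U]]]]] :=
      @approx_ex N [:: one_coef; opp_coef e0] [:: nu; nu'].
    by move=> mu; rewrite !inE => /orP[]/eqP->.
  exists [:: N; U], [:: f i], j, 0%N; split; last by move=> v; rewrite inE => /eqP->; exists i.
  rewrite gj nidW /= smW fi mem_head !andbT /nu /nu' /node !seq_decodeK eqxx /=.
  move: lt_U; rewrite valE ltr_norml => /andP[_ h2].
  rewrite -(ler_nat R); rewrite ltr_pdivrMr // in lt_N; lra.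
have [j gj] := node_list Snu Snu'; apply/eqP; case: (eqVneq nu nu') => // neq.
have [y [s [j' [k [+ sP]]]]] := thP [:: j; 0; 0; 0]%N.
have size_g : size (seq_decode (g j)) = 2%N by rewrite -(size_map nid) gj.
have nth_g i : (i < 2)%N -> nid (nth 0 (seq_decode (g j)) i)%N = nth 0%N [:: seq_code nu; seq_code nu'] i.
  by move=> lt_i; rewrite -gj (nth_map 0%N) ?size_g.
rewrite /th_inj [nth 0%N [:: j; _; _; _] 0]/= size_g !nth_g //=.
rewrite (inj_eq (can_inj seq_codeK)) neq => /and4P[/eqP nidW smW le_U /sP Uf].
have := approx_atom (@name_in _ _ _ _ _ _ _ _ _ named j') smW Uf.
rewrite (@nid_nodes _ [:: nu; nu']) // valE psiE subrr (nrm0 sc) mulr0 sub0r normrN normr_nat.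
by rewrite ltr_nat ltnNge le_U.
Qed.

Lemma nonzero_iff : (forall nu, S nu -> psi nu <> 0) <->
  forall_exists (th_nonzero rotsc) f g h.
Proof.
have valE nu : lc [:: one_coef] [:: nu] = psi nu.
  by rewrite lincomb_cons lincomb_nil zcoef_one scale1r addr0.
split=> [psiN x|thP nu Snu psi0].
  rewrite /th_nonzero; set L := seq_decode (g (nth 0 x 0)%N).
  have [size_L|npre] := boolP (0 < size L)%N; last by exists [::], [::], 0%N, 0%N.
  have [Sc _] := name_nth named size_L; rewrite -/L in Sc; set nu := node _ in Sc.
  have nz : 0 < nrm (psi nu).
    rewrite lt_neqAle (nrm_ge0 sc) andbT; apply/eqP => /esym/(nrm_eq0 sc).
    exact: psiN.
  have [N lt_N] := nat_above (4 / nrm (psi nu)).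
  have [|W [j [U [gj _ nidW smW [[i fi] lt_U]]]]] := @approx_ex N [:: one_coef] [:: nu].
    by move=> mu; rewrite !inE => /eqP->.
  exists [:: N; U], [:: f i], j, 0%N; split; last by move=> v; rewrite inE => /eqP->; exists i.
  rewrite gj nidW /= smW fi mem_head !andbT /nu /node !seq_decodeK eqxx /=.
  move: lt_U; rewrite valE ltr_norml => /andP[_ h2].
  rewrite -(ler_nat R); rewrite ltr_pdivrMr // in lt_N; lra.
have [j gj] := node_list Snu Snu.
have [y [s [j' [k [+ sP]]]]] := thP [:: j; 0; 0; 0]%N.
have size_g : size (seq_decode (g j)) = 2%N by rewrite -(size_map nid) gj.
have nth_g : nid (nth 0 (seq_decode (g j)) 0)%N = seq_code nu.
  by rewrite -(nth_map 0%N 0%N) ?gj // size_g.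
rewrite /th_nonzero [nth 0%N [:: j; _; _; _] 0]/= size_g nth_g //= => /and4P[/eqP nidW smW le_U /sP Uf].
have := approx_atom (@name_in _ _ _ _ _ _ _ _ _ named j') smW Uf.
rewrite (@nid_nodes _ [:: nu]) // valE psi0 (nrm0 sc) mulr0 sub0r normrN normr_nat.
by rewrite ltr_nat ltnNge le_U.
Qed.

(** Each coefficient is multiplied by D and rounded to a sum of roots of unity with error at most 2.
    The total error does not depend on D, so it disappears after division by a large D. *)
Lemma lincomb_dense (D : K) (s : seq (K * V)) : (forall c, c \in s -> (psi @` S) c.2) ->
  exists E nus, (forall nu, nu \in nus -> S nu) /\
    nrm (D *: \sum_(c <- s) c.1 *: c.2 - lc E nus) <= 2 * \sum_(c <- s) nrm c.2.
Proof.
elim: s => [|[a v] s IHs] sP.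
  by exists [::], [::]; rewrite !big_nil lincomb_nil scaler0 subr0 (nrm0 sc) mulr0.
have [|E [nus [nusS le_s]]] := IHs; first by move=> c cs; apply: sP; rewrite in_cons cs orbT.
have [nu Snu psinu] := sP _ (mem_head _ _); rewrite /= in psinu.
have [l le_l] := iota_dense sc (D * a).
exists (seq_code l :: E), (nu :: nus); split.
  by move=> mu; rewrite in_cons => /predU1P[->//|]; exact: nusS.
rewrite !big_cons lincomb_cons seq_codeK scalerDr opprD addrACA scalerA psinu -scalerBl mulrDr /=.
apply: le_trans (nrmD sc _ _) _; apply: lerD => //.
by rewrite (nrmZ sc) ler_wpM2r // (nrm_ge0 sc).
Qed.

Lemma dense_iff : lin_dense (psi @` S) <-> forall_exists (th_dense rotsc) f g h.
Proof.
split=> [/(lin_denseP sc) dS x|thP].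
  rewrite /th_dense; set m := seq_decode (nth 0 x 4)%N; set M := nth 0%N x 5.
  have [|s sP lt_s] := dS (- (rv m *+ M)) (1 / 2); first by rewrite divr_gt0.
  (* With T the sum of the norms, the vector tested has norm at most D/2 + 2T + 1: approximation,
     rounding, centres. Adding the 2 asked for by the test stays below D once D >= 4T + 6. *)
  have [D lt_D] := nat_above (4 * \sum_(c <- s) nrm c.2 + 8).
  have [E [nus [nusS le_E]]] := lincomb_dense D%:R sP.
  have [W [WA nidW smW]] := balls_ex sc presP psi 1 E nusS.
  have [j gj] := name_list named WA.
  have [U [i fi] /andP[le_U _]] := atom_ex sc namesP (rep (M * D) m ++ cen E W).
  exists [:: seq_code E; D; U], [:: f i], j, 0%N.
  split; last by move=> v; rewrite inE => /eqP->; exists i.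
  rewrite gj /= !seq_codeK smW fi mem_head !andbT /= -(ler_nat R) -!natr1.
  have := lincomb_approx sc WA smW; rewrite (nid_nodes nidW) mul1r => le1.
  move: le_U; rewrite rv_cat rv_rep.
  set T := \sum_(c <- s) _ in lt_D le_E; set v := \sum_(c <- s) _ in lt_s le_E.
  have -> : rv m *+ (M * D) + rv (cen E W) =
      (D%:R *: (v - - (rv m *+ M)) - (D%:R *: v - lc E nus)) - (lc E nus - rv (cen E W)).
    rewrite opprK scalerDr !scaler_nat -mulrnA !opprB; set v' := v *+ D; set a := rv m *+ _.
    rewrite [v' + a]addrC -[a + v' + _]addrA [lc E nus - v']addrC addNKr -addrA.
    by rewrite [rv _ - lc E nus]addrC addNKr.
  have h1 := nrmB sc (D%:R *: (v - - (rv m *+ M)) - (D%:R *: v - lc E nus))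
    (lc E nus - rv (cen E W)).
  have h2 := nrmB sc (D%:R *: (v - - (rv m *+ M))) (D%:R *: v - lc E nus).
  have h3 : nrm (D%:R *: (v - - (rv m *+ M))) <= D%:R * (1 / 2).
    rewrite (nrmZ sc) normr_nat (toR_nat sc) ler_wpM2l ?ler0n //.
    by rewrite nrm_distC ltW.
  lra.
apply/(lin_denseP sc) => v e e1; have e2 : 0 < e / 2 by lra.
have [m lt_m] := rv_dense sc presP v e2.
have [M lt_M] := nat_above (e / 2)^-1.
have [y [s [j [k [+ sP]]]]] := thP [:: 0; 0; 0; 0; seq_code m; M]%N.
rewrite /th_dense [nth 0%N [:: _; _; _; _; _; _] 4]/= [nth 0%N [:: _; _; _; _; _; _] 5]/= seq_codeK.
set E := seq_decode _; set W := seq_decode _; set D := nth 0%N y 1; set U := nth 0%N y 2.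
move=> /and3P[smW le_D /sP/(atomP namesP)]; rewrite rv_cat rv_rep => Uf.
have le1 := lincomb_approx sc (@name_in _ _ _ _ _ _ _ _ _ named j) smW.
pose nus := map node W; rewrite -/nus mul1r in le1.
have M0 : 0 < M%:R :> R by apply: lt_trans lt_M; rewrite invr_gt0.
have D0 : 0 < D%:R :> R by rewrite ltr0n; apply: leq_trans le_D.
have MD0 : (M * D)%:R != 0 :> K.
  by rewrite pnatr_eq0 muln_eq0 negb_or -!lt0n -!(ltr0n R) M0 D0.
pose a i : K := - ((M * D)%:R^-1 * zc (coefs E i)).
exists [seq (a i, psi (nth [::] nus i)) | i <- iota 0 (size nus)].
  have: forall i, i \in iota 0 (size nus) -> S (nth [::] nus i).
    move=> i; rewrite mem_iota /= add0n size_map => lt_i; rewrite /nus (nth_map 0%N) //.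
    by have [] := name_nth named lt_i.
  elim: (iota _ _) => [|i r IHr] rS c; first by rewrite in_nil.
  rewrite in_cons => /predU1P[->|]; first by exists (nth [::] nus i) => //; apply: rS; exact: mem_head.
  by apply: IHr => k' k'r; apply: rS; rewrite in_cons k'r orbT.
rewrite big_map -[X in iota _ X]subn0 -/(index_iota 0 (size nus)) big_mkord /=.
have -> : \sum_(i < size nus) a i *: psi (nth [::] nus i) = - ((M * D)%:R^-1 *: lc E nus).
  rewrite /lincomb scaler_sumr -sumrN; apply: eq_bigr => i _.
  by rewrite /a scaleNr scalerA.
apply: le_lt_trans (nrm_triangle sc (rv m) _ _) _; rewrite [ltRHS](splitr e) ltrD //.
rewrite opprK.
have lt2 : nrm (rv m *+ (M * D) + lc E nus) < D%:R.
  have h1 := nrmD sc (rv m *+ (M * D) + rv (cen E W)) (lc E nus - rv (cen E W)).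
  rewrite -addrA [rv (cen E W) + _]addrC subrK in h1.
  move: Uf; rewrite ltr_norml => /andP[_ h2].
  by move: le_D; rewrite -(ler_nat R) -!natr1 => h3; lra.
have -> : rv m + (M * D)%:R^-1 *: lc E nus = (M * D)%:R^-1 *: (rv m *+ (M * D) + lc E nus).
  by rewrite scalerDr -(scaler_nat _ (rv m)) scalerA mulVf // scale1r.
rewrite -(ltr_pM2l M0) -(ltr_pM2l D0).
have -> : D%:R * (M%:R * nrm ((M * D)%:R^-1 *: (rv m *+ (M * D) + lc E nus))) =
    nrm (rv m *+ (M * D) + lc E nus).
  by rewrite mulrA -natrM mulnC -(nrmMn sc) -(scaler_nat _ (_ *: _)) scalerA mulfV // scale1r.
apply: lt_trans lt2 _; rewrite -[ltLHS]mulr1 ltr_pM2l //.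
by rewrite -ltr_pdivrMr // mul1r.
Qed.

End TreeConditions.

(** * Limits of powers *)

Section Powers.
Context (R : realType).

(** For x > 0 this is continuity of exp and ln. At x = 0 the bases are eventually below 1 and the
    exponents above p/2, so u^q <= u^(p/2), which is at most e once u < e^(2/p). *)
Lemma cvg_powR (u q : nat -> R) (x p : R) : (forall n, 0 <= u n) -> 0 < p ->
  u @ \oo --> x -> q @ \oo --> p -> (u n `^ q n) @[n --> \oo] --> x `^ p.
Proof.
move=> u0 p0 ux qp; have x0 : 0 <= x.
  by rewrite -(cvg_lim _ ux) //; apply: limr_ge; [exact: (cvgP _ ux) | exact: nearW].
have [xE|xN] := eqVneq x 0; last first.
  have xp : 0 < x by rewrite lt_neqAle eq_sym xN.
  have cE : (expR (q n * ln (u n))) @[n --> \oo] --> expR (p * ln x).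
    apply: continuous_cvg; first exact: continuous_expR.
    by apply: cvgM => //; apply: continuous_cvg => //; exact: continuous_ln.
  rewrite /powR (negbTE xN); apply: cvg_trans cE; apply: near_eq_cvg.
  have near0 := cvgr_gt x ux _ xp; near=> n; have un : 0 < u n by near: n; exact: near0.
  by rewrite (negbTE (lt0r_neq0 un)).
rewrite xE powR0 ?lt0r_neq0 //; apply/cvgrPdist_le => e e0.
have p2 : 0 < p / 2 by lra.
have d0 : 0 < e `^ (p / 2)^-1 by rewrite powR_gt0.
have near1 : \forall n \near \oo, u n < 1 by apply: (cvgr_lt x ux); rewrite xE.
have near2 : \forall n \near \oo, u n < e `^ (p / 2)^-1 by apply: (cvgr_lt x ux); rewrite xE.
have near3 : \forall n \near \oo, p / 2 < q n by apply: (cvgr_gt p qp); lra.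
near=> n; rewrite sub0r normrN ger0_norm ?powR_ge0 //.
have un1 : u n < 1 by near: n; exact: near1.
have un2 : u n < e `^ (p / 2)^-1 by near: n; exact: near2.
have qn : p / 2 < q n by near: n; exact: near3.
have [->|uN] := eqVneq (u n) 0; first by rewrite powR0 ?ltW // lt0r_neq0 // (lt_trans p2).
have up : 0 < u n <= 1 by rewrite lt_neqAle eq_sym uN u0 ltW.
apply: le_trans (ger_powR up (ltW qn)) _.
apply: le_trans (ge0_ler_powR (ltW p2) _ _ (ltW un2)) _; rewrite ?nnegrE ?powR_ge0 //.
by rewrite -powRrM mulVf ?lt0r_neq0 // powRr1 // ltW.
Unshelve. all: by end_near. Qed.

Lemma cvg_sum_ord (m : nat) (F : nat -> nat -> R) (l : nat -> R) :
  (forall i, (i < m)%N -> F i n @[n --> \oo] --> l i) ->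
  \sum_(i < m) F i n @[n --> \oo] --> \sum_(i < m) l i.
Proof.
elim: m => [|m IHm] Fl.
  by rewrite big_ord0; under eq_fun do rewrite big_ord0; exact: cvg_cst.
rewrite big_ord_recr; under eq_fun do rewrite big_ord_recr.
by apply: cvgD; [apply: IHm => i lt_i; apply: Fl; exact: ltnW | exact: Fl].
Qed.

Lemma cvg_dist_eventually (A B C : nat -> R) (x e : R) :
  A @ \oo --> x -> B @ \oo --> x -> C @ \oo --> (1 : R) -> 0 < e ->
  exists n, 1 / 2 < C n /\ `|A n - B n| < e.
Proof.
move=> /cvgrPdist_lt Ax /cvgrPdist_lt Bx /cvgrPdist_lt Cx e0.
have e2 : 0 < e / 2 by lra.
have [n1 _ n1P] := Ax _ e2; have [n2 _ n2P] := Bx _ e2.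
have [|n3 _ n3P] := Cx (1 / 2); first by lra.
pose n := (n1 + n2 + n3)%N; exists n.
have := n1P n; have := n2P n; have := n3P n; rewrite /n /= -/n.
move=> /(_ (leq_addl _ _)) + /(_ (leq_trans (leq_addl _ _) (leq_addr _ _))).
move=> + + /(_ (leq_trans (leq_addr _ _) (leq_addr _ _))).
rewrite !ltr_norml => /andP[h1 h2] /andP[h3 h4] /andP[h5 h6].
by split; [|apply/andP; split]; lra.
Qed.

Lemma cvg_eq_of_dist (A B C : nat -> R) (x y : R) :
  A @ \oo --> x -> B @ \oo --> y -> C @ \oo --> (1 : R) ->
  (forall n, n.+1%:R * `|A n - B n| <= C n) -> x = y.
Proof.
move=> /cvgrPdist_lt Ax /cvgrPdist_lt By /cvgrPdist_lt Cx le_n.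
apply/eqP; rewrite -subr_eq0 -normr_le0; apply/ler_addgt0Pr => e e0; rewrite add0r.
have e2 : 0 < e / 4 by lra.
have [n1 _ n1P] := Ax _ e2; have [n2 _ n2P] := By _ e2.
have [n3 _ n3P] := Cx 1 ltr01.
(* Eventually [C n < 2]; together with n + 1 > 8 / e this bounds |A n - B n| by e/4, one of three
   errors of that size. *)
pose n4 := Num.truncn (8 / e); pose n := (n1 + n2 + (n3 + n4))%N.
have := n1P n; have := n2P n; have := n3P n; rewrite /n /= -/n.
move=> /(_ (leq_trans (leq_addr _ _) (leq_addl _ _))).
move=> + /(_ (leq_trans (leq_addl _ _) (leq_addr _ _))).
move=> + + /(_ (leq_trans (leq_addr _ _) (leq_addr _ _))) => h1 h2 h3.
have lt_n : 8 / e < n.+1%:R.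
  apply: lt_le_trans (truncnS_gt _) _; rewrite ler_nat ltnS /n -/n4.
  by rewrite addnA leq_addl.
have h4 : `|A n - B n| < e / 4.
  have n0 : 0 < n.+1%:R :> R by rewrite ltr0n.
  rewrite -(ltr_pM2l n0); apply: le_lt_trans (le_n n) _.
  move: lt_n; rewrite ltr_pdivrMr // => lt_n.
  by move: h1; rewrite ltr_norml => /andP[]; lra.
have -> : x - y = (x - A n) + (A n - B n) - (y - B n) by ring.
apply: le_trans (ler_normB _ _) _; have := ler_normD (x - A n) (A n - B n).
lra.
Qed.

Lemma sumn_lt t n : sumn [seq (z < t)%N : nat | z <- iota 0 n] = minn t n.
Proof.
elim: n => [|n IHn]; first by rewrite minn0.
by rewrite -addn1 iotaD map_cat sumn_cat IHn /= add0n; lia.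
Qed.

(** With y = U^(a/b), z^b <= U^a means z <= y. Counting only below U^a loses nothing, since the
    integer part t of y satisfies t <= t^b <= U^a. *)
Lemma rpowE U a b : (0 < b)%N -> rpow U a b = Num.truncn (U%:R `^ (a%:R / b%:R) : R).
Proof.
move=> b0; set y := _ `^ _; have y0 : 0 <= y by exact: powR_ge0.
have yb : y ^+ b = (U ^ a)%:R.
  rewrite -powR_mulrn // /y -powRrM -mulrA mulVf ?pnatr_eq0 -?lt0n // mulr1.
  by rewrite powR_mulrn ?ler0n // natrX.
have leE z : (z ^ b <= U ^ a)%N = (z <= Num.truncn y)%N.
  rewrite truncn_ge_nat // -(ler_nat R) natrX -yb.
  by rewrite (ler_pXn2r b0) ?nnegrE ?ler0n.
have le_t : (Num.truncn y <= U ^ a)%N.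
  have := leqnn (Num.truncn y); rewrite -leE; apply: leq_trans.
  by case: (Num.truncn y) => // t; case: b b0 {yb leE y y0} => // b _; rewrite expnS leq_pmulr ?expn_gt0.
rewrite /rpow; under eq_map do rewrite leE.
move: le_t; move: (Num.truncn y) (U ^ a)%N => t n le_t.
by rewrite sumn_lt; apply/minn_idPl.
Qed.

Lemma rpow_itv U a b : (0 < b)%N ->
  (rpow U a b)%:R <= (U%:R `^ (a%:R / b%:R) : R) < (rpow U a b)%:R + 1.
Proof. by move=> b0; rewrite rpowE // natr1 truncn_itv // powR_ge0. Qed.

(** u / N tends to x because N exceeds n, so (u / N)^q tends to x^p; the integer part subtracts less
    than N^(-q), which tends to 0. A squeeze concludes. *)
Lemma rpow_cvg (N u a b : nat -> nat) (x p : R) : (forall n, n < N n)%N -> (forall n, 0 < b n)%N ->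
  0 <= x -> 0 < p -> (a n)%:R / (b n)%:R @[n --> \oo] --> p ->
  (forall n, `|(N n)%:R * x - (u n)%:R| < 2) ->
  (rpow (u n) (a n) (b n))%:R / (N n)%:R `^ ((a n)%:R / (b n)%:R) @[n --> \oo] --> x `^ p.
Proof.
move=> ltN b0 x0 p0 qp ux; pose q n : R := (a n)%:R / (b n)%:R.
have N0 n : 0 < (N n)%:R :> R by rewrite ltr0n; apply: leq_ltn_trans (ltN n).
have cN : (N n)%:R^-1 @[n --> \oo] --> (0 : R).
  apply: (@squeeze_cvgr _ _ _ R (fun=> 0) (@harmonic R));
    [|exact: cvg_cst | exact: cvg_harmonic].
  apply: nearW => n; rewrite /= invr_ge0 ltW //= lef_pV2 ?posrE ?ltr0n //.
    by rewrite ler_nat.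
  by rewrite -(ltr0n R).
have cu : (u n)%:R / (N n)%:R @[n --> \oo] --> x.
  apply/cvgrPdist_lt => e e0; have e2 : 0 < e / 2 by lra.
  have near0 := cvgr_lt 0 cN _ e2; near=> n; have lt_n : (N n)%:R^-1 < e / 2 by near: n; exact: near0.
  rewrite -(ltr_pM2l (N0 n)) -{1}[(N n)%:R]ger0_norm ?ltW // -normrM mulrBr.
  rewrite mulrCA mulfV ?mulr1 ?lt0r_neq0 //; apply: lt_trans (ux n) _.
  move: lt_n; rewrite -(ltr_pM2l (N0 n)) mulfV ?lt0r_neq0 //; lra.
have cup := cvg_powR (fun n => divr_ge0 (ler0n _ (u n)) (ltW (N0 n))) p0 cu qp.
have cNp : ((N n)%:R^-1 `^ q n) @[n --> \oo] --> (0 : R).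
  have := @cvg_powR (fun n => (N n)%:R^-1) q 0 p _ p0 cN qp.
  rewrite powR0 ?lt0r_neq0 //; apply => n.
  by rewrite invr_ge0 ltW.
have divE n : ((u n)%:R / (N n)%:R) `^ q n = (u n)%:R `^ q n / (N n)%:R `^ q n.
  by rewrite powRM ?invr_ge0 ?ler0n // -[(N n)%:R^-1]powR_inv1 ?ler0n // -powRrM mulN1r powRN.
have invE n : (N n)%:R^-1 `^ q n = ((N n)%:R `^ q n)^-1.
  by rewrite -[(N n)%:R^-1]powR_inv1 ?ler0n // -powRrM mulN1r powRN.
apply: (@squeeze_cvgr _ _ _ R (fun n => ((u n)%:R / (N n)%:R) `^ q n - (N n)%:R^-1 `^ q n)
  (fun n => ((u n)%:R / (N n)%:R) `^ q n)); [| |exact: cup]; last first.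
  by rewrite -[x `^ p]subr0; apply: cvgB.
apply: nearW => n; have /andP[h1 h2] := rpow_itv (u n) (a n) (b0 n).
have NqN : 0 < ((N n)%:R `^ q n)^-1 by rewrite invr_gt0 powR_gt0.
rewrite divE invE -{2}[_^-1]mul1r -mulrBl !ler_pM2r //.
by apply/andP; split; rewrite ?lerBlDr // ltW.
Unshelve. all: by end_near. Qed.

End Powers.

(** * Formal disjointness of supports *)

Section Separation.
Context (R : realType) (K : numFieldType) (toR : K -> R) (ratsc : nat -> K).
Context (iota_sc : K) (rotsc : nat -> nat) (e0 : nat).
Hypothesis sc : scalar_spec toR ratsc iota_sc rotsc e0.
Context (V : completeNormedModType K) (P : nat -> V) (f : nat -> nat).
Hypotheses (presP : presentation P) (namesP : names_pres toR ratsc P f).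
Context (S : set (seq nat)) (psi : seq nat -> V) (g h : nat -> nat).
Hypothesis named : names_tree toR ratsc P S psi g.
Context (p : R).
Hypotheses (realP : names_real h p) (p1 : 1 <= p).
Local Notation nrm := (@nrm R K toR V).
Local Notation rv := (rv ratsc P).
Local Notation inA := (inA toR ratsc P S psi).
Local Notation zc := (zcoef iota_sc).
Local Notation lc := (lincomb iota_sc psi).
Local Notation cen := (cen rotsc).
Local Notation act := (act rotsc).

Let p0 : 0 < p. Proof. exact: lt_le_trans p1. Qed.

(** As p >= 1 and the error is below 2^(-k) <= 1, the approximation is positive and its numerator
    and denominator can be read off the code. *)
Lemma exponentP k : (0 < k)%N -> (0 < denc (h k))%N /\
  ratr (rat_of_nat (h k)) = (numc (h k))%:R / (denc (h k))%:R :> R.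
Proof.
move=> k0; have q0 : (0 < rat_of_nat (h k)).
  rewrite -(ltr0q R); have := realP k.
  have : (2 ^+ k)^-1 <= 1 :> R by rewrite invf_le1 ?exprn_ege1 ?exprn_gt0 //; lra.
  move: (2 ^+ k)^-1 => i i1; rewrite ltr_norml => /andP[+ _].
  by move: p1; lra.
have [d0 ->] := rat_of_nat_gt0 q0; split=> //.
by rewrite fmorph_div !rmorph_nat.
Qed.

Lemma exponent_cvg (k : nat -> nat) : (forall n, n < k n)%N ->
  (numc (h (k n)))%:R / (denc (h (k n)))%:R @[n --> \oo] --> p.
Proof.
move=> ltk; apply/cvgrPdist_lt => e e1.
have near0 := cvgr_lt 0 (@cvg_harmonic R) _ e1.
near=> n; have lt_n : n.+1%:R^-1 < e by near: n; exact: near0.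
have [_ <-] := exponentP (leq_ltn_trans (leq0n n) (ltk n)).
rewrite distrC; apply: lt_trans (realP (k n)) _; apply: le_lt_trans lt_n.
rewrite lef_pV2 ?posrE ?exprn_gt0 ?ltr0n // -natrX ler_nat.
by apply: leq_trans (ltk n) _; rewrite ltnW // ltn_expl.
Unshelve. all: by end_near. Qed.

Definition component E (nus : seq (seq nat)) i : R := nrm (zc (coefs E i) *: psi (nth [::] nus i)).

(** Common to both directions of [sep_iff]: the sequences are chosen freely in one and supplied by
    the witnesses of the test in the other. *)
Lemma sep_limits nus E (N k U : nat -> nat) (W Us : nat -> seq nat) :
  (forall n, n < N n)%N -> (forall n, n < k n)%N ->
  (forall n c, c \in W n -> inA c) -> (forall n, map node (W n) = nus) ->
  (forall n, small (N n) E (W n)) ->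
  (forall n, exists i, f i = atom (rep (N n) (cen E (W n))) (U n)) ->
  (forall n j, (j < size (W n))%N -> exists i,
     f i = atom (rep (N n) (act (coefs E j) (mid (nth 0 (W n) j)%N))) (nth 0 (Us n) j)%N) ->
  let a n := numc (h (k n)) in let b n := denc (h (k n)) in
  let d n : R := (N n)%:R `^ ((a n)%:R / (b n)%:R) in
  [/\ (rpow (U n) (a n) (b n))%:R / d n @[n --> \oo] --> nrm (lc E nus) `^ p,
      \sum_(i < size nus) (rpow (nth 0 (Us n) i)%N (a n) (b n))%:R / d n @[n --> \oo]
        --> \sum_(i < size nus) component E nus i `^ p &
      (rpow (N n) (a n) (b n))%:R / d n @[n --> \oo] --> (1 : R)].
Proof.
move=> ltN ltk WA nodeW smW Uf Usf a b d.
have qp := exponent_cvg ltk.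
have b0 n : (0 < b n)%N by have [] := exponentP (leq_ltn_trans (leq0n n) (ltk n)).
split.
- apply: rpow_cvg => //; first exact: (nrm_ge0 sc).
  move=> n; rewrite -(nodeW n); exact: (approx_atom sc namesP (WA n) (smW n) (Uf n)).
- apply: (@cvg_sum_ord R (size nus) (fun i n => (rpow (nth 0 (Us n) i)%N (a n) (b n))%:R / d n)
    (fun i => component E nus i `^ p)) => i lt_i.
  apply: (@rpow_cvg R N (fun n => nth 0 (Us n) i)%N) => //; first exact: (nrm_ge0 sc).
  move=> n; have lt_iW : (i < size (W n))%N by rewrite -(size_map node) nodeW.
  have /(atomP namesP) := Usf n i lt_iW; rewrite rv_rep (nrmMn sc) => lt1.
  have le1 := lincomb_approx1 sc (WA n) (smW n) lt_iW.
  rewrite /component -(nodeW n) (nth_map 0%N) //.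
  set v := _ *: psi _ in le1 *; set w := rv _ in lt1 le1.
  have le2 : `|(N n)%:R * nrm v - (N n)%:R * nrm w| <= 1.
    rewrite -mulrBr normrM normr_nat; apply: le_trans le1.
    by rewrite ler_wpM2l ?ler0n // (nrm_dist sc).
  move: lt1 le2; rewrite ltr_norml ler_norml => /andP[h1 h2] /andP[h3 h4].
  by rewrite ltr_norml; apply/andP; split; lra.
- have := @rpow_cvg R N N a b 1 p ltN b0 ler01 p0 qp; rewrite powR1; apply=> n.
  by rewrite mulr1 subrr normr0.
Qed.

Lemma absdiffE x y : (absdiff x y)%:R = `|x%:R - y%:R| :> R.
Proof.
rewrite /absdiff; case: (leqP x y) => [le_xy|/ltnW le_yx].
  by rewrite (eqP le_xy) add0n distrC natrB // ger0_norm // subr_ge0 ler_nat.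
by rewrite [(y - x)%N](eqP le_yx) addn0 natrB // ger0_norm // subr_ge0 ler_nat.
Qed.

Lemma sumn_ord (F : nat -> nat) n : sumn [seq F i | i <- iota 0 n] = (\sum_(i < n) F i)%N.
Proof. by rewrite sumnE big_map -[X in iota _ X]subn0 -/(index_iota 0 n) big_mkord. Qed.

(** By homogeneity the identity may be scaled: (n + 1) times each scalar is rounded to a sum of
    roots of unity with error at most 2, and division by n + 1 gives the identity for the original
    scalars in the limit. *)
Lemma separatingP : Lp_separating toR p S psi <->
  forall nus, (forall nu, nu \in nus -> S nu) -> pairwise incomparable nus ->
  forall E, nrm (lc E nus) `^ p = \sum_(i < size nus) component E nus i `^ p.
Proof.
split=> [sepS nus nusS inc E|sepP nus nusS inc al].
  have := sepS nus nusS inc (fun i => zc (coefs E i)); rewrite size_map => sepE.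
  rewrite /lincomb; under eq_bigr => i _ do rewrite -(nth_map _ 0) //.
  rewrite sepE; apply: eq_bigr => i _.
  by rewrite /component (nrmZ sc) powRM ?(toR_ge0 sc) ?(nrm_ge0 sc) // (nth_map [::]).
rewrite size_map; have /boolp.choice[l lP] : forall n, exists l : nat -> seq nat, forall i,
    toR `|n.+1%:R * al i - zc (l i)| <= 2.
  move=> n; have /boolp.choice[l lP] : forall i, exists s, toR `|n.+1%:R * al i - zc s| <= 2.
    by move=> i; exact: (iota_dense sc).
  by exists l.
pose E n := [seq seq_code (l n i) | i <- iota 0 (size nus)].
have coefsE n i : (i < size nus)%N -> coefs (E n) i = l n i.
  move=> lt_i; rewrite /coefs (nth_map 0%N) ?size_iota // nth_iota // add0n.
  exact: seq_codeK.
(* Vectors at bounded distance from (n + 1) w have norms which, divided by n + 1, tend to the norm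
   of w. *)
have cvg_scale (v : nat -> V) (w : V) (C : R) : 0 <= C ->
    (forall n, nrm (n.+1%:R *: w - v n) <= C) ->
    (nrm (v n) / n.+1%:R) `^ p @[n --> \oo] --> nrm w `^ p.
  move=> C0 vw; apply: cvg_powR => //; last exact: cvg_cst.
    by move=> n; rewrite divr_ge0 ?ler0n // (nrm_ge0 sc).
  apply/cvgrPdist_lt => e e1; have eC : 0 < e / (C + 1) by rewrite divr_gt0 //; lra.
  have near0 := cvgr_lt 0 (@cvg_harmonic R) _ eC.
  near=> n; have lt_n : n.+1%:R^-1 < e / (C + 1) by near: n; exact: near0.
  have n0 : 0 < n.+1%:R :> R by rewrite ltr0n.
  rewrite -(ltr_pM2l n0) -{1}[n.+1%:R]ger0_norm ?ltW // -normrM mulrBr.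
  rewrite mulrCA mulfV ?mulr1 ?lt0r_neq0 //.
  have -> : n.+1%:R * nrm w = nrm (n.+1%:R *: w) by rewrite (nrmZ sc) normr_nat (toR_nat sc).
  apply: le_lt_trans (nrm_dist sc _ _) _; apply: le_lt_trans (vw n) _.
  move: lt_n; rewrite ltr_pdivlMr; last lra.
  by rewrite mulrC ltr_pdivrMr // mulrC; lra.
have c1 : (nrm (lc (E n) nus) / n.+1%:R) `^ p @[n --> \oo] -->
    nrm (\sum_(j < size nus) al j *: (map psi nus)`_j) `^ p.
  apply: (@cvg_scale _ _ (\sum_(i < size nus) 2 * nrm (psi (nth [::] nus i)))).
    by apply: sumr_ge0 => i _; rewrite mulr_ge0 // (nrm_ge0 sc).
  move=> n; rewrite /lincomb scaler_sumr -sumrB; apply: le_trans (nrm_sum sc _ _ _) _.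
  apply: ler_sum => i _; rewrite (nth_map [::]) // coefsE // scalerA -scalerBl (nrmZ sc).
  by rewrite ler_wpM2r ?(nrm_ge0 sc).
have c2 : \sum_(i < size nus) (component (E n) nus i / n.+1%:R) `^ p @[n --> \oo] -->
    \sum_(i < size nus) nrm (al i *: psi (nth [::] nus i)) `^ p.
  apply: (@cvg_sum_ord R (size nus) (fun i n => (component (E n) nus i / n.+1%:R) `^ p)
    (fun i => nrm (al i *: psi (nth [::] nus i)) `^ p)) => i lt_i.
  apply: (@cvg_scale _ _ (2 * nrm (psi (nth [::] nus i)))).
    by rewrite mulr_ge0 // (nrm_ge0 sc).
  move=> n; rewrite coefsE // scalerA -scalerBl (nrmZ sc).
  by rewrite ler_wpM2r ?(nrm_ge0 sc).
have eq12 : (fun n => (nrm (lc (E n) nus) / n.+1%:R) `^ p) =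
    (fun n => \sum_(i < size nus) (component (E n) nus i / n.+1%:R) `^ p).
  apply/funext => n; rewrite powRM ?(nrm_ge0 sc) ?invr_ge0 ?ler0n //.
  rewrite sepP // mulr_suml; apply: eq_bigr => i _.
  by rewrite powRM ?(nrm_ge0 sc) ?invr_ge0 ?ler0n.
rewrite eq12 in c1; rewrite (cvg_unique _ c1 c2) //; apply: eq_bigr => i _.
by rewrite (nrmZ sc) powRM ?(toR_ge0 sc) ?(nrm_ge0 sc) // (nth_map [::]).
Unshelve. all: by end_near. Qed.

Lemma sep_iff : Lp_separating toR p S psi <-> forall_exists (th_sep rotsc) f g h.
Proof.
rewrite separatingP; split=> [sepP x|thP nus nusS inc E].
  rewrite /th_sep; set L := seq_decode (g (nth 0 x 0)%N); set E := seq_decode (nth 0 x 4)%N.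
  set M := nth 0%N x 5; pose nus := map node L.
  have [inc|npre] := boolP (pairwise incomparable nus); last first.
    by exists [::], [::], 0%N, 0%N.
  have nusS nu : nu \in nus -> S nu.
    by move=> /mapP[c cL ->]; have [] := name_in named cL.
  (* Used both as scale and as index of the approximation to p; it exceeds M, as the test demands,
     and n, as the limits do. *)
  pose N n := (M + n).+1.
  have /boolp.choice[t tP] : forall n, exists t : seq nat * nat * seq nat,
    [/\ forall c, c \in t.1.1 -> inA c, map nid t.1.1 = map seq_code nus, small (N n) E t.1.1,
        exists i, f i = atom (rep (N n) (cen E t.1.1)) t.1.2 &
        forall j, (j < size t.1.1)%N -> exists i, f i =
          atom (rep (N n) (act (coefs E j) (mid (nth 0 t.1.1 j)%N))) (nth 0 t.2 j)%N].
    move=> n; have [W [WA nidW smW]] := balls_ex sc presP psi (N n) E nusS.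
    have [U Uf _] := atom_ex sc namesP (rep (N n) (cen E W)).
    have /boolp.choice[u uP] : forall j, exists u, exists i, f i =
        atom (rep (N n) (act (coefs E j) (mid (nth 0 W j)%N))) u.
      move=> j; have [u uf _] := atom_ex sc namesP
        (rep (N n) (act (coefs E j) (mid (nth 0 W j)%N))).
      by exists u.
    exists (W, U, mkseq u (size W)); split=> // j lt_j /=.
    by rewrite nth_mkseq.
  have nodeW n : map node (t n).1.1 = nus by have [_ /nid_nodes] := tP n.
  have [||||||| c1 c2 c3] := @sep_limits nus E N N (fun n => (t n).1.2) (fun n => (t n).1.1)
    (fun n => (t n).2).
  - by move=> n; rewrite /N ltnS leq_addl.
  - by move=> n; rewrite /N ltnS leq_addl.
  - by move=> n; have [] := tP n.
  - by [].
  - by move=> n; have [] := tP n.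
  - by move=> n; have [] := tP n.
  - by move=> n; have [] := tP n.
  rewrite -sepP // in c2.
  (* This tolerance makes (M + 1) times the difference less than 1/2, hence less than the normalized
     value of [N^q], which tends to 1. Using M + 1 covers M = 0. *)
  have M0 : 0 < M.+1%:R^-1 / 2 :> R by rewrite divr_gt0 // invr_gt0 ltr0n.
  have [n [n1 n2]] := cvg_dist_eventually c1 c2 c3 M0.
  have [WA nidW smW [i fi] Usf] := tP n.
  have [j gj] := name_list named WA.
  have /boolp.choice[iu iuP] : forall j, exists i, (j < size (t n).1.1)%N -> f i =
      atom (rep (N n) (act (coefs E j) (mid (nth 0 (t n).1.1 j)%N))) (nth 0 (t n).2 j)%N.
    move=> j'; have [/Usf[i' fi']|] := boolP (j' < size (t n).1.1)%N; first by exists i'.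
    by exists 0%N.
  exists [:: N n; (t n).1.2; seq_code (t n).2],
    (f i :: [seq f (iu j) | j <- iota 0 (size (t n).1.1)]), j, (N n).
  split; last first.
    move=> v; rewrite in_cons => /predU1P[->|/mapP[j' _ ->]]; first by exists i.
    by exists (iu j').
  rewrite gj /= smW fi mem_head nidW /= seq_codeK.
  have -> : [seq seq_code i | i <- nus] == [seq nid i | i <- L].
    by rewrite /nus -map_comp; apply/eqP/eq_map => c /=; rewrite /node seq_decodeK.
  have -> : (M <= N n)%N by rewrite /N leqW // leq_addr.
  have -> : (M < N n)%N by rewrite /N ltnS leq_addr.
  rewrite !andTb; apply/andP; split.
    apply/allP => j' j'i; rewrite in_cons; apply/orP; right; apply/mapP; exists j' => //.
    by rewrite iuP //; move: j'i; rewrite mem_iota.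
  rewrite sumn_ord -(ler_nat R) natrM absdiffE natr_sum.
  have -> : size (t n).1.1 = size nus by rewrite -(nodeW n) size_map.
  move: n1 n2; cbv beta; set d := _ `^ _; have d0 : 0 < d by rewrite powR_gt0 // ltr0n.
  rewrite -mulr_suml -mulrBl normrM [`|d^-1|]ger0_norm ?invr_ge0 ?(ltW d0) //.
  rewrite ltr_pdivlMr // ltr_pdivrMr //; set y := `|_ - _|; set r := (rpow _ _ _)%:R.
  move=> h1 h2; apply: le_trans (_ : M.+1%:R * y <= _).
    by apply: ler_wpM2r; [exact: normr_ge0 | rewrite ler_nat].
  have : M.+1%:R * y <= M.+1%:R * (M.+1%:R^-1 / 2 * d) by apply: ler_wpM2l; [exact: ler0n | exact: ltW].
  rewrite !mulrA mulfV ?pnatr_eq0 // => h3; apply: le_trans h3 _.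
  exact: ltW.
have [W0 [WA0 nidW0 _]] := balls_ex sc presP psi 0 E nusS.
have [j0 gj0] := name_list named WA0.
have /boolp.choice[t tP] : forall n, exists t : seq nat * nat * seq nat * (nat * nat),
    [/\ forall c, c \in t.1.1.1 -> inA c, map node t.1.1.1 = nus, small t.2.1 E t.1.1.1,
        exists i, f i = atom (rep t.2.1 (cen E t.1.1.1)) t.1.1.2 &
        [/\ forall j, (j < size t.1.1.1)%N -> exists i, f i =
          atom (rep t.2.1 (act (coefs E j) (mid (nth 0 t.1.1.1 j)%N))) (nth 0 t.1.2 j)%N,
          (n < t.2.1)%N, (n < t.2.2)%N &
          (n.+1 * absdiff (rpow t.1.1.2 (numc (h t.2.2)) (denc (h t.2.2)))
            (\sum_(i < size nus) rpow (nth 0 t.1.2 i) (numc (h t.2.2)) (denc (h t.2.2))) <=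
            rpow t.2.1 (numc (h t.2.2)) (denc (h t.2.2)))%N]].
  (* The test is taken at precision n + 1; its witnesses for all n form the sequences whose limits
     are compared. *)
  move=> n; have [y [s [j [k [+ sP]]]]] := thP [:: j0; 0; 0; 0; seq_code E; n.+1]%N.
  rewrite /th_sep [nth 0%N [:: j0; _; _; _; _; _] 0]/= gj0.
  rewrite [nth 0%N [:: j0; _; _; _; _; _] 4]/= [nth 0%N [:: j0; _; _; _; _; _] 5]/= seq_codeK.
  rewrite (nid_nodes nidW0) inc implyTb nidW0.
  move=> /and5P[/eqP nidW ltN ltk smW /and3P[/sP Uf /allP Usf]]; rewrite sumn_ord.
  have nodeW := nid_nodes nidW; have sizeW : size (seq_decode (g j)) = size nus.
    by rewrite -nodeW size_map.
  rewrite sizeW => le_n.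
  exists (seq_decode (g j), nth 0%N y 1, seq_decode (nth 0%N y 2), (nth 0%N y 0, k)).
  split=> //=; first by move=> c cj; exact: (name_in named cj).
  split=> //; last exact: ltnW.
  by move=> j' lt_j'; apply/sP/Usf; rewrite mem_iota.
have [||||||| c1 c2 c3] := @sep_limits nus E (fun n => (t n).2.1) (fun n => (t n).2.2)
  (fun n => (t n).1.1.2) (fun n => (t n).1.1.1) (fun n => (t n).1.2).
- by move=> n; have [_ _ _ _ []] := tP n.
- by move=> n; have [_ _ _ _ []] := tP n.
- by move=> n; have [] := tP n.
- by move=> n; have [] := tP n.
- by move=> n; have [] := tP n.
- by move=> n; have [] := tP n.
- by move=> n; have [_ _ _ _ []] := tP n.
apply: (cvg_eq_of_dist c1 c2 c3) => n; have [_ _ _ _ [_ ltN _ le_n]] := tP n.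
set d := _ `^ _; have d0 : 0 < d by rewrite powR_gt0 // ltr0n (leq_ltn_trans _ ltN).
rewrite -mulr_suml -mulrBl normrM [`|d^-1|]ger0_norm ?invr_ge0 ?(ltW d0) //.
rewrite mulrA ler_pM2r ?invr_gt0 // -natr_sum -absdiffE -natrM ler_nat.
exact: le_n.
Qed.

End Separation.

(** * Summativity *)

Lemma childP q c : reflect (exists k, node c = rcons (seq_decode q) k) (child q c).
Proof.
rewrite /child; apply: (iffP andP) => [[size0 /eqP <-]|[k ->]]; last first.
  by rewrite size_rcons /= -cats1 take_size_cat.
by case: (lastP (node c)) size0 => // s k _; exists k; rewrite size_rcons /= -cats1 take_size_cat // cats1.
Qed.

Lemma incomparable_rcons nu k k' : k != k' -> incomparable (rcons nu k) (rcons nu k').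
Proof.
move=> neq; have nprefix a b : a != b -> ~~ prefix (rcons nu a) (rcons nu b).
  by apply: contra; rewrite prefixE !size_rcons -(size_rcons nu b) take_size eqseq_rcons eqxx eq_sym.
by rewrite /incomparable !nprefix // eq_sym.
Qed.

Lemma pairwise_children nu ks : uniq ks -> pairwise incomparable (map (rcons nu) ks).
Proof.
elim: ks => //= k ks IHks /andP[kks /IHks ->]; rewrite andbT all_map.
by apply/allP => k' k'ks /=; apply: incomparable_rcons; apply: contraNneq kks => ->.
Qed.

Lemma incomparable_uniq (nus : seq (seq nat)) : pairwise incomparable nus -> uniq nus.
Proof.
elim: nus => //= nu nus IHnus /andP[/allP inc /IHnus ->]; rewrite andbT.
by apply/negP => /inc; rewrite /incomparable prefix_refl.
Qed.

Section SubsetSums.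
Context (T : eqType) (A : zmodType).

Lemma big_uniq_subset (F : T -> A) (r s : seq T) : uniq r -> uniq s -> {subset s <= r} ->
  \sum_(k <- r) F k = \sum_(k <- s) F k + \sum_(k <- [seq k <- r | k \notin s]) F k.
Proof.
move=> ur us sr; rewrite (bigID (mem s)) /= [in RHS]big_filter; congr (_ + _).
rewrite -big_filter; apply: perm_big; apply: uniq_perm => //; first exact: filter_uniq.
by move=> k; rewrite mem_filter; case: (boolP (k \in s)) => // /sr ->.
Qed.

End SubsetSums.

Section Summation.
Context (R : realType) (K : numFieldType) (toR : K -> R) (ratsc : nat -> K).
Context (iota_sc : K) (rotsc : nat -> nat) (e0 : nat).
Hypothesis sc : scalar_spec toR ratsc iota_sc rotsc e0.
Context (V : completeNormedModType K) (P : nat -> V) (f : nat -> nat).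
Hypotheses (presP : presentation P) (namesP : names_pres toR ratsc P f).
Context (S : set (seq nat)) (psi : seq nat -> V) (g h : nat -> nat).
Hypothesis named : names_tree toR ratsc P S psi g.
Context (p : R).
Hypotheses (p0 : 0 < p) (sepS : Lp_separating toR p S psi).
Local Notation nrm := (@nrm R K toR V).
Local Notation rv := (rv ratsc P).
Local Notation inA := (inA toR ratsc P S psi).
Local Notation lc := (lincomb iota_sc psi).
Local Notation cen := (cen rotsc).

Definition kids nu (ks : seq nat) := uniq ks /\ forall k, k \in ks -> S (rcons nu k).

Definition kid_sum nu (ks : seq nat) : V := \sum_(k <- ks) psi (rcons nu k).
Definition kid_mass nu (ks : seq nat) : R := \sum_(k <- ks) nrm (psi (rcons nu k)) `^ p.

(** Distinct children of a node are incomparable, so this is formal disjointness with all scalars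
    equal to 1. *)
Lemma kid_sum_mass nu ks : kids nu ks -> nrm (kid_sum nu ks) `^ p = kid_mass nu ks.
Proof.
move=> [uks ksS]; have := @sepS (map (rcons nu) ks) _ (pairwise_children nu uks) (fun=> 1).
rewrite !size_map /kid_sum /kid_mass normr1 (toR1 sc) => sepE.
transitivity (nrm (\sum_(j < size ks) 1 *: [seq psi i | i <- [seq rcons nu i | i <- ks]]`_j) `^ p).
  congr (nrm _ `^ p); rewrite (big_nth 0%N) big_mkord; apply: eq_bigr => i _.
  by rewrite scale1r (nth_map [::]) ?size_map // (nth_map 0%N).
rewrite sepE; last by move=> mu /mapP[k kks ->]; exact: ksS.
rewrite (big_nth 0%N) big_mkord; apply: eq_bigr => i _.
by rewrite powR1 mul1r (nth_map [::]) ?size_map // (nth_map 0%N).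
Qed.

Lemma lincomb_opp nus n : size nus = n ->
  lc (nseq n (opp_coef e0)) nus = - \sum_(mu <- nus) psi mu.
Proof.
move=> <-; elim: nus => [|nu nus IHnus]; first by rewrite lincomb_nil big_nil oppr0.
by rewrite lincomb_cons IHnus (zcoef_opp sc) scaleN1r big_cons opprD.
Qed.

Lemma lincomb_sum nu nus : lc (sum_coefs e0 (size (nu :: nus))) (nu :: nus) =
  psi nu - \sum_(mu <- nus) psi mu.
Proof. by rewrite /sum_coefs lincomb_cons zcoef_one scale1r lincomb_opp. Qed.

Definition kids_below nu M := [seq k <- iota 0 M | `[< S (rcons nu k) >]].

Lemma kids_belowP (nu : seq nat) M : kids nu (kids_below nu M).
Proof.
split; first by rewrite filter_uniq // iota_uniq.
by move=> k; rewrite mem_filter => /andP[/asboolP].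
Qed.

Lemma partial_sumE (nu : seq nat) M :
  \sum_(k < M | `[< S (rcons nu k) >]) psi (rcons nu k) = kid_sum nu (kids_below nu M).
Proof.
rewrite /kid_sum big_filter -[X in iota _ X]subn0 -/(index_iota 0 M) big_mkord.
exact: eq_bigl.
Qed.

Lemma finite_sum_witness (nu : seq nat) : S nu ->
  (fun M => kid_sum nu (kids_below nu M)) @ \oo --> psi nu ->
  forall c0 G N, node c0 = nu -> (forall c, c \in G -> inA c) -> all (child (nid c0)) G ->
  exists W j i, [/\ seq_decode (g j) = W, f i = atom (rep N (cen (sum_coefs e0 (size W)) W)) 0 &
    [/\ (0 < size W)%N, nid (nth 0 W 0)%N = nid c0, all (child (nid c0)) (behead W),
     pairwise incomparable (map node (behead W)) &
     all (fun c => nid c \in map nid (behead W)) G /\ small N (sum_coefs e0 (size W)) W]].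
Proof.
move=> Snu /(cvg_nrmP sc) cnu c0 G N nodec0 GA childG.
(* Half of the tolerance 1 / (N + 1) is for the convergence of the partial sums, the other half for
   the ball centres. *)
have e1 : 0 < (2 * N.+1%:R)^-1 :> R by rewrite invr_gt0 mulr_gt0 // ltr0n.
have [M0 M0P] := cnu _ e1.
(* Beyond the last entry of every node in G, so that the partial sum contains all the children
   prescribed. *)
pose M := (M0 + \sum_(c <- G) (last 0 (node c)).+1)%N.
have lt_M := M0P M (leq_addr _ _).
set ks := kids_below nu M in lt_M; have [uks ksS] := kids_belowP nu M.
pose nus := nu :: map (rcons nu) ks; set E := sum_coefs e0 (size nus).
have nusS mu : mu \in nus -> S mu.
  by rewrite in_cons => /predU1P[->//|/mapP[k kks ->]]; exact: ksS.
have [W [WA nidW smW]] := balls_ex sc presP psi (2 * N.+1)%N E nusS.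
have nodeW := nid_nodes nidW.
have sizeW : size W = size nus by rewrite -nodeW size_map.
have [j gj] := name_list named WA.
have appW := lincomb_approx sc WA smW.
have smN : small N E W.
  move: smW => /allP smW; apply/allP => c /smW; apply: leq_trans.
  by rewrite leq_mul2r leq_mul2r; apply/orP; right; apply/orP; right; lia.
have [i fi] : exists i, f i = atom (rep N (cen E W)) 0.
  apply/(atomP namesP); rewrite subr0 ger0_norm ?(nrm_ge0 sc) // rv_rep (nrmMn sc).
  rewrite nodeW lincomb_sum big_map -/(kid_sum nu ks) in appW.
  have tri := nrmD sc (psi nu - kid_sum nu ks) (rv (cen E W) - (psi nu - kid_sum nu ks)).
  rewrite addrC subrK [nrm (rv _ - _)]nrm_distC in tri.
  rewrite nrm_distC in lt_M.
  set a := nrm (rv _) in tri *; set b := nrm (psi nu - _) in tri lt_M; set d := nrm (_ - rv _) in tri appW.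
  have N0 : 0 < N.+1%:R :> R by rewrite ltr0n.
  have h1 : 2 * (N.+1%:R * b) < 1 by rewrite mulrA mulrC -ltr_pdivlMr ?mulr_gt0 // mul1r.
  rewrite natrM -mulrA in appW.
  have h2 : N.+1%:R * a <= N.+1%:R * b + N.+1%:R * d.
    by rewrite -mulrDr; apply: ler_wpM2l; [exact: ltW | exact: tri].
  apply: le_lt_trans (_ : N.+1%:R * a < 1); last lra.
  by rewrite ler_wpM2r ?(nrm_ge0 sc) // ler_nat.
exists W, j, i; rewrite sizeW; split=> //.
case: W nidW nodeW sizeW smN {WA smW gj appW fi} => [|w W'] //= [nidw nidW'] [nodew nodeW'] sizeW smN.
have nidc0 : nid c0 = seq_code nu by rewrite -nodec0 /node seq_decodeK.
split=> //.
- by rewrite nidw nidc0.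
- apply/allP => c cW; apply/childP; rewrite nidc0 seq_codeK.
  have : node c \in map (rcons nu) ks by rewrite -nodeW' map_f.
  by case/mapP => k _ ->; exists k.
- by rewrite nodeW'; exact: pairwise_children.
split=> //; apply/allP => c cG; have /childP[k nodec] := allP childG _ cG.
rewrite nidW'; apply/mapP; exists (node c); last by rewrite /node seq_decodeK.
rewrite nodec nidc0 seq_codeK; apply: map_f; rewrite mem_filter; apply/andP; split.
  by apply/asboolP; have [] := GA c cG; rewrite nodec nidc0 seq_codeK.
rewrite mem_iota add0n /M /=; apply: leq_trans (leq_addl _ _).
by rewrite (big_rem c) //= nodec last_rcons leq_addr.
Qed.

Lemma kid_mass_le nu G F : uniq G -> uniq F -> {subset G <= F} ->
  kid_mass nu G <= kid_mass nu F.
Proof.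
move=> uG uF GF; rewrite /kid_mass (big_uniq_subset _ uF uG GF) lerDl.
by apply: sumr_ge0 => k _; exact: powR_ge0.
Qed.

(* The masses of finite sets of children are bounded, and a set [G] whose mass is nearly maximal
   controls all later partial sums. *)
Lemma summative_of_finite nu : (exists k, S (rcons nu k)) ->
  (forall G (e : R), kids nu G -> G != [::] -> 0 < e ->
    exists F, [/\ kids nu F, {subset G <= F} & nrm (psi nu - kid_sum nu F) < e]) ->
  (fun M => kid_sum nu (kids_below nu M)) @ \oo --> psi nu.
Proof.
move=> [k0 Sk0] fin.
(* Restricted to nonempty sets, because [th_sum] only speaks about lists with at least one child. *)
pose masses := [set x | exists G, [/\ kids nu G, G != [::] & x = kid_mass nu G]].
(* G extends to a set F whose sum is within 1 of the node; the mass of F is the p-th power of the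
   norm of that sum. *)
have ub G : kids nu G -> G != [::] -> kid_mass nu G <= (nrm (psi nu) + 1) `^ p.
  move=> kG G0; have [F [kF GF lt1]] := fin G 1 kG G0 ltr01.
  apply: le_trans (kid_mass_le nu kG.1 kF.1 GF) _; rewrite -(kid_sum_mass kF).
  apply: ge0_ler_powR; rewrite ?nnegrE ?addr_ge0 ?(nrm_ge0 sc) ?ltW //.
  have := nrmD sc (kid_sum nu F - psi nu) (psi nu); rewrite subrK.
  by rewrite nrm_distC in lt1; lra.
have k0kid : kids nu [:: k0] by split=> // k; rewrite inE => /eqP->.
have hs : has_sup masses.
  split; first by exists (kid_mass nu [:: k0]), [:: k0].
  by exists ((nrm (psi nu) + 1) `^ p) => x [G [kG G0 ->]]; exact: ub.
apply/(cvg_nrmP sc) => e e1; have e2 : 0 < e / 2 by lra.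
have ep : 0 < (e / 2) `^ p by exact: powR_gt0.
have [_ [G [kG G0 ->]] lt_G] := sup_adherent ep hs.
have [F [kF GF lt_F]] := fin G _ kG G0 e2.
exists (\sum_(k <- F) k.+1)%N => M le_M.
have FM : {subset F <= kids_below nu M}.
  move=> k kF'; rewrite mem_filter; apply/andP; split; first exact/asboolP/kF.2.
  rewrite mem_iota add0n; apply: leq_trans le_M.
  by rewrite (big_rem k) //= leq_addr.
have kM := kids_belowP nu M; set ks := kids_below nu M in FM kM *.
pose D := [seq k <- ks | k \notin F].
have kD : kids nu D.
  split; first exact: filter_uniq kM.1.
  by move=> k; rewrite mem_filter => /andP[_]; exact: kM.2.
have sumE : kid_sum nu ks = kid_sum nu F + kid_sum nu D.
  exact: (big_uniq_subset _ kM.1 kF.1 FM).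
have massE : kid_mass nu ks = kid_mass nu F + kid_mass nu D.
  exact: (big_uniq_subset _ kM.1 kF.1 FM).
have le_sup : kid_mass nu ks <= sup masses.
  apply: ub_le_sup; first by case: hs.
  exists ks; split=> //; case: (G) G0 GF => // k G' _ GF.
  by have := FM _ (GF k (mem_head _ _)); case: (ks).
(* The mass of D is that of [ks] minus that of F, hence at most sup minus the mass of G, which is
   below (e/2)^p. By disjointness it equals the p-th power of the norm of the sum over D. *)
have lt_D : nrm (kid_sum nu D) < e / 2.
  rewrite ltNge; apply/negP => le_e.
  have : (e / 2) `^ p <= nrm (kid_sum nu D) `^ p.
    by apply: ge0_ler_powR; rewrite ?nnegrE ?(nrm_ge0 sc) ?(ltW p0) ?(ltW e2).
  rewrite (kid_sum_mass kD); have := kid_mass_le nu kG.1 kF.1 GF.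
  lra.
rewrite sumE addrAC; have := nrmD sc (kid_sum nu F - psi nu) (kid_sum nu D).
by rewrite nrm_distC in lt_F; lra.
Qed.

Lemma sum_iff : summative S psi <-> forall_exists (th_sum rotsc e0) f g h.
Proof.
have sumE (nu : seq nat) : (fun M : nat => \sum_(k < M | `[< S (rcons nu k) >]) psi (rcons nu k)) =
    (fun M => kid_sum nu (kids_below nu M)).
  by apply/funext => M; exact: partial_sumE.
split=> [sumS x|thP nu Snu kidS].
  rewrite /th_sum; set L := seq_decode (g (nth 0 x 0)%N).
  have [/andP[size_L childL]|npre] := boolP ((1 < size L)%N && _); last first.
    by exists [::], [::], 0%N, 0%N.
  have [Sc0 _] := name_nth named (ltnW size_L); rewrite -/L in Sc0.
  have LA c : c \in behead L -> inA c.
    by move=> cL; apply: (@name_in _ _ _ _ _ _ _ _ _ named (nth 0 x 0)%N); exact: mem_behead.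
  have kidS : exists k, S (rcons (node (nth 0 L 0)%N) k).
    have L1 : nth 0%N L 1 \in behead L by rewrite -nth_behead mem_nth // size_behead -subn1 ltn_subRL.
    have /childP[k nodek] := allP childL _ L1; exists k.
    by have [] := LA _ L1; rewrite nodek.
  have := sumS _ Sc0 kidS; rewrite sumE => cnu.
  have [W [j [i [gj fi [W0 nidW0 childW incW [GW smW]]]]]] :=
    finite_sum_witness Sc0 cnu (nth 0 x 4)%N erefl LA childL.
  exists [:: nth 0%N x 4], [:: f i], j, 0%N; split; last first.
    by move=> v; rewrite inE => /eqP->; exists i.
  by rewrite gj /= W0 nidW0 eqxx childW incW GW leqnn smW fi mem_head.
rewrite sumE; apply: summative_of_finite => // G e [uG GS] G0 e1.
(* The test bounds N times the distance by 2 for some N >= M, which makes the distance less than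
   e. *)
have [M lt_M] := nat_above (2 / e).
have [|W0 [W0A nidW0 _]] := @balls_ex _ _ _ _ _ _ _ sc _ _ presP S psi 0 [::] (nu :: map (rcons nu) G).
  by move=> mu; rewrite in_cons => /predU1P[->//|/mapP[k kG ->]]; exact: GS.
have [j0 gj0] := name_list named W0A.
have [y [s [j [k [+ sP]]]]] := thP [:: j0; 0; 0; 0; M]%N.
rewrite /th_sum [nth 0%N [:: j0; _; _; _; _] 0]/= gj0 [nth 0%N [:: j0; _; _; _; _] 4]/=.
case: W0 nidW0 {W0A gj0} => // w0 W0 [nidw0 nidW0].
have size_W0 : (0 < size W0)%N.
  by rewrite -(size_map nid) nidW0 !size_map; case: (G) G0.
have nodeW0 := nid_nodes nidW0.
have childW0 : all (child (nid w0)) W0.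
  apply/allP => c cW; apply/childP; rewrite nidw0 seq_codeK.
  have : node c \in map (rcons nu) G by rewrite -nodeW0 map_f.
  by case/mapP => k' _ ->; exists k'.
rewrite [nth 0%N (w0 :: W0) 0]/= [size (w0 :: W0)]/= [behead (w0 :: W0)]/= ltnS size_W0 childW0 implyTb.
set W := seq_decode (g j); set N := nth 0%N y 0.
move=> /and5P[size_W /eqP nidW childW incW /and4P[/allP GW le_M smW /sP Uf]].
have WA c : c \in W -> inA c by exact: (name_in named).
have := approx_atom sc namesP WA smW Uf; rewrite subr0.
case: W size_W nidW childW incW GW smW WA {Uf} => // w W' _ /= nidw childW incW GW smW WA.
have nodew : node w = nu by rewrite /node nidw nidw0 seq_codeK.
have nodeW c : c \in W' -> node c = rcons nu (last 0%N (node c)).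
  by move=> /(allP childW)/childP[k']; rewrite nidw0 seq_codeK => ->; rewrite last_rcons.
(* The children are recovered from the last entries of their nodes; incomparability of the nodes
   makes this list free of repetitions. *)
pose F := [seq last 0%N (node c) | c <- W'].
have FE : map node W' = map (rcons nu) F.
  by rewrite /F -map_comp; apply/eq_in_map => c /nodeW.
rewrite nodew -(size_map node W') -[(size (map node W')).+1]/(size (nu :: map node W')).
rewrite lincomb_sum FE big_map.
rewrite -/(kid_sum nu F) ger0_norm; last by rewrite mulr_ge0 ?ler0n ?(nrm_ge0 sc).
move=> lt2; exists F; split.
- split.
    by have := incomparable_uniq incW; rewrite FE; exact: map_uniq.
  move=> k' /mapP[c cW ->]; rewrite -nodeW //.
  by have [] := WA c; rewrite ?in_cons ?cW ?orbT.
- move=> k' k'G; have : rcons nu k' \in map node W'.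
    have : rcons nu k' \in map node W0 by rewrite nodeW0 map_f.
    case/mapP => c cW0 ->; have /mapP[d dW nidE] := GW c cW0.
    by apply/mapP; exists d => //; rewrite /node nidE.
  by rewrite FE => /mapP[k'' k''F /rcons_inj[->]].
- have M0 : 0 < M%:R :> R by apply: lt_trans lt_M; rewrite divr_gt0.
  have N0 : 0 < N%:R :> R by apply: lt_le_trans M0 _; rewrite ler_nat.
  rewrite -(ltr_pM2l N0); apply: lt_trans lt2 _.
  rewrite -ltr_pdivrMr //; apply: lt_le_trans lt_M _.
  by rewrite ler_nat.
Qed.

End Summation.

(** * Real and complex scalars *)

Lemma Thm41_of_scalars (R : realType) (K : numFieldType) (toR : K -> R) (ratsc : nat -> K)
    (iota_sc : K) (rotsc : nat -> nat) (e0 : nat) :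
  scalar_spec toR ratsc iota_sc rotsc e0 -> PR rotsc -> Thm41_for toR ratsc.
Proof.
move=> sc PRrot; exists (forall_exists (disint_matrix rotsc e0)); split.
  exact/Pi02_forall_exists/PR_disint_matrix.
move=> V P f g h p presP namesP realP p1; have p0 : 0 < p by exact: lt_le_trans p1.
rewrite matrix_split; split.
  move=> [h1 h2 h3 h4 [h5 h6 h7 h8 [h9 h10]]].
  have [//|S [psi named]] := @base_names_tree _ _ _ _ _ _ _ sc _ _ _ namesP g h.
  (* Established before summativity, whose finite criterion assumes it. *)
  have sepS : Lp_separating toR p S psi by apply/(sep_iff sc presP namesP named realP p1).
  exists S, psi; split=> //; split=> //.
  - split; first exact/(tree_iff sc presP namesP h named).
    exact/(inj_iff sc presP namesP h named).
  - exact/(sum_iff sc presP namesP h named p0 sepS).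
  - exact/(nonzero_iff sc presP namesP h named).
  - exact/(dense_iff sc presP namesP h named).
move=> [S [psi [[[treeS injS] sumS sepS nzS denseS] named]]].
have [h1 h2 h3 h4] := names_tree_base sc presP namesP named h.
split=> //; split.
- exact/(tree_iff sc presP namesP h named).
- exact/(inj_iff sc presP namesP h named).
- exact/(nonzero_iff sc presP namesP h named).
- exact/(sum_iff sc presP namesP h named p0 sepS).
- split; first exact/(sep_iff sc presP namesP named realP p1).
  exact/(dense_iff sc presP namesP h named).
Qed.

Section Scalars.
Context (R : realType).

Lemma rat_approx (a e : R) : 0 < e -> exists n, `|a - ratr (rat_of_nat n)| < e.
Proof.
move=> e0; have [|q] := @rat_in_itvoo R (a - e) (a + e); first lra.
rewrite in_itv /= => /andP[h1 h2]; exists (pickle q); rewrite /rat_of_nat pickleK /=.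
by rewrite ltr_norml; apply/andP; split; lra.
Qed.

Lemma floor_approx (a : R) : exists (b : bool) (n : nat), `|a - (-1) ^+ b *+ n| <= 1.
Proof.
have /andP[h1 h2] := real_floor_itv (num_real a); rewrite intrD in h2.
exists (Num.floor a < 0), `|Num.floor a|%N.
have -> : (-1) ^+ (Num.floor a < 0)%R *+ `|Num.floor a|%N = (Num.floor a)%:~R :> R.
  by case: (Num.floor a) => n /=; rewrite ?expr1 ?expr0 // NegzE mulrNz mulNrn.
by rewrite ler_norml; apply/andP; split; lra.
Qed.

(** The root of unity is -1, with exponent 1: sums of its powers are the integers, and the integer
    part is within 1. *)
Lemma scalars_real : scalar_spec (fun x : R => x) (@ratsc_real R) (-1) negc 1.
Proof.
split=> //.
- by move=> e e0; exists e.
- by move=> n; rewrite /ratsc_real rat_of_nat_negc rmorphN mulN1r.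
- by move=> a e; exact: rat_approx.
move=> a; have [b [n le1]] := floor_approx a; exists (nseq n (nat_of_bool b)).
by rewrite big_nseq iter_addr_0; apply: le_trans le1 _; rewrite ler1n.
Qed.

(** From i (a + ib) = -b + ia. *)
Definition roti n := pair_code (negc (unpair n).2) (unpair n).1.

Lemma PR_roti : PR roti.
Proof.
by apply: PR_pair_code; [apply: (PR_negc (F := fun n => (unpair n).2)) |]; pr.
Qed.

Lemma Re_norm_le (x y : R) : Re `|Complex x y| <= `|x| + `|y|.
Proof.
rewrite normc_def /= -[leRHS]ger0_norm ?addr_ge0 // -sqrtr_sqr ler_wsqrtr // sqrrD.
by rewrite !real_normK ?num_real // lerD2r lerDl mulrn_wge0 // mulr_ge0.
Qed.

Lemma scalars_complex : scalar_spec (fun z : R[i] => Re z) (@ratsc_cplx R) 'i%C roti 2.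
Proof.
(* The order of R[i] makes nonnegative elements real, so on them the real part is multiplicative and
   reflects the order. *)
have Im0 (x : R[i]) : 0 <= x -> Im x = 0 by rewrite lecE => /andP[/eqP].
split=> //.
- by move=> x y _ _; rewrite raddfD.
- by move=> [a b] [c d] /Im0 /= -> /Im0 /= ->; rewrite mulr0 subr0.
- by move=> [a b] [c d] /Im0 /= -> /Im0 /= ->; rewrite lecE /= eqxx.
- by move=> e e0; exists e%:C%C => //; rewrite ltcE /= eqxx.
- move=> n; rewrite /ratsc_cplx /roti unpairK /= rat_of_nat_negc rmorphN.
  by apply/eqP; rewrite eq_complex /=; apply/andP; split; apply/eqP; ring.
- exact: sqr_i.
- move=> [x y] e e0; have e2 : 0 < e / 2 by lra.
  have [n lt_n] := rat_approx x e2; have [m lt_m] := rat_approx y e2.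
  exists (pair_code n m); rewrite /ratsc_cplx unpairK /=.
  apply: le_lt_trans (Re_norm_le (x - ratr (rat_of_nat n)) (y - ratr (rat_of_nat m))) _.
  by rewrite [ltRHS](splitr e) ltrD.
move=> [x y]; have [b [n le_n]] := floor_approx x; have [d [m le_m]] := floor_approx y.
(* Exponents 0 and 2 produce the signed integer for the real part, 1 and 3 that for the imaginary
   part. Each is rounded within 1, hence the bound 2. *)
exists (nseq n b.*2 ++ nseq m d.*2.+1); rewrite big_cat !big_nseq !iter_addr_0 /=.
have iX (c : bool) : 'i%C ^+ c.*2 = ((-1) ^+ c)%:C%C :> R[i].
  by case: c; rewrite ?sqr_i ?rmorphN ?rmorph1.
have -> : 'i%C ^+ b.*2 *+ n + 'i%C ^+ d.*2.+1 *+ m =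
    Complex ((-1) ^+ b *+ n) ((-1) ^+ d *+ m) :> R[i].
  rewrite exprS !iX -mulrnAr -!rmorphMn.
  by apply/eqP; rewrite eq_complex /=; apply/andP; split; apply/eqP; ring.
apply: le_trans (Re_norm_le (x - (-1) ^+ b *+ n) (y - (-1) ^+ d *+ m)) _.
lra.
Qed.

End Scalars.

(* Scalar field R (real case) and C = R[i] (complex case). *)
Theorem theorem4p1 (R : realType) :
  Thm41_for (fun x : R => x) (@ratsc_real R) /\
  Thm41_for (fun z : R[i] => Re z) (@ratsc_cplx R).
Proof.
split.
  apply: (Thm41_of_scalars (scalars_real R)).
  by apply: (PR_negc (F := id)); exact: PR_id.
exact: (Thm41_of_scalars (scalars_complex R) PR_roti).
Qed.
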